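(* Let $A\in\mathbb{C}^{n\times n}$ be a normal matrix whose eigenvalues $\lambda_1,\ldots,\lambda_n$ (listed with multiplicity) do not all lie on one line, are arranged in a counterclockwise orientation with respect to $\mathrm{trace}(A)/n$, and are such that no eigenvalue of $A$ is in the interior of $W(A)$. If $\mu_1\in W(A)$, then $$\mathrm{conv}[\mathcal{B}_A(\mu_1)]=\mathcal{R}_A(\mu_1).$$
   Context: $W(A)=\{x^*Ax: x\in\mathbb{C}^n,\ \|x\|=1\}$ is the numerical range; $\partial W(A)$ is its boundary. $\sigma(A)$ is the spectrum, counted with multiplicity; $\ominus$ denotes set difference counting multiplicities (if $\lambda$ has multiplicity $m$ in $\sigma(A)$ and appears $k$ times in $K$, it appears $m-k$ times in $\sigma(A)\ominus K$). $\mathrm{conv}$ is convex hull; $(a,b)$ and $[a,b]$ denote open and closed line segments in $\mathbb{C}$. $\lambda_1,\dots,\lambda_n$ being arranged counterclockwise with respect to $c=\mathrm{trace}(A)/n$ means that arguments $\theta_j$ of $\lambda_j-c$ can be chosen with $\theta_1\le\theta_2\le\cdots\le\theta_n<\theta_1+2\pi$. Indices are read modulo $n$. $\Lambda_2(A)=\{\lambda\in\mathbb{C}: PAP=\lambda P \text{ for some rank-2 orthogonal projection } P\}$ is the rank-2 numerical range. $\mathcal{B}_A(\mu_1)$ is the set of all $\mu_2\in\mathbb{C}$ for which there is $V\in\mathbb{C}^{n\times 2}$ with $V^*V=I_2$ and $V^*AV=\begin{bmatrix}\mu_1&*\\0&\mu_2\end{bmatrix}$ ($*$ arbitrary). Isogonal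 conjugate: for non-collinear $a,b,c\in\mathbb{C}$ and $\mu\in\mathrm{conv}\{a,b,c\}\setminus\{a,b,c\}$, for each vertex $v\in\{a,b,c\}$ let $\ell_v$ be the line through $v$ and $\mu$ and let $\mathcal{L}_v$ be the reflection of $\ell_v$ about the bisector of the triangle's angle at $v$. The isogonal conjugate of $\mu$ with respect to $\mathrm{conv}\{a,b,c\}$ is the common point of $\mathcal{L}_a,\mathcal{L}_b,\mathcal{L}_c$. For $\mu_1\notin\sigma(A)$ and a set $K$ of three non-collinear eigenvalues of $A$, put $\mathcal{E}_K(\mu_1)=\{w_K\}\cup[\sigma(A)\ominus K]$ if $\mu_1\in\mathrm{conv}(K)$, where $w_K$ is the isogonal conjugate of $\mu_1$ with respect to $\mathrm{conv}(K)$, and $\mathcal{E}_K(\mu_1)=\varnothing$ otherwise. The region $\mathcal{R}_A(\mu_1)$ is defined by: (1) $\mathcal{R}_A(\mu_1)=W(A)$ if $\mu_1\in\Lambda_2(A)$; (2) $\mathcal{R}_A(\mu_1)=\mathrm{conv}[\sigma(A)\ominus\{\lambda_i\}]$ if either $\mu_1=\lambda_i$ with $\lambda_i\notin\Lambda_2(A)$, or $\mu_1\in W(A)\setminus\Lambda_2(A)$ and $\mu_1\in(\lambda_i,\lambda_j)$ where $\lambda_i,\lambda_j$ are cyclically consecutive eigenvalues ($j=i+1$ or $j=i-1$ modulo $n$) with $[\lambda_i,\lambda_j]\subseteq\partial W(A)$, $\lambda_i\notin\Lambda_2(A)$ and $\lambda_j\in\Lambda_2(A)$; (3) $\mathcal{R}_A(\mu_1)=\mathrm{conv}[\sigma(A)\ominus\{\lambda_i,\lambda_{i+1}\}]$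 if $\mu_1\in W(A)\setminus\Lambda_2(A)$ and $\mu_1\in(\lambda_i,\lambda_{i+1})$ where $[\lambda_i,\lambda_{i+1}]\subseteq\partial W(A)$ and $\lambda_i,\lambda_{i+1}\notin\Lambda_2(A)$; (4) $\mathcal{R}_A(\mu_1)=\mathrm{conv}\left[\bigcup_K\mathcal{E}_K(\mu_1)\right]$, the union over all sets $K$ of three non-collinear eigenvalues, if $\mu_1\in W(A)\setminus(\Lambda_2(A)\cup\partial W(A))$. *)

(* Defs.v *)
From mathcomp Require Export all_boot all_order all_algebra.
From mathcomp Require Export complex spectral.
From mathcomp Require Export all_classical all_reals all_analysis.

Set Implicit Arguments.
Unset Strict Implicit.
Unset Printing Implicit Defensive.

Import Order.TTheory GRing.Theory Num.Theory.
Import numFieldNormedType.Exports.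

Local Open Scope classical_set_scope.
Local Open Scope sesquilinear_scope.
Local Open Scope ring_scope.
Local Open Scope complex_scope.

(* The complex plane is R[i] for R : realType.  Its topology and its structure
   of module over itself are carried by the regular module R[i]^o, which is
   convertible to R[i]. *)

Section PlaneGeometry.
Variable R : realType.
Implicit Types (a b c d p q v z w mu : R[i]) (S : set R[i]).

(* The weights of a convex combination are elements of {i01 R[i]}; since
   0 <= t <= 1 in R[i] forces t to be real, this is real convexity. *)
Definition conv_hull S : set R[i] := smallest (@convex_set R[i] R[i]^o) S.

Definition boundary S : set R[i] :=
  closure (S : set R[i]^o) `\` interior (S : set R[i]^o).

Definition closed_seg a b : set R[i] :=
  [set a + t%:C * (b - a) | t in `[0, 1]%classic].

Definition open_seg a b : set R[i] :=
  [set a + t%:C * (b - a) | t in `]0, 1[%classic].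

Definition line v d : set R[i] := [set v + t%:C * d | t in @setT R].

Definition collinear S : Prop := exists v d, d != 0 /\ S `<=` line v d.

Definition reflect_line v d z : R[i] := v + d / d^* * (z - v)^*.

(* Direction of the bisector of the angle at v of the triangle v, p, q: the sum
   of the unit vectors pointing from v to p and from v to q. *)
Definition bisector_dir v p q : R[i] :=
  (p - v) / `|p - v| + (q - v) / `|q - v|.

Definition reflected_cevian v p q mu : set R[i] :=
  reflect_line v (bisector_dir v p q) @` line v (mu - v).

(* When a, b, c are not collinear and mu lies in the triangle and is not one of
   its vertices, the three lines have exactly one common point. *)
Definition isogonal_conjugate a b c mu : R[i] :=
  xget 0 (reflected_cevian a b c mu `&` reflected_cevian b c a mu
          `&` reflected_cevian c a b mu).

(* c is the centre, and theta j an argument of the j-th point minus c. *)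
Definition counterclockwise n (lam : n.-tuple R[i]) c : Prop :=
  exists theta : 'I_n -> R,
    [/\ forall j, tnth lam j - c =
          `|tnth lam j - c| * (cos (theta j) +i* sin (theta j)),
        forall j k : 'I_n, (j <= k)%N -> theta j <= theta k
      & forall j k, theta k < theta j + 2 * pi].

End PlaneGeometry.

(* Removes from s one occurrence of each entry of K. *)
Definition multiset_diff (T : eqType) (s K : seq T) : seq T := foldr (@rem T) s K.

Section NumericalRanges.
Variables (R : realType) (n : nat).
Implicit Types (A : 'M[R[i]]_n) (lam : n.-tuple R[i]) (mu : R[i]).

Definition numerical_range A : set R[i] :=
  [set z | exists x : 'cV[R[i]]_n,
     x ^t* *m x = 1%:M /\ z = (x ^t* *m A *m x) 0 0].

Definition rank2_numerical_range A : set R[i] :=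
  [set z | exists P : 'M[R[i]]_n,
     [/\ P *m P = P, P ^t* = P, \rank P = 2%N & P *m A *m P = z *: P]].

Definition compression_range A mu : set R[i] :=
  [set nu | exists V : 'M[R[i]]_(n, 2), V ^t* *m V = 1%:M /\
     let M := V ^t* *m A *m V in [/\ M 0 0 = mu, M 1 0 = 0 & M 1 1 = nu]].

(* In this definition and in the next one, lam lists the eigenvalues of A with
   multiplicity. *)
Definition triangle_set lam mu a b c : set R[i] :=
  [set z | conv_hull [set a; b; c] mu /\
     (z = isogonal_conjugate a b c mu \/
      z \in multiset_diff lam [:: a; b; c])].

Local Notation W := numerical_range.
Local Notation W2 := rank2_numerical_range.
Local Notation eig := tnth.

Variant region_case A lam mu : set R[i] -> Prop :=
| RegionRank2 of W2 A mu :
    region_case A lam mu (W A)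
| RegionEigenvalue i of mu = eig lam i & ~ W2 A (eig lam i) :
    region_case A lam mu (conv_hull [set` multiset_diff lam [:: eig lam i]])
| RegionEdge1 i j of
    (W A `\` W2 A) mu & open_seg (eig lam i) (eig lam j) mu &
    j = ordS i \/ j = ord_pred i &
    closed_seg (eig lam i) (eig lam j) `<=` boundary (W A) &
    ~ W2 A (eig lam i) & W2 A (eig lam j) :
    region_case A lam mu (conv_hull [set` multiset_diff lam [:: eig lam i]])
| RegionEdge2 i of
    (W A `\` W2 A) mu & open_seg (eig lam i) (eig lam (ordS i)) mu &
    closed_seg (eig lam i) (eig lam (ordS i)) `<=` boundary (W A) &
    ~ W2 A (eig lam i) & ~ W2 A (eig lam (ordS i)) :
    region_case A lam mu
      (conv_hull [set` multiset_diff lam [:: eig lam i; eig lam (ordS i)]])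
| RegionInterior of (W A `\` (W2 A `|` boundary (W A))) mu :
    region_case A lam mu
      (conv_hull
        [set z | exists a b c,
           [/\ a \in lam, b \in lam, c \in lam,
               ~ collinear [set a; b; c] & triangle_set lam mu a b c z]]).

(* The set prescribed by the case that applies to mu.  For mu in W(A), under
   the hypotheses of the main theorem, exactly one set is prescribed. *)
Definition region A lam mu : set R[i] := xget set0 (region_case A lam mu).

End NumericalRanges.

(* Main.v *)
Require Import Defs.
From mathcomp Require Import perm ring lra.

Set Implicit Arguments.
Unset Strict Implicit.
Unset Printing Implicit Defensive.

Import Order.TTheory GRing.Theory Num.Theory.
Import numFieldNormedType.Exports.

Local Open Scope classical_set_scope.
Local Open Scope ring_scope.
Local Open Scope complex_scope.

Local Notation Re := complex.Re.
Local Notation Im := complex.Im.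

(* In an orthonormal eigenbasis, [mu2] belongs to [compression_range A mu1] when
   there are unit vectors [x], [y] such that the weights [|x k|^2] and [|y k|^2]
   represent [mu1] and [mu2] as convex combinations of the eigenvalues, and such
   that [y] is orthogonal to [x] and to [A x].  If [x k = 0], one can take for [y]
   the [k]-th basis vector, so an eigenvalue which is not needed to represent
   [mu1] is attained; if [x] is supported by three eigenvalues, [y] is unique on
   this support and gives the isogonal conjugate of [mu1].

   For the other inclusion in the interior case, let [h] be a real affine function
   which is nonpositive on the prescribed set.  The eigenvalues at which [h] is
   positive are all needed to represent [mu1].  If there is exactly one, an
   explicit sum of squares built on the triangle of its two neighbours gives
   [h mu2 <= 0]; if there are at least two, [mu1] is in all the triangles on two of
   them, and Cauchy-Schwarz reduces the claim to these triangles.  On an edge,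
   everything happens among the eigenvalues of that edge. *)

(** The region is selected by [xget] among the cases that apply. Each applicable case is shown to
    prescribe the hull of the compressions, so overlaps between cases are harmless; what remains is
    that some case applies. This is where the cyclic order matters: the centre of mass is strictly
    inside every supporting half-plane, so angles seen from it become signs of determinants.

    That no eigenvalue is interior is used as a supporting line at each eigenvalue. In the interior
    case this line keeps [mu] different from the eigenvalues, and no eigenvalue strictly inside a
    triangle of others. On an edge, it forces the successor of a point that lies before [mu] to stay
    on the edge.

    The rank-2 numerical range is handled by two implications: each of its points can be represented
    without any given eigenvalue, and a point with two representations of disjoint supports belongs
    to it. A plane of vectors meets every coordinate hyperplane, whence the first; the second takes
    square roots of the weights. *)

(* Bartl's induction on the number of constraints. *)
Lemma farkas3 (R : realFieldType) (m : nat) (a b c : 'I_m -> R) (a0 b0 c0 : R) :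
  (forall x y z, (forall k, a k * x + b k * y + c k * z <= 0) ->
     a0 * x + b0 * y + c0 * z <= 0) ->
  exists u : 'I_m -> R, [/\ forall k, 0 <= u k, a0 = \sum_k u k * a k,
    b0 = \sum_k u k * b k & c0 = \sum_k u k * c k].
Proof.
elim: m => [|m IHm] in a b c a0 b0 c0 *.
  move=> h; have : a0 * a0 + b0 * b0 + c0 * c0 <= 0 by apply: h => -[].
  move=> sq; exists (fun=> 0); rewrite !big_ord0.
  have [[a2 b2] c2] := (sqr_ge0 a0, sqr_ge0 b0, sqr_ge0 c0).
  by split=> //; apply/eqP; rewrite -sqrf_eq0; apply/eqP; nra.
move=> h.
pose a' k := a (lift ord0 k); pose b' k := b (lift ord0 k).
pose c' k := c (lift ord0 k).
have [h'|] := pselect (forall x y z,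
    (forall k, a' k * x + b' k * y + c' k * z <= 0) ->
    a0 * x + b0 * y + c0 * z <= 0).
  have [u [u0 ua ub uc]] := IHm _ _ _ _ _ _ h'.
  exists (fun k => if unlift ord0 k is Some j then u j else 0).
  split; first by move=> k; case: unliftP.
  1-3: rewrite big_ord_recl unlift_none mul0r add0r ?ua ?ub ?uc.
  1-3: by apply: eq_bigr => k _; rewrite liftK.
move=> /existsNP[x] /existsNP[y] /existsNP[z] /not_implyP[xyz].
move=> /negP; rewrite -ltNge => gt0.
pose D := a ord0 * x + b ord0 * y + c ord0 * z.
have D0 : 0 < D.
  rewrite ltNge; apply/negP => Dle; move: gt0; rewrite ltNge => /negP; apply.
  by apply: h => k; case: (unliftP ord0 k) => [j ->|->] //; apply: xyz.
(* Subtracting [e k] times the vector of index 0 makes all the vectors orthogonal to [(x, y, z)],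
   and [e k <= 0 < e0] makes the coefficient recovered at index 0 nonnegative. *)
pose e k := (a' k * x + b' k * y + c' k * z) / D.
pose e0 := (a0 * x + b0 * y + c0 * z) / D.
have [|u [u0 ua ub uc]] := IHm (fun k => a' k - e k * a ord0)
  (fun k => b' k - e k * b ord0) (fun k => c' k - e k * c ord0)
  (a0 - e0 * a ord0) (b0 - e0 * b ord0) (c0 - e0 * c ord0).
  move=> x' y' z' h'.
  pose t := (a ord0 * x' + b ord0 * y' + c ord0 * z') / D.
  have -> : (a0 - e0 * a ord0) * x' + (b0 - e0 * b ord0) * y' +
      (c0 - e0 * c ord0) * z' =
      a0 * (x' - t * x) + b0 * (y' - t * y) + c0 * (z' - t * z).
    by rewrite /e0 /t; field; rewrite gt_eqF.
  apply: h => k; case: (unliftP ord0 k) => [j ->|->].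
    rewrite -/(a' j) -/(b' j) -/(c' j).
    suff -> : a' j * (x' - t * x) + b' j * (y' - t * y) + c' j * (z' - t * z) =
      (a' j - e j * a ord0) * x' + (b' j - e j * b ord0) * y' +
      (c' j - e j * c ord0) * z' by [].
    by rewrite /e /t; field; rewrite gt_eqF.
  pose N := a ord0 * x' + b ord0 * y' + c ord0 * z'.
  rewrite (_ : _ + _ = N - t * D); last by rewrite /N /D; ring.
  by rewrite /t divfK ?gt_eqF // subrr.
have u00 : 0 <= e0 - \sum_k u k * e k.
  rewrite subr_ge0 (@le_trans _ _ 0) //; last by rewrite divr_ge0 // ltW.
  rewrite -oppr_ge0 -sumrN sumr_ge0 // => k _; rewrite -mulrN mulr_ge0 //.
  by rewrite oppr_ge0 pmulr_lle0 ?invr_gt0 //; exact: xyz.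
have expand (v : 'I_m.+1 -> R) v0 :
    v0 - e0 * v ord0 = \sum_k u k * (v (lift ord0 k) - e k * v ord0) ->
    v0 = (e0 - \sum_k u k * e k) * v ord0 + \sum_k u k * v (lift ord0 k).
  under eq_bigr do rewrite mulrBr mulrA; rewrite sumrB -mulr_suml => E.
  by move/eqP: E; rewrite subr_eq => /eqP ->; ring.
exists (fun k => if unlift ord0 k is Some j then u j
                 else e0 - \sum_k u k * e k).
split; first by move=> k; case: unliftP.
all: rewrite big_ord_recl unlift_none.
- rewrite [LHS](expand a _ ua); congr (_ + _); apply: eq_bigr => k _.
  by rewrite liftK.
- rewrite [LHS](expand b _ ub); congr (_ + _); apply: eq_bigr => k _.
  by rewrite liftK.
- rewrite [LHS](expand c _ uc); congr (_ + _); apply: eq_bigr => k _.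
  by rewrite liftK.
Qed.

(** * Convex hulls, barycentric coordinates and separation in the plane *)

Section Plane.
Variable R : realType.
Implicit Types (z w : R[i]).

Definition aff (a b c : R) z : R := a * Re z + b * Im z + c.

Lemma complex_ext z w : Re z = Re w -> Im z = Im w -> z = w.
Proof. by case: z w => [a b] [c d] /= -> ->. Qed.

Lemma cReD z w : Re (z + w) = Re z + Re w. Proof. by case: z w => ? ? []. Qed.
Lemma cImD z w : Im (z + w) = Im z + Im w. Proof. by case: z w => ? ? []. Qed.
Lemma cReN z : Re (- z) = - Re z. Proof. by case: z. Qed.
Lemma cImN z : Im (- z) = - Im z. Proof. by case: z. Qed.
Lemma cReM z w : Re (z * w) = Re z * Re w - Im z * Im w.
Proof. by case: z w => ? ? []. Qed.
Lemma cImM z w : Im (z * w) = Re z * Im w + Im z * Re w.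
Proof. by case: z w => ? ? []. Qed.
Lemma cReJ z : Re (Num.conj z) = Re z. Proof. by case: z. Qed.
Lemma cImJ z : Im (Num.conj z) = - Im z. Proof. by case: z. Qed.

Definition ReImE := (cReD, cImD, cReN, cImN, cReM, cImM, cReJ, cImJ).

Lemma Re_sum (I : Type) (r : seq I) (P : pred I) (F : I -> R[i]) :
  Re (\sum_(i <- r | P i) F i) = \sum_(i <- r | P i) Re (F i).
Proof. exact: (big_morph _ cReD). Qed.

Lemma Im_sum (I : Type) (r : seq I) (P : pred I) (F : I -> R[i]) :
  Im (\sum_(i <- r | P i) F i) = \sum_(i <- r | P i) Im (F i).
Proof. exact: (big_morph _ cImD). Qed.

Lemma cReZ (t : R) z : Re (t%:C * z) = t * Re z.
Proof. by rewrite cReM mul0r subr0. Qed.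
Lemma cImZ (t : R) z : Im (t%:C * z) = t * Im z.
Proof. by rewrite cImM mul0r addr0. Qed.

Lemma conv_weight_real (t : {i01 R[i]}) :
  exists r : R, [/\ t%:num = r%:C, 0 <= r & r <= 1].
Proof.
have : 0 <= t%:num by [].
have : t%:num <= 1 by [].
case: (t%:num) => [a b]; rewrite !lecE /= => /andP[/eqP b0 a1] /andP[_ a0].
by exists a; split => //; rewrite -b0.
Qed.

Lemma convex_setP (S : set R[i]) : @convex_set R[i] R[i]^o S <->
  forall x y (t : R), S x -> S y -> 0 <= t -> t <= 1 ->
    S (t%:C * x + (1 - t)%:C * y).
Proof.
split=> [cS x y t Sx Sy t0 t1|cS x y l].
  have t0' : (0 <= t%:C)%R by rewrite lecE /= eqxx.
  have t1' : (t%:C <= 1)%R by rewrite lecE /= eqxx.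
  have := cS x y (@Itv01 _ t%:C t0' t1').
  rewrite !inE => /(_ Sx Sy); rewrite /conv /=.
  by rewrite /unstable.onem /= rmorphB.
rewrite !inE => Sx Sy.
have [r [lr r0 r1]] := conv_weight_real l.
have := cS x y r Sx Sy r0 r1.
by rewrite /conv /= /unstable.onem /= lr rmorphB.
Qed.

Lemma conv_hull_convex (S : set R[i]) x y (t : R) :
  conv_hull S x -> conv_hull S y -> 0 <= t -> t <= 1 ->
  conv_hull S (t%:C * x + (1 - t)%:C * y).
Proof.
move=> Sx Sy t0 t1 T [cT ST].
by have /convex_setP := cT; apply => //; [apply: Sx|apply: Sy].
Qed.

Lemma sub_conv_hull (S : set R[i]) : S `<=` conv_hull S.
Proof. by move=> x Sx T [_]; exact. Qed.

Lemma conv_hull_min (S T : set R[i]) :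
  (forall x y (t : R), T x -> T y -> 0 <= t -> t <= 1 ->
    T (t%:C * x + (1 - t)%:C * y)) ->
  S `<=` T -> conv_hull S `<=` T.
Proof. by move=> /convex_setP cT ST x; apply. Qed.

Lemma conv_hull_sub (S T : set R[i]) :
  S `<=` conv_hull T -> conv_hull S `<=` conv_hull T.
Proof. by apply: conv_hull_min => x y t; exact: conv_hull_convex. Qed.

Section Barycentric.
Variables (m : nat) (s : 'I_m -> R[i]).
Implicit Types (p q : 'I_m -> R).

Definition bary p z := \sum_k p k = 1 /\ \sum_k (p k)%:C * s k = z.

Definition cbary p z := (forall k, 0 <= p k) /\ bary p z.

Lemma baryP p z : bary p z <-> [/\ \sum_k p k = 1,
  \sum_k p k * Re (s k) = Re z & \sum_k p k * Im (s k) = Im z].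
Proof.
split=> [[p1 <-]|[p1 pr pi]].
  rewrite Re_sum Im_sum; split=> //; apply: eq_bigr => k _.
    by rewrite cReZ.
  by rewrite cImZ.
split=> //; apply: complex_ext; rewrite ?Re_sum ?Im_sum.
  by rewrite -pr; apply: eq_bigr => k _; rewrite cReZ.
by rewrite -pi; apply: eq_bigr => k _; rewrite cImZ.
Qed.

Lemma bary_aff p z a b c :
  bary p z -> \sum_k p k * aff a b c (s k) = aff a b c z.
Proof.
move=> /baryP[p1 pr pi]; rewrite /aff -pr -pi -[in RHS](mulr1 c) -p1.
by rewrite !mulr_sumr -!big_split; apply: eq_bigr => k _ /=; ring.
Qed.

Lemma bary_mix p q z w t : bary p z -> bary q w ->
  bary (fun k => t * p k + (1 - t) * q k) (t%:C * z + (1 - t)%:C * w).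
Proof.
move=> [p1 <-] [q1 <-]; split.
  by rewrite big_split -!mulr_sumr /= p1 q1; ring.
rewrite !mulr_sumr -big_split; apply: eq_bigr => k _.
by rewrite !rmorphD !rmorphM /=; ring.
Qed.

Lemma cbary_mix p q z w t : 0 <= t -> t <= 1 -> cbary p z -> cbary q w ->
  cbary (fun k => t * p k + (1 - t) * q k) (t%:C * z + (1 - t)%:C * w).
Proof.
move=> t0 t1 [p0 pz] [q0 qw]; split; last exact: bary_mix.
by move=> k; rewrite addr_ge0 // mulr_ge0 // subr_ge0.
Qed.

Lemma bary_vertex k : cbary (fun j => (j == k)%:R) (s k).
Proof.
split=> [j|]; first exact: ler0n.
split; first by rewrite (bigD1 k) //= eqxx big1 ?addr0 // => j /negbTE ->.
rewrite (bigD1 k) //= eqxx big1 ?addr0 ?mul1r // => j /negbTE ->.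
by rewrite mul0r.
Qed.

Lemma conv_hull_cbary z : conv_hull (range s) z <-> exists p, cbary p z.
Proof.
split; first move: z.
  apply: conv_hull_min => [x y t [p px] [q qy] t0 t1|_ [k _ <-]].
    by exists (fun k => t * p k + (1 - t) * q k); exact: cbary_mix.
  by exists (fun j => (j == k)%:R); exact: bary_vertex.
move=> [p [p0 [p1 <-]]] T [/convex_setP cT sT].
have {}sT k : T (s k) by apply: sT; exists k.
(* Induction on a list of indices: a partial sum, normalised by its mass, is in [T] as soon as this
   mass is positive. *)
suff H (r : seq 'I_m) : 0 < \sum_(k <- r) p k ->
    T ((\sum_(k <- r) p k)%:C^-1 * \sum_(k <- r) (p k)%:C * s k).
  have := H (index_enum 'I_m); rewrite p1 => /(_ ltr01).
  by rewrite invr1 mul1r.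
elim: r => [|k r IHr]; first by rewrite big_nil ltxx.
rewrite !big_cons.
have : 0 <= \sum_(j <- r) p j by apply: sumr_ge0.
rewrite le_eqVlt => /orP[/eqP r0|r_gt0].
  have z0 : \sum_(j <- r) (p j)%:C * s j = 0.
    rewrite big_seq big1 // => j jr.
    have /eqP := esym r0; rewrite psumr_eq0 // => /allP/(_ _ jr)/eqP ->.
    by rewrite mul0r.
  rewrite z0 -r0 !addr0 => pk0.
  by rewrite mulKf //; apply/eqP => -[] /eqP; rewrite gt_eqF.
set S := \sum_(j <- r) p j in r_gt0 IHr *.
set Z := \sum_(j <- r) _ in IHr *.
move=> pS.
have t0 : 0 <= p k / (p k + S) by rewrite divr_ge0 // ltW.
have t1 : p k / (p k + S) <= 1 by rewrite ler_pdivrMr // mul1r lerDl ltW.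
have := cT (s k) (S%:C^-1 * Z) _ (sT k) (IHr r_gt0) t0 t1.
have pS' : (p k)%:C + S%:C != 0.
  by rewrite -rmorphD; apply/eqP => -[] /eqP; rewrite gt_eqF.
have S' : S%:C != 0 by apply/eqP => -[] /eqP; rewrite gt_eqF.
congr (T _); rewrite !rmorphB rmorphD !fmorph_div !rmorphD rmorph1 /=.
by field; rewrite pS'.
Qed.

(** Farkas' lemma for the homogenised vectors [(Re, Im, 1)]; the third coordinate forces the
    multipliers to sum to 1. *)
Lemma separation z : (forall p, ~ cbary p z) ->
  exists a b c, (forall k, aff a b c (s k) <= 0) /\ 0 < aff a b c z.
Proof.
move=> nz; apply: contrapT => nsep.
have [|u [u0 ua ub uc]] := @farkas3 R m (fun k => Re (s k))
   (fun k => Im (s k)) (fun=> 1) (Re z) (Im z) 1.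
  move=> a b c h; rewrite leNgt; apply/negP => gt; apply: nsep.
  exists a, b, c; split; last by move: gt; rewrite /aff; lra.
  by move=> k; have := h k; rewrite /aff; lra.
apply: (nz u); split=> //; apply/baryP; split=> //.
by rewrite uc; apply: eq_bigr => k _; rewrite mulr1.
Qed.

End Barycentric.
End Plane.

(** * Interior points and supporting lines *)

Section Support.
Variables (R : realType) (m : nat) (s : 'I_m -> R[i]).
Implicit Types (z w : R[i]).

Definition hull : set R[i] := [set z | exists p, cbary s p z].

(** A short step from [z] along the gradient [(a, b)] stays in the hull and increases the affine
    function by a multiple of [a ^+ 2 + b ^+ 2]. *)
Lemma interior_no_support z a b c :
  interior (hull : set R[i]^o) z -> aff a b c z = 0 ->
  (forall k, aff a b c (s k) <= 0) -> a = 0 /\ b = 0.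
Proof.
rewrite /interior => /nbhs_ballP[e e0 be] fz fs.
have {e0} : 0 < Re e /\ Im e = 0.
  by move: e0; rewrite /= ltcE => /andP[/eqP ? ?].
case: e be => e ? be /= [e0 ie]; rewrite {}ie in be.
pose M := 1 + Num.sqrt (a ^+ 2 + b ^+ 2).
have M0 : 0 < M by rewrite /M ltr_wpDr ?sqrtr_ge0.
have [t tE] : exists t, t = e / M by exists (e / M).
have t0 : 0 < t by rewrite tE divr_gt0.
have [p [p0 pz]] : hull (z + (t * a +i* (t * b))).
  apply: be; rewrite -ball_normE /ball_ /=.
  rewrite opprD addNKr normrN normc_def ltcE /= eqxx /=.
  rewrite !exprMn -mulrDr sqrtrM ?sqr_ge0 // sqrtr_sqr gtr0_norm //.
  by rewrite tE mulrAC ltr_pdivrMr // ltr_pM2l // /M ltrDr.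
have : aff a b c (z + (t * a +i* (t * b))) <= 0.
  rewrite -(bary_aff a b c pz) -oppr_ge0 -sumrN sumr_ge0 // => k _.
  by rewrite -mulrN mulr_ge0 // oppr_ge0.
have -> : aff a b c (z + (t * a +i* (t * b))) =
    aff a b c z + t * (a ^+ 2 + b ^+ 2) by rewrite /aff cReD cImD /=; ring.
rewrite fz add0r pmulr_rle0 // => ab.
have [a2 b2] := (sqr_ge0 a, sqr_ge0 b).
by split; apply/eqP; rewrite -sqrf_eq0; apply/eqP; lra.
Qed.

(* If no half-plane at [z] contains the hull, Farkas' lemma puts the four
   directions [1], [-1], ['i] and [-'i] in the cone of the [s k - z]. *)
Lemma support z : hull z -> ~ interior (hull : set R[i]^o) z ->
  exists a b c, [/\ (a != 0) || (b != 0), aff a b c z = 0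
                  & forall k, aff a b c (s k) <= 0].
Proof.
move=> [p [p0 [p1 pz]]] nint; apply: contrapT => nsup; apply: nint.
pose X k := Re (s k - z); pose Y k := Im (s k - z).
have cone d1 d2 : exists u : 'I_m -> R, [/\ forall k, 0 <= u k,
    d1 = \sum_k u k * X k & d2 = \sum_k u k * Y k].
  have [|u [u0 uX uY _]] := @farkas3 R m X Y (fun=> 0) d1 d2 0; last by exists u.
  move=> x y c h; rewrite leNgt; apply/negP => gt0; apply: nsup.
  exists x, y, (- (x * Re z + y * Im z)); split; last first.
  - move=> k; have := h k; rewrite /aff /X /Y !ReImE; lra.
  - by rewrite /aff; ring.
  - by apply: contraTT gt0; rewrite negb_or !negbK => /andP[/eqP -> /eqP ->];
    rewrite -leNgt; lra.
have [u1 [u10 u1X u1Y]] := cone 1 0.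
have [u2 [u20 u2X u2Y]] := cone (-1) 0.
have [u3 [u30 u3X u3Y]] := cone 0 1.
have [u4 [u40 u4X u4Y]] := cone 0 (-1).
(* [U] exceeds the total mass of the four cone representations. For [w] within [1 / (2 U)] of [z],
   the vector [w - z] is then a combination of the [s k - z] of mass at most 1, and [p] receives the
   remaining mass. *)
pose U := 1 + \sum_k (u1 k + u2 k + u3 k + u4 k).
have U0 : 0 < U.
  by rewrite /U ltr_wpDr // sumr_ge0 // => k _; rewrite !addr_ge0.
apply/nbhs_ballP; exists (U^-1 / 2)%:C.
  by rewrite /= ltcE /= eqxx divr_gt0 // invr_gt0.
move=> w; rewrite -ball_normE /ball_ /= => zw.
have xlt : `|Re (w - z)| * U <= 1 / 2.
  have : `|Re (w - z)|%:C < (U^-1 / 2)%:C.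
    by apply: le_lt_trans zw; rewrite distrC normc_ge_Re.
  rewrite ltcE /= eqxx /= => /ltW; rewrite -(ler_pM2r U0) => /le_trans; apply.
  by rewrite mulrAC mulVf ?gt_eqF.
have ylt : `|Im (w - z)| * U <= 1 / 2.
  have : `|Im (w - z)|%:C < (U^-1 / 2)%:C.
    apply: le_lt_trans zw; rewrite distrC normc_def lecE /= eqxx /=.
    by rewrite -sqrtr_sqr ler_sqrt ?addr_ge0 ?sqr_ge0 // lerDr sqr_ge0.
  rewrite ltcE /= eqxx /= => /ltW; rewrite -(ler_pM2r U0) => /le_trans; apply.
  by rewrite mulrAC mulVf ?gt_eqF.
set x := Re (w - z) in xlt; set y := Im (w - z) in ylt.
pose v k := Num.max x 0 * u1 k + Num.max (- x) 0 * u2 k +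
            Num.max y 0 * u3 k + Num.max (- y) 0 * u4 k.
have mx0 (t : R) : 0 <= Num.max t 0 by rewrite le_max lexx orbT.
have mx1 (t : R) : Num.max t 0 <= `|t|.
  by rewrite ge_max ler_norm normr_ge0.
have v0 k : 0 <= v k by rewrite !addr_ge0 // mulr_ge0.
have mxB (t : R) : Num.max t 0 - Num.max (- t) 0 = t.
  by case: (ltrgtP t 0) => h; case: (ltrgtP (- t) 0); lra.
have vE (F : 'I_m -> R) : \sum_k v k * F k =
    Num.max x 0 * \sum_k u1 k * F k + Num.max (- x) 0 * \sum_k u2 k * F k +
    Num.max y 0 * \sum_k u3 k * F k + Num.max (- y) 0 * \sum_k u4 k * F k.
  by rewrite !mulr_sumr -!big_split; apply: eq_bigr => k _; rewrite /v /=; ring.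
have vX : \sum_k v k * X k = x.
  by rewrite vE -u1X -u2X -u3X -u4X -[RHS]mxB; ring.
have vY : \sum_k v k * Y k = y.
  by rewrite vE -u1Y -u2Y -u3Y -u4Y -[RHS]mxB; ring.
have vs : \sum_k v k <= 1.
  have : \sum_k v k <= \sum_k (`|x| + `|y|) * (u1 k + u2 k + u3 k + u4 k).
    apply: ler_sum => k _; rewrite /v.
    have := (mx1 x, mx1 y, mx1 (- x), mx1 (- y)); rewrite !normrN.
    have := (mx0 x, mx0 y, mx0 (- x), mx0 (- y)).
    have := (u10 k, u20 k, u30 k, u40 k).
    move=> [[[h1 h2] h3] h4] [[[g1 g2] g3] g4] [[[f1 f2] f3] f4].
    have n1 := normr_ge0 x; have n2 := normr_ge0 y.
    have := ler_wpM2r h1 f1; have := ler_wpM2r h2 f3.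
    have := ler_wpM2r h3 f2; have := ler_wpM2r h4 f4.
    have := mulr_ge0 n1 h3; have := mulr_ge0 n1 h4.
    have := mulr_ge0 n2 h1; have := mulr_ge0 n2 h2.
    lra.
  rewrite -mulr_sumr => /le_trans; apply.
  have : (`|x| + `|y|) * U <= 1 by rewrite mulrDl; lra.
  have := normr_ge0 x; have := normr_ge0 y; rewrite /U; lra.
exists (fun k => v k + (1 - \sum_k v k) * p k); split.
  by move=> k; rewrite addr_ge0 // mulr_ge0 // subr_ge0.
have /baryP[_ pr pi] : bary s p z by split.
apply/baryP; split.
- by rewrite big_split -mulr_sumr /= p1; ring.
- under eq_bigr do rewrite mulrDl -mulrA.
  rewrite big_split -mulr_sumr /= pr.
  have : \sum_k v k * Re (s k) = x + (\sum_k v k) * Re z.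
    rewrite -vX mulr_suml -big_split; apply: eq_bigr => k _.
    by rewrite /X !ReImE /=; ring.
  by move=> ->; rewrite /x !ReImE; ring.
- under eq_bigr do rewrite mulrDl -mulrA.
  rewrite big_split -mulr_sumr /= pi.
  have : \sum_k v k * Im (s k) = y + (\sum_k v k) * Im z.
    rewrite -vY mulr_suml -big_split; apply: eq_bigr => k _.
    by rewrite /Y !ReImE /=; ring.
  by move=> ->; rewrite /y !ReImE; ring.
Qed.

End Support.

(** * Compression pairs, and the sum of squares for a single positive value *)

Section Compression.
Variables (R : realType).
Implicit Types (z w : R[i]).

Definition nsq z : R := Re z ^+ 2 + Im z ^+ 2.

Lemma nsq_ge0 z : 0 <= nsq z. Proof. by rewrite addr_ge0 ?sqr_ge0. Qed.

Lemma nsq_eq0 z : (nsq z == 0) = (z == 0).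
Proof. by rewrite /nsq paddr_eq0 ?sqr_ge0 // !sqrf_eq0 eq_complex. Qed.

Lemma nsq_gt0 z : (0 < nsq z) = (z != 0).
Proof. by rewrite lt_def nsq_ge0 nsq_eq0 andbT. Qed.

Lemma nsqM z w : nsq (z * w) = nsq z * nsq w.
Proof. by rewrite /nsq !ReImE; ring. Qed.

Lemma nsq_eq z : (nsq z)%:C = z * Num.conj z.
Proof. by apply: complex_ext; rewrite !ReImE /nsq /=; ring. Qed.

Lemma conjR (t : R) : Num.conj t%:C = t%:C :> R[i].
Proof. by apply: complex_ext; rewrite //= oppr0. Qed.

Lemma nsqR (t : R) : nsq t%:C = t ^+ 2.
Proof. by rewrite /nsq /= expr0n addr0. Qed.

Lemma nsq0 : nsq (0 : R[i]) = 0.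
Proof. by rewrite /nsq /= expr0n addr0. Qed.

Lemma nsqJ z : nsq (Num.conj z) = nsq z.
Proof. by rewrite /nsq !cReJ !cImJ sqrrN. Qed.

Lemma nsq_sqrt (t : R) : 0 <= t -> nsq (Num.sqrt t)%:C = t.
Proof. by move=> t0; rewrite nsqR sqr_sqrtr. Qed.

Variables (n : nat) (lam : 'I_n -> R[i]).

Definition compression_pair (mu nu : R[i]) (x y : 'I_n -> R[i]) : Prop :=
  [/\ cbary lam (fun k => nsq (x k)) mu, cbary lam (fun k => nsq (y k)) nu,
      \sum_k Num.conj (y k) * x k = 0
    & \sum_k Num.conj (y k) * x k * lam k = 0].

Lemma sum_nsqB (c : 'I_n -> R) (x y : 'I_n -> R[i]) z :
  \sum_k c k * nsq (y k - z * x k) =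
  \sum_k c k * nsq (y k) - 2 * Re (z * \sum_k (c k)%:C * (Num.conj (y k) * x k))
  + nsq z * \sum_k c k * nsq (x k).
Proof.
rewrite mulr_sumr Re_sum !mulr_sumr -sumrB -big_split; apply: eq_bigr => k _ /=.
by rewrite /nsq !ReImE /=; ring.
Qed.

(** Since [a != b], the solutions form a line, spanned by the cross product of [(1, 1, 1)] and
    [(a, b, c)]. The unknowns will be the products [Num.conj (y k) * x k], grouped on a triangle. *)
Lemma orthogonal_pencil (a b c z1 z2 z3 : R[i]) : a != b ->
  z1 + z2 + z3 = 0 -> z1 * a + z2 * b + z3 * c = 0 ->
  exists k, [/\ z1 = k * (c - b), z2 = k * (a - c) & z3 = k * (b - a)].
Proof.
move=> ab E1 E2; have ba : b - a != 0 by rewrite subr_eq0 eq_sym.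
have E3 : z2 * (b - a) = z3 * (a - c).
  have -> : z2 * (b - a) = (z1 * a + z2 * b + z3 * c) - (z1 + z2 + z3) * a +
    z3 * (a - c) by ring.
  by rewrite E1 E2; ring.
have E4 : z1 * (b - a) = z3 * (c - b).
  have -> : z1 * (b - a) = (z1 + z2 + z3) * b - (z1 * a + z2 * b + z3 * c) +
    z3 * (c - b) by ring.
  by rewrite E1 E2; ring.
exists (z3 / (b - a)); split; apply: (mulIf ba); rewrite ?E3 ?E4; field => //.
Qed.

(* The left-hand side is a positive multiple of [h] at the isogonal conjugate
   of the point with barycentric coordinates [p1, p2, p3]. *)
Definition isogonal_form (h : R[i] -> R) (a b c : R[i]) (p1 p2 p3 : R) : R :=
  h a * nsq (c - b) / p1 + h b * nsq (a - c) / p2 + h c * nsq (b - a) / p3.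

Section OnePositive.
Variables (u v r : R) (i : 'I_n) (a b : R[i]) (q0 qa qb : 'I_n -> R).
Let h := aff u v r.
Hypothesis q1 : forall k, q0 k + qa k + qb k = 1.
Hypothesis qlam : forall k,
  lam k = (q0 k)%:C * lam i + (qa k)%:C * a + (qb k)%:C * b.
Hypothesis qi : [/\ q0 i = 1, qa i = 0 & qb i = 0].
Hypothesis qk : forall k, k != i -> [/\ q0 k <= 0, 0 <= qa k & 0 <= qb k].
Hypotheses (ia : lam i != a) (ab : a != b).
Hypotheses (hi : 0 < h (lam i)) (ha : h a <= 0) (hb : h b <= 0).
Variables (mu nu : R[i]) (x y : 'I_n -> R[i]).
Hypothesis xy : compression_pair mu nu x y.
Hypothesis xi : x i != 0.
Let p0 := \sum_k q0 k * nsq (x k).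
Let pa := \sum_k qa k * nsq (x k).
Let pb := \sum_k qb k * nsq (x k).
Hypotheses (p0_gt0 : 0 < p0) (pa_gt0 : 0 < pa) (pb_gt0 : 0 < pb).
Hypothesis iso : isogonal_form h (lam i) a b p0 pa pb <= 0.

(* A real multiple [g] of an affine function, an affine function [l] and [h]
   form Hermitian 2x2 matrices [[g, l], [l^*, -h]] depending affinely on the
   point: they are negative semidefinite and singular at [lam i], positive
   semidefinite at [a] and [b], hence at all the other points.  The sum of the
   values of these forms at the vectors [(tau * x k, y k)] is at most [- h nu],
   and [tau] is chosen such that the term of index [i] vanishes. *)
Lemma one_positive : h nu <= 0.
Proof.
have [[_ bx] [_ by_] o1 o2] := xy.
pose W (c : 'I_n -> R) := \sum_k (c k)%:C * (Num.conj (y k) * x k).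
pose Y (c : 'I_n -> R) := \sum_k c k * nsq (y k).
have WE : W q0 + W qa + W qb = 0.
  rewrite /W -!big_split -[RHS]o1; apply: eq_bigr => k _ /=.
  by rewrite -!mulrDl -!rmorphD q1 mul1r.
have WE' : W q0 * lam i + W qa * a + W qb * b = 0.
  rewrite /W !mulr_suml -!big_split -[RHS]o2; apply: eq_bigr => k _ /=.
  by rewrite [in RHS](qlam k); ring.
have [ka [W0 Wa Wb]] := orthogonal_pencil ia WE WE'.
pose S := - h a * nsq (lam i - b) / pa - h b * nsq (a - lam i) / pb.
have isoS : h (lam i) * nsq (b - a) / p0 <= S.
  by move: iso; rewrite /isogonal_form /S; lra.
have S0 : 0 < S.
  apply: lt_le_trans isoS; rewrite divr_gt0 // mulr_gt0 // nsq_gt0.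
  by rewrite subr_eq0 eq_sym.
have [tau tauE] : exists t, t = y i / x i * (h (lam i) / S)%:C.
  by exists (y i / x i * (h (lam i) / S)%:C).
(* The three multipliers are chosen so that [z0 * W q0], [za * W qa] and [zb * W qb] are real
   multiples of one number [X]: each contains the conjugate of the side that [orthogonal_pencil]
   puts in the corresponding [W], or cancels it. *)
pose z0 := (S / h (lam i))%:C * tau.
pose za := tau * (b - a) * Num.conj (lam i - b) * (pa^-1)%:C.
pose zb := tau * (b - a) * Num.conj (a - lam i) * (pb^-1)%:C.
have z0E : z0 = y i / x i.
  have -> : z0 = (S / h (lam i))%:C * (h (lam i) / S)%:C * (y i / x i).
    by rewrite /z0 tauE; ring.
  rewrite -rmorphM (_ : S / h (lam i) * (h (lam i) / S) = 1) ?mul1r //.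
  by field; rewrite !gt_eqF.
pose T k := - h (lam i) * (q0 k * nsq (y k - z0 * x k)) +
  (- h a * (qa k * nsq (y k - za * x k)) - h b * (qb k * nsq (y k - zb * x k))).
have T0 : 0 <= \sum_k T k.
  rewrite sumr_ge0 // => k _; have [->|ki] := eqVneq k i.
    have [q0i qai qbi] := qi.
    by rewrite /T q0i qai qbi z0E divfK // subrr /nsq /=; lra.
  have [q0k qak qbk] := qk ki; rewrite /T.
  have := mulr_ge0 qak (nsq_ge0 (y k - za * x k)).
  have := mulr_ge0 qbk (nsq_ge0 (y k - zb * x k)).
  have : 0 <= - (q0 k * nsq (y k - z0 * x k)).
    by rewrite -mulNr mulr_ge0 ?nsq_ge0 // oppr_ge0.
  set t1 := q0 k * _; set t2 := qa k * _; set t3 := qb k * _ => e1 e2 e3.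
  have := mulr_ge0 (ltW hi) e1.
  have : 0 <= - h a * t2 by rewrite mulr_ge0 // oppr_ge0.
  have : 0 <= - h b * t3 by rewrite mulr_ge0 // oppr_ge0.
  lra.
have hY : h nu = h (lam i) * Y q0 + h a * Y qa + h b * Y qb.
  have -> : h nu = \sum_k nsq (y k) * h (lam k) by rewrite (bary_aff u v r by_).
  rewrite /Y !mulr_sumr -!big_split; apply: eq_bigr => k _ /=.
  have -> : h (lam k) = q0 k * h (lam i) + qa k * h a + qb k * h b.
    rewrite [in LHS](qlam k) /h /aff !ReImE /= -[in LHS](mulr1 r) -(q1 k).
    ring.
  ring.
pose X := tau * ka * (b - a).
have X0 : z0 * W q0 = (S / h (lam i))%:C * X by rewrite W0 /z0 /X; ring.
have Xa : za * W qa = (nsq (lam i - b) / pa)%:C * X.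
  by rewrite Wa /za /X rmorphM /= nsq_eq; ring.
have Xb : zb * W qb = (nsq (a - lam i) / pb)%:C * X.
  by rewrite Wb /zb /X rmorphM /= nsq_eq; ring.
(* The cross terms contribute [2 * Re X] times [S + h a * nsq (lam i - b) / pa + h b * nsq (a - lam
   i) / pb], which is 0 by the definition of [S]. Only [- h nu] and a multiple of [nsq tau] survive,
   and [isoS] gives the sign of the latter. *)
have TE : \sum_k T k = - h nu +
    nsq tau * (nsq (b - a) * S - S ^+ 2 * p0 / h (lam i)).
  rewrite /T big_split sumrB -!mulr_sumr /= !sum_nsqB.
  rewrite -!/(W _) -!/(Y _) -/p0 -/pa -/pb X0 Xa Xb !cReZ hY.
  rewrite /z0 /za /zb !nsqM !nsqR !nsqJ /S.
  by field; rewrite !gt_eqF.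
move: T0; rewrite TE.
suff : nsq (b - a) * S - S ^+ 2 * p0 / h (lam i) <= 0.
  move=> neg; have := mulr_ge0_le0 (nsq_ge0 tau) neg; lra.
move: isoS; rewrite ler_pdivrMr // => isoS.
rewrite subr_le0 ler_pdivlMr //.
have := ler_wpM2l (ltW S0) isoS; lra.
Qed.
End OnePositive.
End Compression.

(** * Isogonal conjugates in barycentric coordinates *)

Section Isogonal.
Variable R : realType.
Implicit Types (a b c d p q v w z mu : R[i]).

(** Twice the signed area of the triangle, positive when [a], [b], [c] turn counterclockwise. *)
Definition cross a b c : R :=
  Re (b - a) * Im (c - a) - Im (b - a) * Re (c - a).

Lemma aff0_line (a b c : R) : (a != 0) || (b != 0) ->
  exists v d, d != 0 /\ (fun z => aff a b c z = 0) `<=` line v d.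
Proof.
move=> ab; pose N := a ^+ 2 + b ^+ 2.
have N0 : N != 0 by rewrite /N paddr_eq0 ?sqr_ge0 // !sqrf_eq0 negb_and.
exists ((- (a * c) / N) +i* (- (b * c) / N)), ((- b) +i* a); split.
  by rewrite eq_complex /= oppr_eq0 negb_and orbC.
move=> [x y]; rewrite /aff /= => E.
exists ((a * y - b * x) / N) => //.
have -> : c = - (a * x + b * y) by lra.
by apply: complex_ext; rewrite !ReImE /= /N; field.
Qed.

Lemma collinear_aff (S : set R[i]) (a b c : R) : (a != 0) || (b != 0) ->
  (forall z, S z -> aff a b c z = 0) -> collinear S.
Proof.
move=> ab S0; have [v [d [d0 sub]]] := aff0_line c ab.
by exists v, d; split=> // z Sz; exact: (sub z (S0 z Sz)).
Qed.

Lemma collinear_cross a b c : collinear [set a; b; c] <-> cross a b c = 0.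
Proof.
split=> [[v [d [_ sub]]]|cr].
  have [t1 _ <-] : line v d a by apply: sub; left; left.
  have [t2 _ <-] : line v d b by apply: sub; left; right.
  have [t3 _ <-] : line v d c by apply: sub; right.
  by rewrite /cross !ReImE /=; ring.
have [ba|ba] := eqVneq b a; last first.
  apply: (@collinear_aff _ (- Im (b - a)) (Re (b - a))
    (Im (b - a) * Re a - Re (b - a) * Im a)).
    rewrite oppr_eq0 -negb_and; apply: contra ba => /andP[/eqP i0 /eqP r0].
    by rewrite -subr_eq0 eq_complex r0 i0 eqxx.
  move: cr; rewrite /cross !ReImE /aff => cr z [[->|->]|->]; lra.
have [ca|ca] := eqVneq c a; last first.
  apply: (@collinear_aff _ (- Im (c - a)) (Re (c - a))
    (Im (c - a) * Re a - Re (c - a) * Im a)).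
    rewrite oppr_eq0 -negb_and; apply: contra ca => /andP[/eqP i0 /eqP r0].
    by rewrite -subr_eq0 eq_complex r0 i0 eqxx.
  by rewrite {}ba !ReImE /aff => z [[->|->]|->]; lra.
rewrite {}ba {}ca; apply: (@collinear_aff _ 1 0 (- Re a)).
  by rewrite oner_eq0.
by rewrite /aff => z [[->|->]|->]; lra.
Qed.

(* For unit vectors [p] and [q], [(p + q) / (p + q)^* = p * q]. *)
Lemma reflected_cevianP v p q mu z : cross v p q != 0 ->
  reflected_cevian v p q mu z <->
  exists t : R, z = v + t%:C * ((p - v) * (q - v) * Num.conj (mu - v)).
Proof.
move=> cr.
have pv : p - v != 0.
  by apply: contra cr => /eqP E; rewrite /cross E /= !mul0r subr0.
have qv : q - v != 0.
  by apply: contra cr => /eqP E; rewrite /cross E /= !mulr0 subr0.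
set P := p - v in pv *; set Q := q - v in qv *.
have [s [s0 sE]] : exists s : R, 0 < s /\ `|P| = s%:C.
  by exists (Num.sqrt (nsq P)); rewrite sqrtr_gt0 nsq_gt0 normc_def.
have [t [t0 tE]] : exists t : R, 0 < t /\ `|Q| = t%:C.
  by exists (Num.sqrt (nsq Q)); rewrite sqrtr_gt0 nsq_gt0 normc_def.
have s0' : s%:C != 0 by apply/eqP => -[] /eqP; rewrite gt_eqF.
have t0' : t%:C != 0 by apply/eqP => -[] /eqP; rewrite gt_eqF.
have PP : P * Num.conj P = s%:C ^+ 2 by rewrite -normCK sE.
have QQ : Q * Num.conj Q = t%:C ^+ 2 by rewrite -normCK tE.
pose d := bisector_dir v p q.
have dE : d = P / s%:C + Q / t%:C by rewrite /d /bisector_dir -/P -/Q sE tE.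
have dJ : Num.conj d = Num.conj P / s%:C + Num.conj Q / t%:C.
  by rewrite dE rmorphD !fmorph_div /= !conjR.
have dd : d = P * Q / (s * t)%:C * Num.conj d.
  rewrite dJ dE rmorphM /=.
  have -> : P * Q / (s%:C * t%:C) * (Num.conj P / s%:C + Num.conj Q / t%:C) =
    (P * Num.conj P) * Q / (s%:C ^+ 2 * t%:C) + (Q * Num.conj Q) * P / (s%:C * t%:C ^+ 2).
    by field; rewrite s0' t0'.
  by rewrite PP QQ; field; rewrite s0' t0'.
have d0 : Num.conj d != 0.
  rewrite conjC_eq0; apply/negP => /eqP d0; case/eqP: cr.
  rewrite /cross -/P -/Q.
  have QE : Q = (- (t / s))%:C * P.
    move: d0; rewrite dE rmorphN fmorph_div /= => d0.
    have -> : Q = t%:C * (P / s%:C + Q / t%:C) - t%:C / s%:C * P.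
      by field; rewrite s0' t0'.
    by rewrite d0; ring.
  by rewrite QE cReZ cImZ; ring.
have ddE : d / Num.conj d = P * Q / (s * t)%:C by rewrite [X in X / _]dd mulfK.
rewrite /reflected_cevian /reflect_line -/d ddE; split.
  move=> [_ [r _ <-] <-]; exists (r / (s * t)).
  have -> : v + r%:C * (mu - v) - v = r%:C * (mu - v) by ring.
  rewrite [Num.conj (_ * _)]rmorphM /= conjR fmorph_div /= rmorphM /=.
  by congr (v + _); field; rewrite s0' t0'.
move=> [r ->]; exists (v + (r * (s * t))%:C * (mu - v)).
  by exists (r * (s * t)).
have -> : v + (r * (s * t))%:C * (mu - v) - v = (r * (s * t))%:C * (mu - v).
  by ring.
rewrite [Num.conj (_ * _)]rmorphM /= conjR !rmorphM /=.
by congr (v + _); field; rewrite s0' t0'.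
Qed.

(** Classically the coordinates of the conjugate are the squared sides divided by [p1], [p2], [p3].
    Multiplied by [p1 * p2 * p3], they still make sense when [mu] is on a side, and then give the
    opposite vertex. *)
Definition isogonal_weights a b c (p1 p2 p3 : R) : R * R * R :=
  (nsq (c - b) * p2 * p3, nsq (a - c) * p3 * p1, nsq (b - a) * p1 * p2).

Definition isogonal_point a b c (p1 p2 p3 : R) : R[i] :=
  let: (w1, w2, w3) := isogonal_weights a b c p1 p2 p3 in
  (w1%:C * a + w2%:C * b + w3%:C * c) / (w1 + w2 + w3)%:C.

(** Cyclic symmetry lets the computation at one vertex serve for the three cevians. *)
Lemma isogonal_pointC a b c (p1 p2 p3 : R) :
  isogonal_point a b c p1 p2 p3 = isogonal_point b c a p2 p3 p1.
Proof.
by rewrite /isogonal_point /=; congr (_ / _%:C); [rewrite -addrA addrC|lra].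
Qed.

Section Triangle.
Variables (a b c mu : R[i]) (p1 p2 p3 : R).
Hypothesis abc : cross a b c != 0.
Hypotheses (p10 : 0 <= p1) (p20 : 0 <= p2) (p30 : 0 <= p3).
Hypothesis p1E : p1 + p2 + p3 = 1.
Hypothesis muE : mu = p1%:C * a + p2%:C * b + p3%:C * c.

(** As [mu] is not a vertex, at most one coordinate vanishes, so one of the three products is
    positive. *)
Lemma isogonal_mass_gt0 : mu != a -> mu != b -> mu != c ->
  0 < nsq (c - b) * p2 * p3 + nsq (a - c) * p3 * p1 + nsq (b - a) * p1 * p2.
Proof.
move=> ma mb mc.
have ncb : 0 < nsq (c - b).
  rewrite nsq_gt0 subr_eq0; apply: contra abc => /eqP ->.
  by apply/eqP; rewrite /cross; ring.
have nac : 0 < nsq (a - c).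
  rewrite nsq_gt0 subr_eq0; apply: contra abc => /eqP ->.
  by apply/eqP; rewrite /cross !ReImE; ring.
have nba : 0 < nsq (b - a).
  rewrite nsq_gt0 subr_eq0; apply: contra abc => /eqP ->.
  by apply/eqP; rewrite /cross !ReImE; ring.
have n1 : ~~ ((p2 == 0) && (p3 == 0)).
  apply: contra ma => /andP[/eqP e2 /eqP e3]; rewrite muE.
  have -> : p1 = 1 by move: p1E; rewrite e2 e3 !addr0.
  by rewrite e2 e3 !mul0r !addr0 mul1r.
have n2 : ~~ ((p1 == 0) && (p3 == 0)).
  apply: contra mb => /andP[/eqP e1 /eqP e3]; rewrite muE.
  have -> : p2 = 1 by move: p1E; rewrite e1 e3 add0r addr0.
  by rewrite e1 e3 !mul0r add0r !addr0 mul1r.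
have n3 : ~~ ((p1 == 0) && (p2 == 0)).
  apply: contra mc => /andP[/eqP e1 /eqP e2]; rewrite muE.
  have -> : p3 = 1 by move: p1E; rewrite e1 e2 !add0r.
  by rewrite e1 e2 !mul0r !add0r mul1r.
rewrite -!mulrA.
have g1 := mulr_ge0 p20 p30; have g2 := mulr_ge0 p30 p10; have g3 := mulr_ge0 p10 p20.
have h1 := mulr_ge0 (ltW ncb) g1; have h2 := mulr_ge0 (ltW nac) g2.
have h3 := mulr_ge0 (ltW nba) g3.
move: n1 n2 n3; rewrite !negb_and => n1 n2 n3.
have [e1|e1] := eqVneq p1 0.
  rewrite e1 eqxx /= in n2 n3; rewrite e1 !(mulr0, mul0r, addr0).
  by rewrite mulr_gt0 // mulr_gt0 // lt_def ?n2 ?n3.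
have [e2|e2] := eqVneq p2 0.
  rewrite e2 eqxx /= in n1; rewrite e2 !(mulr0, mul0r, addr0, add0r).
  by rewrite mulr_gt0 // mulr_gt0 // lt_def ?n1 ?e1.
suff : 0 < nsq (b - a) * (p1 * p2) by lra.
by rewrite mulr_gt0 // mulr_gt0 // lt_def ?e1 ?e2.
Qed.

Lemma isogonal_point_cevian :
  0 < nsq (c - b) * p2 * p3 + nsq (a - c) * p3 * p1 + nsq (b - a) * p1 * p2 ->
  reflected_cevian a b c mu (isogonal_point a b c p1 p2 p3).
Proof.
(* The parameter [p1 / W] is read off the weights: multiplying by [W] leaves a polynomial identity,
   once [p1] is eliminated from [mu - a]. *)
set W := _ + _ => W0; apply/reflected_cevianP => //; exists (p1 / W).
have W0' : W%:C != 0 by apply/eqP => -[] /eqP; rewrite gt_eqF.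
rewrite /isogonal_point /= -/W; apply: (mulIf W0'); rewrite divfK //.
have -> : (a + (p1 / W)%:C * ((b - a) * (c - a) * Num.conj (mu - a))) * W%:C =
    a * W%:C + p1%:C * ((b - a) * (c - a) * Num.conj (mu - a)).
  by rewrite fmorph_div /=; field.
rewrite muE.
have -> : p1%:C * a + p2%:C * b + p3%:C * c - a = p2%:C * (b - a) + p3%:C * (c - a).
  have -> : p1 = 1 - p2 - p3 by rewrite -p1E; ring.
  by rewrite !rmorphB rmorph1; ring.
have WE : W = nsq (c - b) * p2 * p3 + nsq (a - c) * p3 * p1 + nsq (b - a) * p1 * p2 by [].
rewrite WE /nsq; apply: complex_ext; rewrite !ReImE /=; ring.
Qed.
End Triangle.

(* Two common points of the three reflected cevians would make each of these
   lines the line through both of them, and the vertices collinear. *)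
Lemma isogonal_conjugateE a b c mu (p1 p2 p3 : R) : cross a b c != 0 ->
  0 <= p1 -> 0 <= p2 -> 0 <= p3 -> p1 + p2 + p3 = 1 ->
  mu = p1%:C * a + p2%:C * b + p3%:C * c ->
  mu != a -> mu != b -> mu != c ->
  isogonal_conjugate a b c mu = isogonal_point a b c p1 p2 p3.
Proof.
move=> abc p10 p20 p30 pE muE ma mb mc.
have bca : cross b c a != 0.
  by apply: contra abc => /eqP E; apply/eqP; rewrite -E /cross !ReImE; ring.
have cab : cross c a b != 0.
  by apply: contra abc => /eqP E; apply/eqP; rewrite -E /cross !ReImE; ring.
set w := isogonal_point _ _ _ _ _ _.
have wI : (reflected_cevian a b c mu `&` reflected_cevian b c a mu
          `&` reflected_cevian c a b mu) w.
  have mass := isogonal_mass_gt0 abc p10 p20 p30 pE muE ma mb mc.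
  split; first split.
  - exact: isogonal_point_cevian.
  - rewrite /w isogonal_pointC; apply: isogonal_point_cevian => //; first lra.
      by rewrite muE; ring.
    move: mass; lra.
  - rewrite /w 2!isogonal_pointC; apply: isogonal_point_cevian => //; first lra.
      by rewrite muE; ring.
    move: mass; lra.
rewrite /isogonal_conjugate; case: xgetP => [z _ [[za zb] zc]|/(_ w)//].
have [[wa wb] wc] := wI; apply/eqP/negP => /negP zw.
have pencil v p q : cross v p q != 0 -> reflected_cevian v p q mu z ->
    reflected_cevian v p q mu w -> line z (w - z) v.
  move=> cr /(reflected_cevianP _ _ cr)[t zE] /(reflected_cevianP _ _ cr)[t' wE].
  have tt : t' - t != 0.
    by rewrite subr_eq0; apply: contra zw => /eqP tE; rewrite zE wE tE.
  have tt' : (t' - t)%:C != 0 by apply/eqP => -[] /eqP; apply/negP.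
  exists (- t / (t' - t)) => //.
  rewrite {1}zE wE {1}zE fmorph_div rmorphN /= -/(rmorphB _ _) /=.
  by rewrite rmorphB /= in tt' *; field.
have /negP := abc; apply; apply/eqP/collinear_cross.
exists z, (w - z); split; first by rewrite subr_eq0 eq_sym.
by move=> v [[->|->]|->]; [apply: (pencil a b c)|apply: (pencil b c a)|apply: (pencil c a b)].
Qed.

End Isogonal.

(** * Attained points, and the estimate for two positive values *)

Section Points.
Variables (R : realType) (n : nat) (lam : 'I_n -> R[i]).
Implicit Types (z w mu nu : R[i]) (x y : 'I_n -> R[i]).

Lemma sum_at (V : nmodType) (F : 'I_n -> V) i :
  (forall k, k != i -> F k = 0) -> \sum_k F k = F i.
Proof. by move=> F0; rewrite (bigD1 i) //= big1 ?addr0. Qed.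

Lemma sum_at3 (V : nmodType) (F : 'I_n -> V) i j k :
  i != j -> j != k -> k != i ->
  (forall l, l != i -> l != j -> l != k -> F l = 0) ->
  \sum_l F l = F i + F j + F k.
Proof.
move=> ij jk ki F0; rewrite (bigD1 i) //= (bigD1 j) /=; last by rewrite eq_sym.
rewrite (bigD1 k) /=; last by rewrite ki eq_sym jk.
rewrite big1 ?addr0 ?addrA // => l /andP[/andP[li lj] lk]; exact: F0.
Qed.

Lemma sum_but2 (V : nmodType) (F : 'I_n -> V) i j : i != j ->
  \sum_k F k = F i + F j + \sum_(k | (k != i) && (k != j)) F k.
Proof.
by move=> ij; rewrite (bigD1 i) //= (bigD1 j) 1?eq_sym //= addrA.
Qed.

Lemma compression_vertex p mu k : cbary lam p mu -> p k = 0 ->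
  exists x y, compression_pair lam mu (lam k) x y.
Proof.
move=> pmu pk; have [p0 _] := pmu.
exists (fun j => (Num.sqrt (p j))%:C), (fun j => (j == k)%:R).
have E1 : (fun j => nsq (Num.sqrt (p j))%:C) = p.
  by apply/funext => j; rewrite nsq_sqrt.
have E2 : (fun j : 'I_n => nsq ((j == k)%:R : R[i])) = fun j => (j == k)%:R.
  by apply/funext => j; case: (j == k); rewrite /nsq /=; ring.
split; rewrite ?E1 ?E2 //.
- exact: bary_vertex.
- rewrite big1 // => j _; have [->|jk] := eqVneq j k.
    by rewrite pk sqrtr0 mulr0.
  by rewrite rmorph0 mul0r.
- rewrite big1 // => j _; have [->|jk] := eqVneq j k.
    by rewrite pk sqrtr0 mulr0 mul0r.
  by rewrite rmorph0 !mul0r.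
Qed.

Lemma compression_isogonal mu i j k (p1 p2 p3 : R) :
  i != j -> j != k -> k != i ->
  0 <= p1 -> 0 <= p2 -> 0 <= p3 -> p1 + p2 + p3 = 1 ->
  mu = p1%:C * lam i + p2%:C * lam j + p3%:C * lam k ->
  0 < nsq (lam k - lam j) * p2 * p3 + nsq (lam i - lam k) * p3 * p1 +
      nsq (lam j - lam i) * p1 * p2 ->
  exists x y, compression_pair lam mu
    (isogonal_point (lam i) (lam j) (lam k) p1 p2 p3) x y.
Proof.
move=> ij jk ki p10 p20 p30 pE muE; set W := _ + _ => W0.
have W0' : W%:C != 0 by apply/eqP => -[] /eqP; rewrite gt_eqF.
pose pick3 (V : nmodType) (a b c : V) (l : 'I_n) : V :=
  if l == i then a else if l == j then b else if l == k then c else 0.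
have pi (V : nmodType) (a b c : V) : pick3 V a b c i = a by rewrite /pick3 eqxx.
have pj (V : nmodType) (a b c : V) : pick3 V a b c j = b.
  by rewrite /pick3 eqxx eq_sym (negbTE ij).
have pk (V : nmodType) (a b c : V) : pick3 V a b c k = c.
  by rewrite /pick3 eqxx (negbTE ki) eq_sym (negbTE jk).
have p0 (V : nmodType) (a b c : V) l : l != i -> l != j -> l != k ->
    pick3 V a b c l = 0.
  by rewrite /pick3 => /negbTE -> /negbTE -> /negbTE ->.
pose x := pick3 R[i] (Num.sqrt p1)%:C (Num.sqrt p2)%:C (Num.sqrt p3)%:C.
pose D := (Num.sqrt W)^-1.
(* By [orthogonal_pencil], [Num.conj y * x] must be proportional to the opposite sides. Multiplying
   by the square roots of the two other weights, instead of dividing by that of the same index,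
   allows a weight to vanish; [D] normalises. *)
pose y := pick3 R[i]
  ((D * (Num.sqrt p2 * Num.sqrt p3))%:C * Num.conj (lam k - lam j))
  ((D * (Num.sqrt p3 * Num.sqrt p1))%:C * Num.conj (lam i - lam k))
  ((D * (Num.sqrt p1 * Num.sqrt p2))%:C * Num.conj (lam j - lam i)).
have ny (s t u : R) z : 0 <= t -> 0 <= u ->
    nsq ((D * (Num.sqrt t * Num.sqrt u))%:C * Num.conj z) = nsq z * t * u / W.
  move=> t0 u0; rewrite nsqM nsqR nsqJ !exprMn exprVn.
  by rewrite (sqr_sqrtr t0) (sqr_sqrtr u0) (sqr_sqrtr (ltW W0)); ring.
exists x, y; split.
- split; first by move=> l; exact: nsq_ge0.
  split.
    rewrite (sum_at3 ij jk ki) => [|l li lj lk]; last by rewrite /x p0 // nsq0.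
    by rewrite /x pi pj pk !nsq_sqrt.
  rewrite (sum_at3 ij jk ki) => [|l li lj lk]; last by rewrite /x p0 // nsq0 mul0r.
  by rewrite /x pi pj pk !nsq_sqrt.
- split; first by move=> l; exact: nsq_ge0.
  split.
    rewrite (sum_at3 ij jk ki) => [|l li lj lk]; last by rewrite /y p0 // nsq0.
    by rewrite /y pi pj pk !ny // /W -!mulrDl divff // gt_eqF.
  rewrite (sum_at3 ij jk ki) => [|l li lj lk]; last by rewrite /y p0 // nsq0 mul0r.
  rewrite /y pi pj pk !ny // /isogonal_point /= -/W !fmorph_div /=.
  by field.
- rewrite (sum_at3 ij jk ki) => [|l li lj lk]; last by rewrite /y p0 // rmorph0 mul0r.
  rewrite /x /y !pi !pj !pk !(rmorphM Num.conj) /= !conjCK !conjR.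
  by rewrite !rmorphM /=; ring.
- rewrite (sum_at3 ij jk ki) => [|l li lj lk].
    rewrite /x /y !pi !pj !pk !(rmorphM Num.conj) /= !conjCK !conjR.
    by rewrite !rmorphM /=; ring.
  by rewrite /y p0 // rmorph0 !mul0r.
Qed.

Lemma isogonal_form_le0 (u v r : R) (a b c : R[i]) (p1 p2 p3 : R) :
  0 < p1 -> 0 < p2 -> 0 < p3 -> a != b ->
  aff u v r (isogonal_point a b c p1 p2 p3) <= 0 ->
  isogonal_form (aff u v r) a b c p1 p2 p3 <= 0.
Proof.
move=> p10 p20 p30 ab.
pose W := nsq (c - b) * p2 * p3 + nsq (a - c) * p3 * p1 + nsq (b - a) * p1 * p2.
have W0 : 0 < W.
  rewrite /W ltr_wpDl //.
    by rewrite addr_ge0 // !mulr_ge0 ?nsq_ge0 // ltW.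
  by rewrite !mulr_gt0 // nsq_gt0 subr_eq0 eq_sym.
have hW : W * aff u v r (isogonal_point a b c p1 p2 p3) =
    p1 * p2 * p3 * isogonal_form (aff u v r) a b c p1 p2 p3.
  rewrite /isogonal_form /isogonal_point /= -/W -fmorphV /= mulrC /aff.
  rewrite [X in Re X]mulrC [X in Im X]mulrC cReZ cImZ !cReD !cImD !cReZ !cImZ.
  by rewrite /W; field; rewrite -/W !gt_eqF.
move=> hle; have : W * aff u v r (isogonal_point a b c p1 p2 p3) <= 0.
  by rewrite pmulr_rle0.
by rewrite hW pmulr_rle0 // !mulr_gt0.
Qed.

Section TwoPositive.
Variables (u v r : R) (i j : 'I_n) (qi qj qk : 'I_n -> R).
Let h := aff u v r.
Hypothesis ij : i != j.
Hypothesis lij : lam i != lam j.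
Hypotheses (hi : 0 <= h (lam i)) (hj : 0 <= h (lam j)).
Hypothesis q_gt0 : forall k, k != i -> k != j -> [/\ 0 < qi k, 0 < qj k & 0 < qk k].
Hypothesis iso : forall k, k != i -> k != j ->
  isogonal_form h (lam i) (lam j) (lam k) (qi k) (qj k) (qk k) <= 0.
Variables (mu nu : R[i]) (x y : 'I_n -> R[i]).
Hypothesis xy : compression_pair lam mu nu x y.
Hypotheses (xi : nsq (x i) = \sum_(k | (k != i) && (k != j)) nsq (x k) / qk k * qi k)
  (xj : nsq (x j) = \sum_(k | (k != i) && (k != j)) nsq (x k) / qk k * qj k).
Hypotheses (xi0 : x i != 0) (xj0 : x j != 0).

(* Cauchy-Schwarz in Engel's form, as a sum of squares. *)
Lemma pencil_bound (l : 'I_n) (q : 'I_n -> R) (sg : 'I_n -> R[i]) (d : R[i]) :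
  x l != 0 -> (forall k, k != i -> k != j -> 0 < q k) ->
  nsq (x l) = \sum_(k | (k != i) && (k != j)) nsq (x k) / qk k * q k ->
  Num.conj (y l) * x l * d =
    \sum_(k | (k != i) && (k != j)) Num.conj (y k) * x k * sg k ->
  nsq d * nsq (y l) <=
    \sum_(k | (k != i) && (k != j)) nsq (y k) * (nsq (sg k) * qk k / q k).
Proof.
move=> xl q0 xlE yl; rewrite -subr_ge0.
(* With this [A], the quadratic term and the real part of the cross term both equal
   [nsq d * nsq (y l)], so the expanded squares contain it with coefficient [1 - 2]. *)
pose A := y l / x l * Num.conj d.
have -> : \sum_(k | (k != i) && (k != j)) nsq (y k) * (nsq (sg k) * qk k / q k)
      - nsq d * nsq (y l) =
    \sum_(k | (k != i) && (k != j))
      q k / qk k * nsq (A * x k - Num.conj (sg k) * (qk k / q k)%:C * y k).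
  have AE : A * x l = y l * Num.conj d.
    by rewrite /A mulrAC divfK.
  have nA : nsq A * nsq (x l) = nsq d * nsq (y l).
    by rewrite -nsqM AE nsqM nsqJ mulrC.
  have rA : Re (A * (Num.conj (y l) * x l * d)) = nsq d * nsq (y l).
    have -> : A * (Num.conj (y l) * x l * d) =
      (d * Num.conj d) * (y l * Num.conj (y l)).
      transitivity (A * x l * (Num.conj (y l) * d)); first by ring.
      by rewrite AE; ring.
    by rewrite -!nsq_eq -rmorphM.
  transitivity (nsq A * \sum_(k | (k != i) && (k != j)) nsq (x k) / qk k * q k
     - 2 * Re (A * \sum_(k | (k != i) && (k != j)) Num.conj (y k) * x k * sg k)
     + \sum_(k | (k != i) && (k != j)) nsq (y k) * (nsq (sg k) * qk k / q k)).
    by rewrite -xlE -yl nA rA; ring.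
  rewrite !mulr_sumr Re_sum mulr_sumr -sumrB -big_split.
  apply: eq_bigr => k /andP[ki kj] /=.
  have [_ _ qk0] := q_gt0 ki kj; have qq := q0 _ ki kj.
  rewrite /nsq !ReImE /=; field; by rewrite !gt_eqF.
apply: sumr_ge0 => k /andP[ki kj].
have [_ _ qk0] := q_gt0 ki kj.
by rewrite mulr_ge0 ?nsq_ge0 // divr_ge0 // ltW // q0.
Qed.

(** Eliminating [w j] or [w i] from the orthogonality relations expresses the other one through the
    remaining indices, and [pencil_bound] bounds [nsq (y i)] and [nsq (y j)]. As [h] is nonnegative
    at [lam i] and [lam j], these bounds add up: [nsq d * h nu] is at most a sum of nonnegative
    multiples of the [isogonal_form] of the triangles on [lam i], [lam j]. *)
Lemma two_positive : h nu <= 0.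
Proof.
have [_ [_ by_] o1 o2] := xy.
pose d := lam j - lam i.
have d0 : 0 < nsq d by rewrite nsq_gt0 subr_eq0 eq_sym.
pose w k := Num.conj (y k) * x k.
pose s1 := \sum_(k | (k != i) && (k != j)) w k.
pose s2 := \sum_(k | (k != i) && (k != j)) w k * lam k.
have o1' : w i + w j + s1 = 0 by rewrite -[RHS]o1 (sum_but2 _ ij).
have o2' : w i * lam i + w j * lam j + s2 = 0 by rewrite -[RHS]o2 (sum_but2 _ ij).
have yi : w i * d = \sum_(k | (k != i) && (k != j)) w k * (lam k - lam j).
  under eq_bigr do rewrite mulrBr; rewrite sumrB -mulr_suml -/s1 -/s2.
  apply/eqP; rewrite -subr_eq0; apply/eqP.
  transitivity ((w i + w j + s1) * lam j - (w i * lam i + w j * lam j + s2)).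
    by rewrite /d; ring.
  by rewrite o1' o2'; ring.
have yj : w j * d = \sum_(k | (k != i) && (k != j)) w k * (lam i - lam k).
  under eq_bigr do rewrite mulrBr; rewrite sumrB -mulr_suml -/s1 -/s2.
  apply/eqP; rewrite -subr_eq0; apply/eqP.
  transitivity ((w i * lam i + w j * lam j + s2) - (w i + w j + s1) * lam i).
    by rewrite /d; ring.
  by rewrite o1' o2'; ring.
have bi := pencil_bound xi0 (fun k ki kj => let: And3 H _ _ := q_gt0 ki kj in H) xi yi.
have bj := pencil_bound xj0 (fun k ki kj => let: And3 _ H _ := q_gt0 ki kj in H) xj yj.
have -> : h nu = \sum_k nsq (y k) * h (lam k) by rewrite (bary_aff u v r by_).
rewrite -(pmulr_rle0 _ d0) (sum_but2 _ ij) 2!mulrDr.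
have bi' := ler_wpM2l hi bi; have bj' := ler_wpM2l hj bj.
apply: (@le_trans _ _ (\sum_(k | (k != i) && (k != j)) nsq (y k) * qk k *
   isogonal_form h (lam i) (lam j) (lam k) (qi k) (qj k) (qk k))); last first.
  rewrite -oppr_ge0 -sumrN sumr_ge0 // => k /andP[ki kj].
  have [_ _ qk0] := q_gt0 ki kj.
  by rewrite -mulrN !mulr_ge0 ?nsq_ge0 ?oppr_ge0 ?iso // ltW.
rewrite (_ : \sum_(k | _) nsq (y k) * qk k * _ =
  h (lam i) * (\sum_(k | (k != i) && (k != j)) nsq (y k) * (nsq (lam k - lam j) * qk k / qi k)) +
  h (lam j) * (\sum_(k | (k != i) && (k != j)) nsq (y k) * (nsq (lam i - lam k) * qk k / qj k)) +
  nsq d * \sum_(k | (k != i) && (k != j)) nsq (y k) * h (lam k)).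
  by rewrite lerD2r lerD // mulrA [_ * h _]mulrC.
rewrite !mulr_sumr -!big_split; apply: eq_bigr => k /andP[ki kj] /=.
have [q1 q2 q3] := q_gt0 ki kj.
by rewrite /isogonal_form -/d; field; rewrite !gt_eqF.
Qed.
End TwoPositive.
End Points.

(** * Essential eigenvalues and triangles around a point *)

Section Essential.
Variables (R : realType) (n : nat) (lam : 'I_n -> R[i]).
Implicit Types (z w mu nu : R[i]).

Definition essential mu k : Prop := forall p, cbary lam p mu -> p k != 0.

(* Otherwise the segment from [p] to [q] leaves the nonnegative orthant, and it
   does so at a representation of [mu] which does not use some element of [T]. *)
Lemma essential_gt0 (T : pred 'I_n) mu (p q : 'I_n -> R) :
  (forall k, T k -> essential mu k) -> cbary lam p mu -> bary lam q mu ->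
  (forall k, ~~ T k -> 0 <= q k) -> forall k, T k -> 0 < q k.
Proof.
move=> Tess pmu qmu q0 k Tk; rewrite ltNge; apply/negP => qk.
have [p0 _] := pmu.
pose P j := T j && (q j <= 0).
pose t j := p j / (p j - q j).
have Pk : P k by rewrite /P Tk.
have pq j : P j -> 0 < p j - q j.
  move=> /andP[Tj qj]; have := Tess j Tj p pmu.
  have := p0 j; rewrite le_eqVlt => /orP[/eqP <-|]; first by rewrite eqxx.
  lra.
case: (arg_minP t Pk) => j Pj tj.
have Tj : T j by case/andP: Pj.
have t0 : 0 <= t j by rewrite divr_ge0 ?(ltW (pq j Pj)).
have t1 : t j <= 1.
  rewrite ler_pdivrMr ?pq // mul1r; case/andP: Pj; lra.
pose r l := t j * q l + (1 - t j) * p l.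
have rj : r j = 0.
  by rewrite /r /t; have := pq j Pj => h; field; rewrite gt_eqF.
suff /(Tess j Tj) : cbary lam r mu by rewrite rj eqxx.
split=> [l|].
  have [Pl|nPl] := boolP (P l).
    have := tj l Pl; rewrite {2}/t ler_pdivlMr ?pq // /r; lra.
  rewrite /r addr_ge0 // mulr_ge0 //; last by rewrite subr_ge0.
  have [Tl|] := boolP (T l); last exact: q0.
  by move: nPl; rewrite /P Tl /= -ltNge => /ltW.
have -> : mu = (t j)%:C * mu + (1 - t j)%:C * mu.
  by rewrite rmorphB rmorph1; ring.
by apply: bary_mix => //; case: pmu.
Qed.

(* In the coordinate [zt], in which [lam a] is 0 and [mu] is 1, averaging over all
   pairs of points on both sides of the real line shows that one of them is
   joined by a segment crossing this line beyond 1. *)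
Lemma caratheodory_point mu p a :
  (forall k, mu != lam k) -> cbary lam p mu -> 0 < p a ->
  (exists c (t : R), [/\ p c != 0, 0 < t, t < 1
     & mu = (1 - t)%:C * lam a + t%:C * lam c]) \/
  (exists b c (t1 t2 t3 : R), [/\ p b != 0, p c != 0,
     cross (lam a) (lam b) (lam c) != 0,
     [/\ 0 < t1, 0 < t2, 0 < t3 & t1 + t2 + t3 = 1]
     & mu = t1%:C * lam a + t2%:C * lam b + t3%:C * lam c]).
Proof.
move=> mul [p0 [p1 pmu]] pa.
have ma : mu - lam a != 0 by rewrite subr_eq0.
have [zt ztE] : exists zt : 'I_n -> R[i],
    forall k, zt k = (lam k - lam a) / (mu - lam a).
  by exists (fun k => (lam k - lam a) / (mu - lam a)).
have ztK k : lam k = lam a + zt k * (mu - lam a).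
  by rewrite ztE divfK // addrC subrK.
have zta : zt a = 0 by rewrite ztE subrr mul0r.
pose e k := Re (zt k); pose f k := Im (zt k).
have sz : \sum_k (p k)%:C * zt k = 1.
  under eq_bigr do rewrite ztE mulrA mulrBr.
  rewrite -mulr_suml sumrB pmu -mulr_suml -rmorph_sum p1 /= rmorph1 mul1r.
  by rewrite divff.
have se : \sum_k p k * (e k - 1) = 0.
  under eq_bigr do rewrite mulrBr mulr1.
  rewrite sumrB p1; apply/eqP; rewrite subr_eq0; apply/eqP.
  have := congr1 (@complex.Re R) sz; rewrite Re_sum /= => E; rewrite -[RHS]E.
  by apply: eq_bigr => k _; rewrite cReZ.
have sf : \sum_k p k * f k = 0.
  have := congr1 (@complex.Im R) sz; rewrite Im_sum /= => E; rewrite -[RHS]E.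
  by apply: eq_bigr => k _; rewrite cImZ.
have [[c [pc fc ec]]|nline] :=
    pselect (exists c, [/\ p c != 0, f c = 0 & 1 < e c]).
  left; exists c, (e c)^-1; have ec0 : 0 < e c by lra.
  split=> //; first by rewrite invr_gt0.
    by rewrite invf_lt1.
  have ztc : zt c = (e c)%:C by apply: complex_ext => //=; rewrite -fc.
  rewrite (ztK c) ztc rmorphB rmorph1 mulrDr mulrA -rmorphM mulVf ?gt_eqF //.
  by rewrite rmorph1; ring.
(* The segment from [zt b] to [zt c] crosses the real line at
   [(- f c * e b + f b * e c) / (f b - f c)]; the last condition says that this exceeds 1. *)
have [[b [c [pb pc fb fc D]]]|npair] := pselect (exists b c,
    [/\ p b != 0, p c != 0, 0 < f b, f c < 0
      & 0 < - f c * (e b - 1) + f b * (e c - 1)]).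
  right; pose De := - f c * e b + f b * e c.
  have De0 : 0 < De by rewrite /De; lra.
  have De1 : De != 0 by rewrite gt_eqF.
  exists b, c, ((- f c * (e b - 1) + f b * (e c - 1)) / De), (- f c / De), (f b / De).
  split=> //.
  - have -> : cross (lam a) (lam b) (lam c) = - nsq (mu - lam a) * De.
      rewrite /cross (ztK b) (ztK c) /nsq /De /e /f.
      have dz z : lam a + z - lam a = z by ring.
      by rewrite !dz !cReM !cImM; ring.
    by rewrite mulf_neq0 // oppr_eq0 nsq_eq0.
  - split; rewrite ?divr_gt0 ?oppr_gt0 //.
    by rewrite /De; field; rewrite -/De.
  - rewrite (ztK b) (ztK c).
    set t1 := _ / De; set t2 := _ / De; set t3 := _ / De.
    have t11 : t1 = 1 - t2 - t3.
      by rewrite /t1 /t2 /t3 /De; field; rewrite -/De.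
    have tz : t2%:C * zt b + t3%:C * zt c = 1.
      apply: complex_ext; rewrite ?cReD ?cImD ?cReZ ?cImZ /= -/(e _) -/(f _).
        by rewrite /t2 /t3 /De; field; rewrite -/De.
      by rewrite /t2 /t3; ring.
    transitivity (lam a + (t2%:C * zt b + t3%:C * zt c) * (mu - lam a)).
      by rewrite tz; ring.
    by rewrite t11 !rmorphB rmorph1; ring.
exfalso.
pose G k := p k * (e k - 1).
pose P := \sum_(k | 0 < f k) G k.
pose N := \sum_(k | f k < 0) G k.
pose Z := \sum_(k | f k == 0) G k.
have tri (F : 'I_n -> R) : \sum_k F k =
    \sum_(k | 0 < f k) F k + \sum_(k | f k < 0) F k + \sum_(k | f k == 0) F k.
  rewrite (bigID (fun k => 0 < f k)) /= -addrA; congr (_ + _).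
  rewrite (bigID (fun k => f k < 0)) /=; congr (_ + _); apply: eq_bigl => k.
    by case: ltrgtP.
  by case: ltrgtP.
have PNZ : P + N + Z = 0 by rewrite -tri.
have Z0 : Z < 0.
  rewrite /Z (bigD1 a) /=; last by rewrite /f zta.
  have Ga : G a < 0 by rewrite /G /e zta /=; lra.
  suff : \sum_(k | (f k == 0) && (k != a)) G k <= 0 by lra.
  rewrite -oppr_ge0 -sumrN sumr_ge0 // => k /andP[/eqP fk _].
  rewrite /G; have [->|pk] := eqVneq (p k) 0; first by rewrite mul0r oppr0.
  rewrite -mulrN mulr_ge0 // oppr_ge0 subr_le0 leNgt; apply/negP => ek.
  by apply: nline; exists k.
pose F := \sum_(k | 0 < f k) p k * f k.
have FE : F = - \sum_(k | f k < 0) p k * f k.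
  have := tri (fun k => p k * f k); rewrite sf -/F.
  rewrite [X in _ + X]big1 => [|k /eqP ->]; last by rewrite mulr0.
  lra.
have F0 : 0 <= F by apply: sumr_ge0 => k fk; rewrite mulr_ge0 // ltW.
(* [F] is the mass moment of both sides of the real line, so the product is a double sum over
   opposite pairs, with nonpositive terms by [npair]. But [P + N = - Z > 0], as index [a] counts in
   [Z]; hence [F = 0], both sides are empty of mass, and [P + N = 0]. *)
have FPN : F * (P + N) <= 0.
  have -> : F * (P + N) = \sum_(b | 0 < f b) \sum_(c | f c < 0)
      p b * p c * (- f c * (e b - 1) + f b * (e c - 1)).
    rewrite mulrDr {1}FE mulNr mulrC /P mulr_suml -sumrN /N.
    rewrite /F mulr_suml -big_split; apply: eq_bigr => b _ /=.
    rewrite !mulr_sumr -sumrN -big_split; apply: eq_bigr => c _ /=.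
    by rewrite /G; ring.
  rewrite -oppr_ge0 -sumrN sumr_ge0 // => b fb.
  rewrite -sumrN sumr_ge0 // => c fc.
  have [->|pb] := eqVneq (p b) 0; first by rewrite !mul0r oppr0.
  have [->|pc] := eqVneq (p c) 0; first by rewrite mulr0 mul0r oppr0.
  rewrite -mulrN !mulr_ge0 // oppr_ge0 leNgt; apply/negP => D.
  by apply: npair; exists b, c.
have PN0 : 0 < P + N by lra.
have {}F0 : F = 0.
  by apply/eqP; rewrite eq_le F0 andbT -(pmulr_lle0 _ PN0).
have P0 : P = 0.
  apply: big1 => k fk; rewrite /G.
  have /eqP := F0; rewrite psumr_eq0 => [|l fl]; last by rewrite mulr_ge0 // ltW.
  move=> /allP/(_ k (mem_index_enum _))/implyP/(_ fk).
  by rewrite mulf_eq0 (gt_eqF fk) orbF => /eqP ->; rewrite mul0r.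
have N0 : N = 0.
  apply: big1 => k fk; rewrite /G.
  move: FE; rewrite F0 -sumrN => /esym/eqP.
  rewrite psumr_eq0 => [|l fl]; last by rewrite -mulrN mulr_ge0 // oppr_ge0 ltW.
  move=> /allP/(_ k (mem_index_enum _))/implyP/(_ fk).
  by rewrite oppr_eq0 mulf_eq0 (lt_eqF fk) orbF => /eqP ->; rewrite mul0r.
by move: PN0; rewrite P0 N0; lra.
Qed.

(** Interiority in terms of half-planes. Applied to an affine function and to its opposite, it
    yields points strictly on both sides of any line through [mu]. *)
Definition interior_like mu : Prop :=
  forall u v r, (u != 0) || (v != 0) -> aff u v r mu = 0 ->
    exists k, 0 < aff u v r (lam k).

(** Only indices of nonzero weight are taken, hence never [l]. If [mu] is on a segment, a third
    vertex of weight 0 is added: there are points strictly on both sides of its line, and [l] is at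
    most one of them. *)
Lemma caratheodory mu p l : interior_like mu -> (forall k, mu != lam k) ->
  cbary lam p mu -> p l = 0 ->
  exists i j k (t1 t2 t3 : R), [/\ [/\ i != l, j != l & k != l],
    cross (lam i) (lam j) (lam k) != 0,
    [/\ 0 <= t1, 0 <= t2, 0 <= t3 & t1 + t2 + t3 = 1]
    & mu = t1%:C * lam i + t2%:C * lam j + t3%:C * lam k].
Proof.
move=> mint mul pmu pl; have [p0 [p1 _]] := pmu.
have [a pa] : exists a, p a != 0.
  apply: contrapT => /forallNP na; have /eqP := p1.
  rewrite big1 ?(eq_sym 0) ?oner_eq0 // => k _; apply: contrapT => /eqP.
  exact: na.
have pl' k : p k != 0 -> k != l.
  by apply: contra => /eqP ->; rewrite pl.
have pa0 : 0 < p a by rewrite lt_def pa p0.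
have [[c [t [pc t0 t1 muE]]]|[b [c [t1 [t2 [t3 [pb pc cr [t10 t20 t30 tE] muE]]]]]]] :=
  caratheodory_point mul pmu pa0; last first.
  exists a, b, c, t1, t2, t3; split=> //; first by split; apply: pl'.
  by split=> //; exact: ltW.
pose d := lam c - lam a.
have ac : d != 0.
  rewrite subr_eq0; apply: contra (mul a) => /eqP E; apply/eqP.
  by rewrite muE E rmorphB rmorph1; ring.
pose u := - Im d; pose v := Re d; pose r := Im d * Re (lam a) - Re d * Im (lam a).
have uv : (u != 0) || (v != 0).
  rewrite oppr_eq0 -negb_and; apply: contra ac => /andP[/eqP i0 /eqP r0].
  by rewrite eq_complex i0 -/v r0 eqxx.
have fcr z : aff u v r z = cross (lam a) (lam c) z.
  by rewrite /aff /cross /u /v /r -/d !ReImE; ring.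
have fmu : aff u v r mu = 0.
  rewrite fcr muE /cross.
  have -> : (1 - t)%:C * lam a + t%:C * lam c - lam a = t%:C * (lam c - lam a).
    by rewrite rmorphB rmorph1; ring.
  by rewrite cReZ cImZ; ring.
have [k1 fk1] := mint _ _ _ uv fmu.
have [k2 fk2] : exists k, 0 < aff (- u) (- v) (- r) (lam k).
  apply: mint; first by rewrite (oppr_eq0 u) (oppr_eq0 v).
  by move: fmu; rewrite /aff; lra.
have {fk2} fk2 : aff u v r (lam k2) < 0 by move: fk2; rewrite /aff; lra.
have [k [kl fk]] : exists k, k != l /\ cross (lam a) (lam c) (lam k) != 0.
  have [k1l|k1l] := eqVneq k1 l; last by exists k1; split=> //; rewrite -fcr gt_eqF.
  exists k2; split; last by rewrite -fcr lt_eqF.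
  rewrite -k1l.
  by apply: contraTN fk1 => /eqP <-; rewrite -leNgt ltW.
exists a, c, k, (1 - t), t, 0; split=> //; first by split=> //; apply: pl'.
  by split; rewrite ?subr_ge0 ?(ltW t0) ?(ltW t1) // addr0 subrK.
by rewrite mul0r addr0.
Qed.

End Essential.

(** * Compressions of an interior point satisfy every inequality valid on the region *)

Section Interior.
Variables (R : realType) (n : nat) (lam : 'I_n -> R[i]).
Implicit Types (z w mu nu : R[i]).

Lemma aff_inj (u v : R) z w : (u != 0) || (v != 0) ->
  u * Re z + v * Im z = u * Re w + v * Im w ->
  - v * Re z + u * Im z = - v * Re w + u * Im w -> z = w.
Proof.
move=> uv E1 E2; pose N := u ^+ 2 + v ^+ 2.
have N0 : N != 0 by rewrite /N paddr_eq0 ?sqr_ge0 // !sqrf_eq0 negb_and.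
apply: complex_ext; apply: (mulfI N0).
  transitivity (u * (u * Re z + v * Im z) - v * (- v * Re z + u * Im z)).
    by rewrite /N; ring.
  by rewrite E1 E2 /N; ring.
transitivity (v * (u * Re z + v * Im z) + u * (- v * Re z + u * Im z)).
  by rewrite /N; ring.
by rewrite E1 E2 /N; ring.
Qed.

Lemma aff0_cross (u v r : R) (a b c : R[i]) : (u != 0) || (v != 0) ->
  aff u v r a = 0 -> aff u v r b = 0 -> aff u v r c = 0 -> cross a b c = 0.
Proof.
move=> uv ha hb hc; apply/collinear_cross; apply: (collinear_aff (c := r) uv).
by move=> z [[->|->]|->].
Qed.

Lemma lex_arg_max (P : pred 'I_n) (e g : 'I_n -> R) k0 : P k0 ->
  exists2 a, P a & forall k, P k -> e k < e a \/ (e k = e a /\ g a <= g k).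
Proof.
move=> Pk0; case: (arg_maxP e Pk0) => a0 Pa0 max0.
pose Q k := P k && (e k == e a0).
have Qa0 : Q a0 by rewrite /Q Pa0 eqxx.
case: (arg_minP g Qa0) => a /andP[Pa /eqP ea] mina.
exists a => // k Pk; rewrite ea.
have := max0 k Pk; rewrite /= le_eqVlt => /orP[/eqP ek|]; last by left.
by right; split=> //; apply: mina; rewrite /Q Pk ek eqxx.
Qed.

Hypothesis spread : forall u v r : R, (u != 0) || (v != 0) ->
  exists k, aff u v r (lam k) != 0.
Hypothesis supported : forall i, exists u v r,
  [/\ (u != 0) || (v != 0), aff u v r (lam i) = 0
    & forall k, aff u v r (lam k) <= 0].
Variables (mu : R[i]).
Hypothesis mu_int : interior_like lam mu.
Variables (u v r : R).
Let h := aff u v r.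
Hypothesis h_iso : forall i j k (t1 t2 t3 : R),
  cross (lam i) (lam j) (lam k) != 0 ->
  0 <= t1 -> 0 <= t2 -> 0 <= t3 -> t1 + t2 + t3 = 1 ->
  mu = t1%:C * lam i + t2%:C * lam j + t3%:C * lam k ->
  h (isogonal_point (lam i) (lam j) (lam k) t1 t2 t3) <= 0.
Hypothesis h_ver : forall i j k l (t1 t2 t3 : R),
  cross (lam i) (lam j) (lam k) != 0 ->
  0 <= t1 -> 0 <= t2 -> 0 <= t3 -> t1 + t2 + t3 = 1 ->
  mu = t1%:C * lam i + t2%:C * lam j + t3%:C * lam k ->
  i != l -> j != l -> k != l -> h (lam l) <= 0.

Lemma interior_like_neq k : mu != lam k.
Proof.
apply/eqP => muk; have [u' [v' [r' [uv hk hle]]]] := supported k.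
rewrite -muk in hk; have [j] := mu_int uv hk.
by rewrite ltNge hle.
Qed.

(** A representation avoiding [k] gives a nondegenerate triangle around [mu] avoiding [k]; then
    [lam k] is in the prescribed set, where [h] is nonpositive. *)
Lemma positive_essential k : 0 < h (lam k) -> essential lam mu k.
Proof.
move=> hk p pmu; apply/eqP => pk.
have [i [j [l [t1 [t2 [t3 [[ik jk lk] cr [t10 t20 t30 t1E] muE]]]]]]] :=
  caratheodory mu_int interior_like_neq pmu pk.
by move: hk; rewrite ltNge (h_ver cr t10 t20 t30).
Qed.

Variables (nu : R[i]) (x y : 'I_n -> R[i]).
Hypothesis xy : compression_pair lam mu nu x y.

Let xmu : cbary lam (fun k => nsq (x k)) mu. Proof. by case: xy. Qed.

(* [a] and [b] are the points seen from [lam i] under the extreme slopes, the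
   nearest ones in case of ties; as no eigenvalue is interior, all the others lie
   in the cone of apex [lam i] through [a] and [b], beyond the line [a b]. *)
Lemma compression_le0_one i : 0 < h (lam i) ->
  (forall k, k != i -> h (lam k) <= 0) -> h nu <= 0.
Proof.
move=> hi hk; have iess := positive_essential hi.
have one_nz : ((1 : R) != 0) || ((0 : R) != 0) by rewrite oner_eq0.
have uv : (u != 0) || (v != 0).
  apply/negP => /negP; rewrite negb_or !negbK => /andP[/eqP u0 /eqP v0].
  have h_cst z : h z = r by rewrite /h /aff u0 v0; ring.
  have [k] := @spread 1 0 (- Re (lam i)) one_nz.
  have [->|/hk] := eqVneq k i; first by rewrite /aff => /eqP; lra.
  by move: hi; rewrite !h_cst; lra.
(* Coordinates centred at [lam i]: [g] is the drop of [h], positive at all other indices, [et] runs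
   along the level lines of [h], and [e] is the slope. At [i] the quotient [e] is 0 by convention,
   which [etE] tolerates since [g i = 0]. *)
pose g k := h (lam i) - h (lam k).
pose et k := - v * Re (lam k) + u * Im (lam k) -
             (- v * Re (lam i) + u * Im (lam i)).
pose e k : R := et k / g k.
have gi : g i = 0 by rewrite /g subrr.
have g0 k : k != i -> 0 < g k by move=> /hk; rewrite /g; lra.
have etE k : et k = e k * g k.
  rewrite /e; have [->|/g0 gk] := eqVneq k i; last by rewrite divfK // gt_eqF.
  by rewrite gi mulr0 /et subrr.
have [k1 k1i] : exists k, k != i.
  apply: contrapT => /forallNP all_i.
  have [k] := @spread 1 0 (- Re (lam i)) one_nz.
  have -> : k = i by apply/eqP/negPn/negP; apply: all_i.
  by rewrite /aff => /eqP; lra.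
have [a ai amax] := @lex_arg_max (fun k => k != i) e g k1 k1i.
have [b bi bmin] := @lex_arg_max (fun k => k != i) (fun k => - e k) g k1 k1i.
have eak k : k != i -> e k <= e a.
  by move=> /amax[|[->]] //; apply: ltW.
have ebk k : k != i -> e b <= e k.
  by move=> /bmin[|[/oppr_inj ->]] //; rewrite ltrN2; apply: ltW.
(* [G c] is [et - c * g] as an affine function, vanishing on the line of slope [c] through
   [lam i]. *)
pose G c := aff (- v + c * u) (u + c * v)
  (- c * h (lam i) + c * r - (- v * Re (lam i) + u * Im (lam i))).
have Gnz c : (- v + c * u != 0) || (u + c * v != 0).
  apply: contraT; rewrite negb_or !negbK => /andP[/eqP E1 /eqP E2].
  have : (u ^+ 2 + v ^+ 2) * (1 + c ^+ 2) = 0.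
    transitivity ((- v + c * u) ^+ 2 + (u + c * v) ^+ 2); first by ring.
    by rewrite E1 E2; ring.
  move=> /eqP; rewrite mulf_eq0 !paddr_eq0 ?sqr_ge0 //.
  rewrite !sqrf_eq0 oner_eq0 orbF => /andP[/eqP u0 /eqP v0].
  by move: uv; rewrite u0 v0 eqxx.
have GE c k : G c (lam k) = g k * (e k - c).
  transitivity (et k - c * g k); first by rewrite /G /et /g /h /aff; ring.
  by rewrite etE; ring.
have eba : e b < e a.
  rewrite lt_neqAle eak // andbT; apply/eqP => eE.
  have [k] := spread (- e a * h (lam i) + e a * r -
    (- v * Re (lam i) + u * Im (lam i))) (Gnz (e a)).
  rewrite -/(G (e a)) GE; have [->|ki] := eqVneq k i; first by rewrite gi mul0r eqxx.
  suff -> : e k = e a by rewrite subrr mulr0 eqxx.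
  by apply/eqP; rewrite eq_le eak //= -eE ebk.
have ab0 : e a - e b != 0 by rewrite subr_eq0 gt_eqF.
have ga0 := g0 a ai; have gb0 := g0 b bi.
have ga' : g a != 0 by rewrite gt_eqF.
have gb' : g b != 0 by rewrite gt_eqF.
(* Barycentric coordinates of [lam k] in the triangle [lam i], [lam a], [lam b], obtained by solving
   for [g] and [et]. *)
pose qa k := g k * (e k - e b) / (g a * (e a - e b)).
pose qb k := g k * (e a - e k) / (g b * (e a - e b)).
pose q0 k := 1 - qa k - qb k.
have ga1 : g a * (e a - e b) != 0 by rewrite mulf_neq0 // gt_eqF.
have gb1 : g b * (e a - e b) != 0 by rewrite mulf_neq0 // gt_eqF.
have qg k : qa k * g a + qb k * g b = g k.
  by rewrite /qa /qb; field; rewrite ga' gb' ab0.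
have qe k : qa k * et a + qb k * et b = et k.
  by rewrite !etE /qa /qb; field; rewrite ga' gb' ab0.
have qlam k : lam k = (q0 k)%:C * lam i + (qa k)%:C * lam a + (qb k)%:C * lam b.
  apply: (aff_inj uv); rewrite !cReD !cImD !cReZ !cImZ.
    by have := qg k; rewrite /g /h /aff /q0; lra.
  by have := qe k; rewrite /et /q0; lra.
have qi : [/\ q0 i = 1, qa i = 0 & qb i = 0].
  by rewrite /q0 /qa /qb gi !mul0r !subr0.
have qa0 k : 0 <= qa k.
  rewrite /qa; have [->|ki] := eqVneq k i; first by rewrite gi !mul0r.
  have gk := ltW (g0 k ki); have D := ltW eba; have gx := ltW ga0.
  by apply: divr_ge0; apply: mulr_ge0 => //; rewrite subr_ge0 // ebk.
have qb0 k : 0 <= qb k.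
  rewrite /qb; have [->|ki] := eqVneq k i; first by rewrite gi !mul0r.
  have gk := ltW (g0 k ki); have D := ltW eba; have gx := ltW gb0.
  by apply: divr_ge0; apply: mulr_ge0 => //; rewrite subr_ge0 // eak.
have crE : cross (lam i) (lam a) (lam b) != 0.
  apply/eqP => cr.
  suff : et a * g b = et b * g a.
    rewrite !etE => E.
    have : g a * g b * (e a - e b) = e a * g a * g b - e b * g b * g a by ring.
    rewrite E subrr => /eqP.
    by rewrite !mulf_eq0 (negbTE ab0) (negbTE ga') (negbTE gb').
  apply/eqP; rewrite -subr_eq0; apply/eqP.
  transitivity (- (u ^+ 2 + v ^+ 2) * cross (lam i) (lam a) (lam b) * -1).
    by rewrite /et /g /h /aff /cross !ReImE; ring.
  by rewrite cr mulr0 mul0r.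
have trivial_aff u' v' r' : (u' != 0) || (v' != 0) ->
    aff u' v' r' (lam i) = 0 -> aff u' v' r' (lam a) = 0 ->
    aff u' v' r' (lam b) = 0 -> False.
  by move=> uv' hi' ha' hb'; move/eqP: crE; apply; exact: aff0_cross uv' hi' ha' hb'.
(* If [q0 k > 0], either [lam k] is on an extreme ray, closer to [lam i] than the nearest point
   chosen there, or it is strictly inside the triangle, and its supporting line would contain the
   three vertices. *)
have q_le0 k : k != i -> q0 k <= 0.
  move=> ki; rewrite leNgt; apply/negP => q0k.
  have gk0 := g0 k ki.
  have [qak|qak] := eqVneq (qa k) 0.
    have ek : e k = e b.
      move: qak => /eqP; rewrite /qa !mulf_eq0 invr_eq0 (negbTE ga1) orbF.
      by rewrite gt_eqF //= subr_eq0 => /eqP.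
    have gbk : g b <= g k.
      by case: (bmin k ki) => [|[_]//]; rewrite ek ltxx.
    move: q0k; rewrite /q0 qak subr0 subr_gt0 ltNge /qb ek.
    by rewrite -mulf_div divff // mulr1 ler_pdivlMr // mul1r gbk.
  have [qbk|qbk] := eqVneq (qb k) 0.
    have ek : e k = e a.
      move: qbk => /eqP; rewrite /qb !mulf_eq0 invr_eq0 (negbTE gb1) orbF.
      by rewrite gt_eqF //= subr_eq0 => /eqP.
    have gak : g a <= g k.
      by case: (amax k ki) => [|[_]//]; rewrite ek ltxx.
    move: q0k; rewrite /q0 qbk subr0 subr_gt0 ltNge /qa ek.
    by rewrite -mulf_div divff // mulr1 ler_pdivlMr // mul1r gak.
  have [u' [v' [r' [uv' fk fle]]]] := supported k.
  have qak0 : 0 < qa k by rewrite lt_def qak qa0.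
  have qbk0 : 0 < qb k by rewrite lt_def qbk qb0.
  set f := aff u' v' r' in fk fle.
  have fE : q0 k * f (lam i) + qa k * f (lam a) + qb k * f (lam b) = 0.
    rewrite -[RHS]fk [in RHS](qlam k) /f /aff !cReD !cImD !cReZ !cImZ.
    have -> : r' = (q0 k + qa k + qb k) * r' by rewrite /q0; ring.
    by rewrite /q0; ring.
  have zero3 (s t : R) : 0 < s -> t <= 0 -> s * t <= 0.
    by move=> s0 t0; rewrite pmulr_rle0.
  have z1 := zero3 _ _ q0k (fle i); have z2 := zero3 _ _ qak0 (fle a).
  have z3 := zero3 _ _ qbk0 (fle b); rewrite -/f in z1 z2 z3.
  have zero (s t : R) : 0 < s -> s * t = 0 -> t = 0.
    by move=> s0 /eqP; rewrite mulf_eq0 gt_eqF //= => /eqP.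
  apply: (trivial_aff u' v' r' uv').
  - by apply: (zero _ _ q0k); rewrite -/f; lra.
  - by apply: (zero _ _ qak0); rewrite -/f; lra.
  - by apply: (zero _ _ qbk0); rewrite -/f; lra.
pose p0 := \sum_k q0 k * nsq (x k).
pose pa := \sum_k qa k * nsq (x k).
pose pb := \sum_k qb k * nsq (x k).
have [x0 [x1 xE]] := xmu.
have muE : mu = p0%:C * lam i + pa%:C * lam a + pb%:C * lam b.
  rewrite -xE /p0 /pa /pb !rmorph_sum !mulr_suml -!big_split /=.
  by apply: eq_bigr => k _; rewrite [in LHS](qlam k) !rmorphM /=; ring.
have pE : p0 + pa + pb = 1.
  by rewrite -x1 /p0 /pa /pb -!big_split; apply: eq_bigr => k _; rewrite /q0 /=; ring.
have iab : [/\ i != a, a != b & b != i].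
  split=> //; first by rewrite eq_sym.
  by apply: contraTneq eba => ->; rewrite ltxx.
have [ia ab bi'] := iab.
pose q k := if k == i then p0 else if k == a then pa else if k == b then pb else 0.
have [qi' qa' qb'] : [/\ q i = p0, q a = pa & q b = pb].
  rewrite /q !eqxx (negbTE ai) (negbTE bi) [b == a]eq_sym (negbTE ab).
  by split.
have q_else k : k != i -> k != a -> k != b -> q k = 0.
  by rewrite /q => /negbTE -> /negbTE -> /negbTE ->.
have qmu : bary lam q mu.
  split.
    by rewrite (sum_at3 ia ab bi') ?qi' ?qa' ?qb' // => k ki ka kb; rewrite q_else.
  rewrite (sum_at3 ia ab bi') ?qi' ?qa' ?qb' // => k ki ka kb.
  by rewrite q_else // mul0r.
have pa_ge0 : 0 <= pa by apply: sumr_ge0 => k _; rewrite mulr_ge0 ?nsq_ge0.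
have pb_ge0 : 0 <= pb by apply: sumr_ge0 => k _; rewrite mulr_ge0 ?nsq_ge0.
have p0_gt0 : 0 < p0.
  rewrite -qi'; apply: (@essential_gt0 _ _ _ (pred1 i) mu _ q _ xmu qmu) => //=.
    by move=> k /eqP ->.
  by move=> k ki; rewrite /q (negbTE ki); case: ifP => // _; case: ifP.
have Gmu c : G c mu = \sum_k nsq (x k) * (g k * (e k - c)).
  have [_ bx] := xmu.
  have -> : G c mu = \sum_k nsq (x k) * G c (lam k) by rewrite (bary_aff _ _ _ bx).
  by apply: eq_bigr => k _; rewrite -GE.
(* If [pb = 0], then [mu] is on the line of extreme slope [e a] through [lam i], and all the
   eigenvalues are on one side of it. *)
have pb_gt0 : 0 < pb.
  rewrite lt_def pb_ge0 andbT; apply/eqP => pb0.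
  have Gmu0 : G (e a) mu = 0.
    rewrite Gmu; transitivity (- (g b * (e a - e b)) * pb).
      rewrite /pb mulr_sumr; apply: eq_bigr => k _.
      by rewrite /qb; field; rewrite gb' ab0.
    by rewrite pb0 mulr0.
  have [k] := mu_int (Gnz (e a)) Gmu0; rewrite -/(G (e a)) GE.
  have [->|ki] := eqVneq k i; first by rewrite gi mul0r ltxx.
  by rewrite pmulr_rgt0 ?g0 // subr_gt0 ltNge eak.
have pa_gt0 : 0 < pa.
  rewrite lt_def pa_ge0 andbT; apply/eqP => pa0.
  have Gmu0 : G (e b) mu = 0.
    rewrite Gmu; transitivity (g a * (e a - e b) * pa).
      rewrite /pa mulr_sumr; apply: eq_bigr => k _.
      by rewrite /qa; field; rewrite ga' ab0.
    by rewrite pa0 mulr0.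
  have [||k] := mu_int (u := - (- v + e b * u)) (v := - (u + e b * v))
    (r := - (- e b * h (lam i) + e b * r - (- v * Re (lam i) + u * Im (lam i)))).
  - by rewrite (oppr_eq0 (- v + _)) (oppr_eq0 (u + _)) Gnz.
  - by move: Gmu0; rewrite /G /aff; lra.
  have -> : aff (- (- v + e b * u)) (- (u + e b * v))
    (- (- e b * h (lam i) + e b * r - (- v * Re (lam i) + u * Im (lam i)))) (lam k)
    = - G (e b) (lam k) by rewrite /G /aff; ring.
  rewrite GE; have [->|ki] := eqVneq k i; first by rewrite gi mul0r oppr0 ltxx.
  by rewrite oppr_gt0 pmulr_rlt0 ?g0 // subr_lt0 ltNge ebk.
have lab : lam a != lam b.
  by apply: contra crE => /eqP ->; apply/eqP; rewrite /cross; ring.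
have lia : lam i != lam a.
  by apply: contra crE => /eqP ->; apply/eqP; rewrite /cross !ReImE; ring.
have xi : x i != 0.
  have /eqP := iess _ xmu; apply: contra_notN => /eqP ->.
  by rewrite /nsq /= expr0n addr0.
apply: (one_positive (q0 := q0) (qa := qa) (qb := qb) (i := i) (a := lam a)
  (b := lam b) _ qlam qi _ lia lab hi (hk a ai) (hk b bi) xy xi p0_gt0 pa_gt0 pb_gt0).
- by move=> k; rewrite /q0; ring.
- by move=> k ki; split=> //; exact: q_le0.
- apply: isogonal_form_le0 => //.
  by apply: h_iso => //; rewrite ltW.
Qed.

(* As both weights at [i] and [j] are needed in all representations of [mu], the
   point [mu] is in all the triangles [lam i, lam j, lam k]. *)
Lemma compression_le0_two i j : i != j -> 0 < h (lam i) -> 0 < h (lam j) ->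
  h nu <= 0.
Proof.
move=> ij hi hj.
pose T := [pred k | (k == i) || (k == j)].
have Tess k : T k -> essential lam mu k.
  by case/orP => /eqP ->; apply: positive_essential.
have [x0 [x1 xE]] := xmu.
have nsqx k : T k -> 0 < nsq (x k).
  by move=> Tk; rewrite lt_def x0 andbT; exact: (Tess _ Tk _ xmu).
have Ti : T i by rewrite /= eqxx.
have Tj : T j by rewrite /= eqxx orbT.
(* Following an affine dependency from the weights of [mu] keeps [mu] fixed; a negative entry at an
   essential index would bring its weight down to 0, which happens at the factor [M]. *)
have nodep (de : 'I_n -> R) : \sum_k de k = 0 ->
    \sum_k (de k)%:C * lam k = 0 -> (forall k, ~~ T k -> 0 <= de k) ->
    forall k, T k -> 0 <= de k.
  move=> d1 d2 d0 k Tk; rewrite leNgt; apply/negP => dk.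
  pose M := nsq (x k) / - de k.
  have M0 : 0 < M by rewrite divr_gt0 ?oppr_gt0 ?nsqx.
  have : 0 < nsq (x k) + M * de k.
    apply: (@essential_gt0 _ _ _ T mu _ (fun k => nsq (x k) + M * de k) Tess xmu) => //.
      split; first by rewrite big_split -mulr_sumr /= x1 d1; ring.
      under eq_bigr do rewrite rmorphD rmorphM /= mulrDl -mulrA.
      by rewrite big_split -mulr_sumr /= xE d2; ring.
    by move=> l nTl; rewrite addr_ge0 // mulr_ge0 ?d0 // ltW.
  have dk0 : de k != 0 by rewrite lt_eqF.
  by rewrite (_ : _ + _ = 0) ?ltxx // /M; field.
have lij : lam i != lam j.
  apply/eqP => lE.
  have s1 (l : 'I_n) : \sum_k ((k == l)%:R : R) = 1.
    by rewrite (bigD1 l) //= eqxx big1 ?addr0 // => k /negbTE ->.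
  have s2 (l : 'I_n) : \sum_k ((k == l)%:R : R)%:C * lam k = lam l.
    rewrite (bigD1 l) //= eqxx mul1r big1 ?addr0 // => k /negbTE ->.
    by rewrite mul0r.
  have : 0 <= (j == i)%:R - (j == j)%:R :> R.
    apply: (nodep (fun k => (k == i)%:R - (k == j)%:R)) => //.
    - by rewrite sumrB !s1 subrr.
    - under eq_bigr do rewrite rmorphB mulrBl.
      by rewrite sumrB !s2 lE subrr.
    - by move=> k /norP[/negbTE -> /negbTE ->]; rewrite subrr.
  by rewrite eqxx eq_sym (negbTE ij) sub0r oppr_ge0 ler10.
have ldz : lam j - lam i != 0 by rewrite subr_eq0 eq_sym.
have [zt ztE] : exists zt : R[i] -> R[i],
    forall z, zt z = (z - lam i) / (lam j - lam i).
  by exists (fun z => (z - lam i) / (lam j - lam i)).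
have ztK z : z = lam i + zt z * (lam j - lam i) by rewrite ztE divfK // addrC subrK.
(* In the coordinate sending [lam i] to 0 and [lam j] to 1, [e] is the height above the line of
   these two points and [c] the position along it. *)
pose e z := Im (zt z); pose c z := Re (zt z).
have ei : e (lam i) = 0 by rewrite /e ztE subrr mul0r.
have ej : e (lam j) = 0 by rewrite /e ztE divff.
have ci : c (lam i) = 0 by rewrite /c ztE subrr mul0r.
have cj : c (lam j) = 1 by rewrite /c ztE divff.
pose NT k := (k != i) && (k != j).
have NTT k : NT k = ~~ T k by rewrite /NT /= negb_or.
(* [wj] balances the positions and [wi] the total mass, so [w] extends to a dependency. By [nodep]
   both are nonnegative, while their sum is minus the mass of [w]. *)
have nodep2 (w : 'I_n -> R) : (forall k, NT k -> 0 <= w k) ->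
    \sum_(k | NT k) w k * e (lam k) = 0 -> \sum_(k | NT k) w k <= 0.
  move=> w0 we.
  pose wj := - \sum_(k | NT k) w k * c (lam k).
  pose wi := - \sum_(k | NT k) w k - wj.
  pose de k := if k == i then wi else if k == j then wj else w k.
  have dei : de i = wi by rewrite /de eqxx.
  have dej : de j = wj by rewrite /de eqxx eq_sym (negbTE ij).
  have deN k : NT k -> de k = w k by case/andP=> /negbTE ki /negbTE kj; rewrite /de ki kj.
  have dege : forall k, T k -> 0 <= de k.
    apply: nodep.
    - rewrite (sum_but2 _ ij) dei dej (eq_bigr w) /wi; last exact: deN.
      by rewrite subrK addNr.
    - have dz : \sum_k (de k)%:C * zt (lam k) = 0.
        apply: complex_ext; rewrite ?Re_sum ?Im_sum (sum_but2 _ ij) ?cReZ ?cImZ.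
          rewrite -/(c _) -/(c _) ci cj dej mulr0 add0r mulr1.
          rewrite (eq_bigr (fun k => w k * c (lam k))) /wj ?addNr // => k NTk.
          by rewrite cReZ deN.
        rewrite -/(e _) -/(e _) ei ej !mulr0 !add0r /= -[RHS]we.
        by apply: eq_bigr => k NTk; rewrite cImZ deN.
      have d0 : \sum_k (de k)%:C = 0.
        rewrite -rmorph_sum (sum_but2 _ ij) dei dej (eq_bigr w) /wi; last exact: deN.
        by rewrite subrK addNr.
      transitivity ((\sum_k (de k)%:C) * lam i +
                    (\sum_k (de k)%:C * zt (lam k)) * (lam j - lam i)).
        rewrite !mulr_suml -big_split; apply: eq_bigr => k _.
        by rewrite [in LHS](ztK (lam k)) /=; ring.
      by rewrite dz d0 !mul0r addr0.
    - by move=> k; rewrite -NTT => NTk; rewrite deN // w0.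
  have := dege i Ti; have := dege j Tj; rewrite dei dej /wi; lra.
have ind1 k (F : 'I_n -> R) : NT k -> \sum_(l | NT l) (l == k)%:R * F l = F k.
  move=> NTk; rewrite (bigD1 k) //= eqxx mul1r big1 ?addr0 // => l /andP[_ /negbTE ->].
  by rewrite mul0r.
have ind1' k : NT k -> \sum_(l | NT l) (l == k)%:R = 1 :> R.
  move=> NTk; rewrite -[RHS](ind1 k (fun=> 1) NTk).
  by apply: eq_bigr => l _; rewrite mulr1.
have ek0 k : NT k -> e (lam k) != 0.
  move=> NTk; apply/eqP => ek.
  have : \sum_(l | NT l) (l == k)%:R <= 0 :> R.
    by apply: nodep2 => [l _|]; [exact: ler0n|rewrite ind1].
  by rewrite ind1' // ler10.
(* All other points are strictly on one side of the line: two opposite heights could be balanced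
   with positive weights, against [nodep2]. *)
have ekm k m : NT k -> NT m -> 0 < e (lam k) * e (lam m).
  move=> NTk NTm; rewrite ltNge; apply/negP => km.
  pose w l : R := `|e (lam m)| * (l == k)%:R + `|e (lam k)| * (l == m)%:R.
  have : \sum_(l | NT l) w l <= 0.
    apply: nodep2 => [l _|].
      by rewrite /w addr_ge0 // mulr_ge0 ?ler0n.
    rewrite /w; under eq_bigr do rewrite mulrDl -!mulrA.
    rewrite big_split -!mulr_sumr /= !ind1 //.
    have := ek0 _ NTk; have := ek0 _ NTm; move: km.
    case: (ltrgtP (e (lam k)) 0) => // k0 km; case: (ltrgtP (e (lam m)) 0) => // m0 _ _.
    - by move: km; rewrite nmulr_rle0 // leNgt m0.
    - by rewrite (ltr0_norm k0) (gtr0_norm m0); ring.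
    - by rewrite (gtr0_norm k0) (ltr0_norm m0); ring.
    - by move: km; rewrite pmulr_rle0 // leNgt m0.
  rewrite /w big_split -!mulr_sumr /= !ind1' // !mulr1 leNgt ltr_wpDl //.
  by rewrite normr_gt0 ek0.
pose eu := - Im (lam j - lam i); pose ev := Re (lam j - lam i).
pose er := Im (lam j - lam i) * Re (lam i) - Re (lam j - lam i) * Im (lam i).
have ecr z : aff eu ev er z = nsq (lam j - lam i) * e z.
  have -> : aff eu ev er z = cross (lam i) (lam j) z.
    by rewrite /aff /cross /eu /ev /er !ReImE; ring.
  rewrite [in LHS](ztK z) /cross /e /nsq.
  have -> : lam i + zt z * (lam j - lam i) - lam i = zt z * (lam j - lam i) by ring.
  by rewrite cReM cImM; ring.
have N0 : 0 < nsq (lam j - lam i) by rewrite nsq_gt0.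
have euv : (eu != 0) || (ev != 0).
  rewrite (oppr_eq0 (Im _)) -negb_and; apply: contra ldz => /andP[/eqP i0 /eqP r0].
  by rewrite eq_complex i0 -/ev r0 eqxx.
have eT k : T k -> e (lam k) = 0 by case/orP => /eqP ->.
have zmu : zt mu = \sum_k (nsq (x k))%:C * zt (lam k).
  rewrite ztE; under eq_bigr do rewrite ztE mulrA mulrBr.
  by rewrite -mulr_suml sumrB xE -mulr_suml -rmorph_sum x1 /= rmorph1 mul1r.
have emu : e mu = \sum_(k | NT k) nsq (x k) * e (lam k).
  rewrite /e zmu Im_sum (sum_but2 _ ij) !cImZ -/(e _) -/(e _) ei ej !mulr0 !add0r.
  by apply: eq_bigr => k _; rewrite cImZ.
have cmu : c mu = nsq (x j) + \sum_(k | NT k) nsq (x k) * c (lam k).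
  rewrite /c zmu Re_sum (sum_but2 _ ij) !cReZ -/(c _) -/(c _) ci cj mulr0 add0r mulr1.
  by congr (_ + _); apply: eq_bigr => k _; rewrite cReZ.
have ekmu k : NT k -> 0 < e (lam k) * e mu.
  move=> NTk; rewrite lt_def; apply/andP; split; last first.
    rewrite emu mulr_sumr sumr_ge0 // => m NTm.
    by rewrite mulrCA mulr_ge0 // ltW // ekm.
  rewrite mulf_neq0 ?ek0 //; apply/eqP => emu0.
  have uvk : (- e (lam k) * eu != 0) || (- e (lam k) * ev != 0).
    rewrite !(mulf_eq0 (- e (lam k))) (oppr_eq0 (e _)) (negbTE (ek0 _ NTk)) /=.
    exact: euv.
  have affM z : aff (- e (lam k) * eu) (- e (lam k) * ev) (- e (lam k) * er) z =
      - e (lam k) * aff eu ev er z by rewrite /aff; ring.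
  have [|m] := mu_int (r := - e (lam k) * er) uvk.
    by rewrite affM ecr emu0 !mulr0.
  rewrite affM ecr mulrCA pmulr_rgt0 // mulNr oppr_gt0 ltNge => /negP; apply.
  have [Tm|] := boolP (T m); first by rewrite (eT _ Tm) mulr0.
  by rewrite -NTT => NTm; rewrite ltW // ekm.
have [k0 NTk0] : exists k, NT k.
  have [k] := spread er euv; rewrite ecr mulf_eq0 negb_or => /andP[_ ek].
  by exists k; rewrite NTT; apply: contraNN ek => /eT ->.
have emu0 : e mu != 0.
  by have := ekmu _ NTk0; apply: contraTneq => ->; rewrite mulr0 ltxx.
(* Coordinates of [mu] in the triangle [lam i], [lam j], [lam k]: heights give [qk], positions
   [qj]. *)
pose qk k := e mu / e (lam k).
pose qj k := c mu - qk k * c (lam k).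
pose qi k := 1 - qk k - qj k.
have qk_gt0 k : NT k -> 0 < qk k.
  move=> NTk; have := ekmu _ NTk; have := ek0 _ NTk.
  rewrite /qk; case: (ltrgtP (e (lam k)) 0) => // k_0 _.
    by rewrite nmulr_rgt0 // nmulr_lgt0 ?invr_lt0.
  by rewrite pmulr_rgt0 // pmulr_lgt0 ?invr_gt0.
have muE k : NT k -> mu = (qi k)%:C * lam i + (qj k)%:C * lam j + (qk k)%:C * lam k.
  move=> NTk.
  have zE : zt mu = (qj k)%:C + (qk k)%:C * zt (lam k).
    apply: complex_ext; rewrite ?cReD ?cImD ?cReZ ?cImZ /= -/(c _) -/(e _).
      by rewrite /qj subrK.
    by rewrite add0r /qk divfK // ek0.
  rewrite [LHS]ztK zE [in RHS](ztK (lam k)) /qi !rmorphB rmorph1 /=; ring.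
have qE k : qi k + qj k + qk k = 1 by rewrite /qi; ring.
have qpos k : NT k -> 0 < qi k /\ 0 < qj k.
  move=> NTk; case/andP: (NTk) => ki kj.
  pose q l := if l == i then qi k else if l == j then qj k else if l == k then qk k else 0.
  have q1 : q i = qi k by rewrite /q eqxx.
  have q2 : q j = qj k by rewrite /q eqxx eq_sym (negbTE ij).
  have q3 : q k = qk k by rewrite /q eqxx (negbTE ki) (negbTE kj).
  have jk : j != k by rewrite eq_sym.
  have q_else l : l != i -> l != j -> l != k -> q l = 0.
    by rewrite /q => /negbTE -> /negbTE -> /negbTE ->.
  have qmu : bary lam q mu.
    split.
      by rewrite (sum_at3 ij jk ki) ?q1 ?q2 ?q3 // => l li lj lk; rewrite q_else.
    rewrite (sum_at3 ij jk ki) ?q1 ?q2 ?q3 -?muE // => l li lj lk.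
    by rewrite q_else // mul0r.
  have qoff l : ~~ T l -> 0 <= q l.
    rewrite -NTT => /andP[li lj]; rewrite /q (negbTE li) (negbTE lj).
    by case: ifP => // _; rewrite ltW // qk_gt0.
  have qT := essential_gt0 Tess xmu qmu qoff.
  by have := qT i Ti; have := qT j Tj; rewrite q1 q2.
(* The weights [nsq (x k) / qk k] average the representations of [mu] on these triangles into the
   one given by [x], which is what [two_positive] asks. *)
have S1 : \sum_(k | NT k) nsq (x k) / qk k = 1.
  rewrite (eq_bigr (fun k => nsq (x k) * e (lam k) * (e mu)^-1)) => [|k NTk].
    by rewrite -mulr_suml -emu divff.
  by rewrite /qk; field; rewrite emu0 ek0.
have xjE : nsq (x j) = \sum_(k | NT k) nsq (x k) / qk k * qj k.
  transitivity (c mu * \sum_(k | NT k) nsq (x k) / qk k -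
                \sum_(k | NT k) nsq (x k) * c (lam k)).
    by rewrite S1 cmu; ring.
  rewrite mulr_sumr -sumrB; apply: eq_bigr => k NTk.
  by rewrite /qj; field; rewrite gt_eqF // qk_gt0.
have xiE : nsq (x i) = \sum_(k | NT k) nsq (x k) / qk k * qi k.
  transitivity (\sum_(k | NT k) nsq (x k) / qk k -
    \sum_(k | NT k) nsq (x k) - \sum_(k | NT k) nsq (x k) / qk k * qj k).
    by rewrite S1 -xjE -x1 (sum_but2 _ ij) -/NT; ring.
  rewrite -!sumrB; apply: eq_bigr => k NTk.
  by rewrite /qi; field; rewrite gt_eqF // qk_gt0.
have xnz k : T k -> x k != 0 by move=> Tk; rewrite -nsq_gt0 nsqx.
apply: (two_positive ij lij (ltW hi) (ltW hj) _ _ xy xiE xjE (xnz i Ti) (xnz j Tj)).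
  move=> k ki kj; have NTk : NT k by rewrite /NT ki.
  by have [? ?] := qpos k NTk; split=> //; exact: qk_gt0.
move=> k ki kj; have NTk : NT k by rewrite /NT ki.
have [qi0 qj0] := qpos k NTk; have qk0 := qk_gt0 k NTk.
apply: isogonal_form_le0 => //; apply: h_iso; rewrite ?ltW //; last exact: muE.
have -> : cross (lam i) (lam j) (lam k) = aff eu ev er (lam k).
  by rewrite /aff /cross /eu /ev /er !ReImE; ring.
by rewrite ecr mulf_neq0 ?ek0 // gt_eqF.
Qed.

Lemma compression_le0 : h nu <= 0.
Proof.
have [_ [y0 by_] _ _] := xy.
have [[i hi]|npos] := pselect (exists i, 0 < h (lam i)); last first.
  rewrite /h -(bary_aff u v r by_) -oppr_ge0 -sumrN sumr_ge0 // => k _.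
  rewrite -mulrN mulr_ge0 // oppr_ge0 leNgt; apply/negP => hk.
  by apply: npos; exists k.
have [[j [ij hj]]|none] := pselect (exists j, i != j /\ 0 < h (lam j)).
  exact: compression_le0_two ij hi hj.
apply: (compression_le0_one hi) => k ki; rewrite leNgt; apply/negP => hk.
by apply: none; exists k; rewrite eq_sym.
Qed.

End Interior.

(** * Unitary diagonalization in a prescribed order *)

Section Diagonalization.
Local Open Scope sesquilinear_scope.
Variables (R : realType) (n : nat).
Implicit Types (A U : 'M[R[i]]_n).

Lemma char_poly_conj A U : U \in unitmx ->
  char_poly (invmx U *m A *m U) = char_poly A.
Proof.
move=> Uu; rewrite /char_poly.
have -> : char_poly_mx (invmx U *m A *m U) =
    map_mx polyC (invmx U) *m char_poly_mx A *m map_mx polyC U.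
  rewrite /char_poly_mx mulmxBr mulmxBl -!map_mxM; congr (_ - _).
  by rewrite mul_mx_scalar -scalemxAl -map_mxM mulVmx // map_mx1 scalemx1.
by rewrite !det_mulmx mulrAC -det_mulmx -map_mxM mulVmx // map_mx1 det1 mul1r.
Qed.

(** The spectral theorem lists the eigenvalues in its own order; comparing the factored
    characteristic polynomials gives a permutation, applied to the rows of the unitary matrix. *)
Lemma spectral_decomposition A (lam : n.-tuple R[i]) : A \is normalmx ->
  char_poly A = \prod_(z <- lam) ('X - z%:P) ->
  exists U : 'M[R[i]]_n, [/\ U *m U ^t* = 1%:M, U ^t* *m U = 1%:M
    & A = U ^t* *m diag_mx (\row_k tnth lam k) *m U].
Proof.
move=> /orthomx_spectralP AE chA.
have uP := spectral_unitarymx A; have Pu := unitarymx_unit uP.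
set P := spectralmx A in AE uP Pu; set sp := spectral_diag A in AE.
have : perm_eq [tuple sp 0 k | k < n] lam.
  apply: prod_XsubC_eq; rewrite -chA AE char_poly_conj // char_poly_trig.
    rewrite big_tuple; apply: eq_bigr => k _.
    by rewrite tnth_mktuple mxE eqxx.
  exact: diag_mx_is_trig.
rewrite perm_sym => /tuple_permP[s sE].
have lamE k : tnth lam k = sp 0 (s k).
  by rewrite (val_inj sE) !tnth_mktuple.
have PP : P *m P ^t* = 1%:M by apply/unitarymxP.
exists (\matrix_(k, j) P (s k) j).
have UU : (\matrix_(k, j) P (s k) j) *m (\matrix_(k, j) P (s k) j) ^t* = 1%:M.
  apply/matrixP => k l; rewrite !mxE.
  have /matrixP/(_ (s k) (s l)) := PP; rewrite !mxE.
  rewrite (inj_eq perm_inj) => <-.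
  by apply: eq_bigr => j _; rewrite !mxE.
split=> //; first exact: mulmx1C.
rewrite AE (invmx_unitary uP); apply/matrixP => i j.
rewrite !mxE (reindex_inj (@perm_inj _ s)) /=; apply: eq_bigr => k _.
by rewrite !mul_mx_diag !mxE -lamE.
Qed.

End Diagonalization.

(** * The three ranges in eigenbasis coordinates *)

Section Coordinates.
Local Open Scope sesquilinear_scope.
Variables (R : realType) (n : nat).
Variables (A U : 'M[R[i]]_n) (lam : 'I_n -> R[i]).
Hypotheses (UU : U *m U ^t* = 1%:M) (UU' : U ^t* *m U = 1%:M).
Hypothesis AE : A = U ^t* *m diag_mx (\row_k lam k) *m U.

Lemma ctrmxM m1 m2 m3 (B : 'M[R[i]]_(m1, m2)) (C : 'M[R[i]]_(m2, m3)) :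
  (B *m C) ^t* = C ^t* *m B ^t*.
Proof. by rewrite trmx_mul map_mxM. Qed.

Lemma ctrmxK m1 m2 (B : 'M[R[i]]_(m1, m2)) : B ^t* ^t* = B.
Proof. exact: trmxCK. Qed.

Lemma gram_coord m (V : 'M[R[i]]_(n, m)) :
  (U *m V) ^t* *m (U *m V) = V ^t* *m V.
Proof. by rewrite ctrmxM mulmxA -(mulmxA _ _ U) UU' mulmx1. Qed.

Lemma form_coord m (V : 'M[R[i]]_(n, m)) :
  (U *m V) ^t* *m diag_mx (\row_k lam k) *m (U *m V) = V ^t* *m A *m V.
Proof. by rewrite ctrmxM AE !mulmxA. Qed.

Lemma gram_entry m (W : 'M[R[i]]_(n, m)) i j :
  (W ^t* *m W) i j = \sum_k Num.conj (W k i) * W k j.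
Proof. by rewrite mxE; apply: eq_bigr => k _; rewrite !mxE. Qed.

Lemma form_entry m (W : 'M[R[i]]_(n, m)) i j :
  (W ^t* *m diag_mx (\row_k lam k) *m W) i j =
  \sum_k Num.conj (W k i) * W k j * lam k.
Proof.
rewrite mxE; apply: eq_bigr => k _; rewrite mul_mx_diag !mxE; ring.
Qed.

Lemma sum_nsq (x : 'I_n -> R[i]) :
  \sum_k Num.conj (x k) * x k = (\sum_k nsq (x k))%:C.
Proof. by rewrite rmorph_sum; apply: eq_bigr => k _; rewrite mulrC -nsq_eq. Qed.

Lemma sum_nsq_lam (x : 'I_n -> R[i]) :
  \sum_k Num.conj (x k) * x k * lam k = \sum_k (nsq (x k))%:C * lam k.
Proof.
by apply: eq_bigr => k _; rewrite [Num.conj _ * _]mulrC -nsq_eq.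
Qed.

Lemma cbary_nsq (x : 'I_n -> R[i]) z :
  \sum_k Num.conj (x k) * x k = 1 -> \sum_k Num.conj (x k) * x k * lam k = z ->
  cbary lam (fun k => nsq (x k)) z.
Proof.
rewrite sum_nsq sum_nsq_lam => x1 xz; split; first by move=> k; apply: nsq_ge0.
by split=> //; have := congr1 (@complex.Re R) x1.
Qed.

Lemma numerical_range_coord z : numerical_range A z <-> hull lam z.
Proof.
split=> [[x [x1 zE]]|[p [p0 [p1 pz]]]].
  exists (fun k => nsq ((U *m x) k 0)); apply: cbary_nsq.
    by rewrite -gram_entry gram_coord x1 mxE eqxx.
  by rewrite -form_entry form_coord -zE.
pose w : 'cV[R[i]]_n := \col_k (Num.sqrt (p k))%:C.
have Uw : U *m (U ^t* *m w) = w by rewrite mulmxA UU mul1mx.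
have nw k : nsq (w k 0) = p k by rewrite mxE nsq_sqrt.
exists (U ^t* *m w); split.
  rewrite -gram_coord Uw; apply/matrixP => i j; rewrite gram_entry !ord1.
  by rewrite sum_nsq mxE eqxx (eq_bigr p) ?p1.
rewrite -form_coord Uw form_entry sum_nsq_lam -pz.
by apply: eq_bigr => k _; rewrite nw.
Qed.

Lemma compression_range_coord mu nu : compression_range A mu nu <->
  exists x y, compression_pair lam mu nu x y.
Proof.
split=> [[V [V1 [V00 V10 V11]]]|[x [y [[x0 [x1 xmu]] [y0 [y1 ynu]] o1 o2]]]].
  exists (fun k => (U *m V) k 0), (fun k => (U *m V) k 1); split.
  - apply: cbary_nsq; first by rewrite -gram_entry gram_coord V1 mxE.
    by rewrite -form_entry form_coord.
  - apply: cbary_nsq; first by rewrite -gram_entry gram_coord V1 mxE.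
    by rewrite -form_entry form_coord.
  - by rewrite -gram_entry gram_coord V1 mxE.
  - by rewrite -form_entry form_coord.
pose w : 'M[R[i]]_(n, 2) := \matrix_(k, j) if j == 0 then x k else y k.
have Uw : U *m (U ^t* *m w) = w by rewrite mulmxA UU mul1mx.
have w0 k : w k 0 = x k by rewrite mxE.
have w1 k : w k 1 = y k by rewrite mxE.
have sw (F : 'I_n -> R[i]) (G : 'I_n -> R[i]) : (forall k, F k = G k) ->
  \sum_k F k = \sum_k G k by move=> FG; apply: eq_bigr => k _; apply: FG.
exists (U ^t* *m w); split; last first.
  rewrite /= -form_coord Uw !form_entry; split.
  - by rewrite -xmu -sum_nsq_lam; apply: sw => k; rewrite w0.
  - by rewrite -[RHS]o2; apply: sw => k; rewrite w0 w1.
  - by rewrite -ynu -sum_nsq_lam; apply: sw => k; rewrite w1.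
rewrite -gram_coord Uw; apply/matrixP => i j; rewrite gram_entry mxE.
have [->|->] : i = 0 \/ i = 1 by case: i => -[|[|//]] ?; [left|right]; apply: val_inj.
  have [->|->] : j = 0 \/ j = 1 by case: j => -[|[|//]] ?; [left|right]; apply: val_inj.
    by under eq_bigr do rewrite w0; rewrite sum_nsq x1.
  under eq_bigr do rewrite w0 w1.
  rewrite -[LHS]conjCK (rmorph_sum Num.conj) /= -[RHS]conjC0; congr (Num.conj _).
  rewrite -[RHS]o1; apply: sw => k.
  by rewrite rmorphM /= conjCK mulrC.
have [->|->] : j = 0 \/ j = 1 by case: j => -[|[|//]] ?; [left|right]; apply: val_inj.
  by under eq_bigr do rewrite w0 w1; rewrite o1.
by under eq_bigr do rewrite w1; rewrite sum_nsq y1.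
Qed.

(** The vectors of square roots of [p] and [q] have disjoint supports, so they are orthogonal for
    both the inner product and the diagonal form; the compression to their span is the scalar
    [z]. *)
Lemma rank2_disjoint z p q : cbary lam p z -> cbary lam q z ->
  (forall k, p k * q k = 0) -> rank2_numerical_range A z.
Proof.
move=> [p0 [p1 pz]] [q0 [q1 qz]] pq.
pose w : 'M[R[i]]_(n, 2) :=
  \matrix_(k, j) (Num.sqrt (if j == 0 then p k else q k))%:C.
have Uw : U *m (U ^t* *m w) = w by rewrite mulmxA UU mul1mx.
have w0 k : w k 0 = (Num.sqrt (p k))%:C by rewrite mxE.
have w1 k : w k 1 = (Num.sqrt (q k))%:C by rewrite mxE.
have ww k : w k 0 * w k 1 = 0.
  by rewrite w0 w1 -rmorphM -sqrtrM // pq sqrtr0.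
have cw k j : Num.conj (w k j) = w k j by rewrite mxE conjR.
have n0 k : nsq (w k 0) = p k by rewrite w0 nsq_sqrt.
have n1 k : nsq (w k 1) = q k by rewrite w1 nsq_sqrt.
have i01 (i : 'I_2) : i = 0 \/ i = 1.
  by case: i => -[|[|//]] ?; [left|right]; apply: val_inj.
have sw (F : 'I_n -> R[i]) (G : 'I_n -> R[i]) : (forall k, F k = G k) ->
  \sum_k F k = \sum_k G k by move=> FG; apply: eq_bigr => k _; apply: FG.
have gram : w ^t* *m w = 1%:M.
  apply/matrixP => i j; rewrite gram_entry mxE.
  have [->|->] := i01 i; have [->|->] := i01 j.
  - by rewrite sum_nsq (eq_bigr p) ?p1.
  - by rewrite big1 // => k _; rewrite cw ww.
  - by rewrite big1 // => k _; rewrite cw mulrC ww.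
  - by rewrite sum_nsq (eq_bigr q) ?q1.
have form : w ^t* *m diag_mx (\row_k lam k) *m w = z%:M.
  apply/matrixP => i j; rewrite form_entry mxE.
  have [->|->] := i01 i; have [->|->] := i01 j.
  - by rewrite sum_nsq_lam -pz mulr1n; apply: sw => k; rewrite n0.
  - by rewrite big1 // => k _; rewrite cw ww mul0r.
  - by rewrite big1 // => k _; rewrite cw [w k 1 * _]mulrC ww mul0r.
  - by rewrite sum_nsq_lam -qz mulr1n; apply: sw => k; rewrite n1.
pose V := U ^t* *m w.
have VV : V ^t* *m V = 1%:M by rewrite -gram_coord Uw.
have VAV : V ^t* *m A *m V = z%:M by rewrite -form_coord Uw.
exists (V *m V ^t*); split.
- by rewrite mulmxA -(mulmxA V) VV mulmx1.
- by rewrite ctrmxM ctrmxK.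
- apply/eqP; rewrite eqn_leq; apply/andP; split.
    by apply: leq_trans (mxrankM_maxl _ _) (rank_leq_col _).
  have rk : \rank (V ^t* *m (V *m V ^t*) *m V) = 2%N.
    by rewrite mulmxA VV mul1mx VV mxrank1.
  apply: leq_trans (eq_leq (esym rk)) _.
  by apply: leq_trans (mxrankM_maxl _ _) _; exact: mxrankM_maxr.
- have -> : V *m V ^t* *m A *m (V *m V ^t*) = V *m (V ^t* *m A *m V) *m V ^t*.
    by rewrite !mulmxA.
  by rewrite VAV mul_mx_scalar -scalemxAl.
Qed.

(** The range of the projection has dimension 2, hence contains a nonzero vector whose [k]-th
    eigenbasis coordinate is 0. Its normalised squared moduli represent [z], because the compression
    is scalar. *)
Lemma rank2_vertex z k : rank2_numerical_range A z ->
  exists p, cbary lam p z /\ p k = 0.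
Proof.
move=> [P [PP Ph Pr PAP]].
have [Q QE] : exists Q, Q = U *m P *m U ^t* by exists (U *m P *m U ^t*).
have QQ : Q *m Q = Q.
  by rewrite QE !mulmxA -(mulmxA _ (U ^t*)) UU' mulmx1 -(mulmxA U P) PP.
have Qh : Q ^t* = Q by rewrite QE !ctrmxM ctrmxK Ph mulmxA.
have [Uu Uu'] := mulmx1_unit UU.
have Qr : \rank Q = 2%N.
  rewrite QE mxrankMfree ?row_free_unit // -Pr.
  by rewrite eqmxMfull // row_full_unit.
have QDQ : Q *m diag_mx (\row_k lam k) *m Q = z *: Q.
  transitivity (U *m (P *m A *m P) *m U ^t*); first by rewrite QE AE !mulmxA.
  by rewrite QE PAP -scalemxAr -scalemxAl.
have [v [vQ vk v0]] : exists v : 'cV[R[i]]_n, [/\ Q *m v = v, v k 0 = 0 & v != 0].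
  have colQ j : Q *m col j Q = col j Q by rewrite colE mulmxA QQ.
  have [[j Qkj]|none] := pselect (exists j, Q k j != 0); last first.
    have Q0 : Q != 0 by rewrite -mxrank_eq0 Qr.
    have /matrix0Pn[i [j Qij]] := Q0.
    exists (col j Q); split; first exact: colQ.
      by rewrite mxE; apply: contrapT => /eqP Qkj; apply: none; exists j.
    by apply/matrix0Pn; exists i, 0; rewrite mxE.
  (* Column [j] is used to cancel the [k]-th coordinate of the others. If nothing nonzero is left,
     all columns are multiples of column [j], against rank 2. *)
  pose v l := col l Q - (Q k l / Q k j) *: col j Q.
  have [[l vl]|none] := pselect (exists l, v l != 0).
    exists (v l); split=> //; last by rewrite !mxE divfK // subrr.
    by rewrite /v mulmxBr -scalemxAr !colQ.
  have : (\rank Q <= 1)%N.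
    have -> : Q = (Q k j)^-1 *: (col j Q *m row k Q).
      apply/matrixP => i l; have : v l = 0.
        by apply: contrapT => /eqP vl; apply: none; exists l.
      move=> /matrixP/(_ i 0); rewrite !mxE big_ord1 !mxE => /eqP.
      by rewrite subr_eq0 => /eqP ->; ring.
    apply: leq_trans (mxrank_scale _ _) _.
    by apply: leq_trans (mxrankM_maxl _ _) _; exact: rank_leq_col.
  by rewrite Qr.
pose N := \sum_j nsq (v j 0).
have N0 : 0 < N.
  have /matrix0Pn[i [j]] := v0; rewrite ord1 => vi.
  rewrite /N (bigD1 i) //= ltr_pwDl ?nsq_gt0 // sumr_ge0 // => l _.
  exact: nsq_ge0.
exists (fun j => nsq (v j 0) / N); split; last by rewrite vk /nsq /= expr0n addr0 mul0r.
split; first by move=> j; rewrite divr_ge0 ?nsq_ge0 // ltW.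
split; first by rewrite -mulr_suml divff // gt_eqF.
have NC : N%:C != 0 by apply/eqP => -[] /eqP; rewrite gt_eqF.
have form : v ^t* *m diag_mx (\row_k lam k) *m v = z *: (v ^t* *m v).
  rewrite -[in LHS]vQ ctrmxM Qh -!mulmxA (mulmxA Q) (mulmxA (Q *m _)) QDQ.
  by rewrite -scalemxAl -scalemxAr vQ.
have /matrixP/(_ 0 0) := form; rewrite form_entry mxE gram_entry.
rewrite sum_nsq sum_nsq_lam -/N => E.
apply: (mulIf NC); rewrite -E mulr_suml; apply: eq_bigr => j _.
by rewrite fmorph_div /=; field.
Qed.

End Coordinates.

(** * Rank-2 points, eigenvalues and edges *)

Section Vertices.
Variables (R : realType) (n : nat) (lam : 'I_n -> R[i]).
Implicit Types (z mu nu : R[i]) (p q : 'I_n -> R) (P : pred 'I_n).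

Lemma conv_hull_seq (L : seq R[i]) z :
  (forall u v r, (forall w, w \in L -> aff u v r w <= 0) -> aff u v r z <= 0) ->
  conv_hull [set` L] z.
Proof.
move=> sep.
have LE : [set` L] = range (tnth (in_tuple L)).
  apply/seteqP; split=> [w /= wL|_ [k _ <-]] /=.
    by have /tnthP[k ->] : w \in in_tuple L by []; exists k.
  exact: (mem_tnth k (in_tuple L)).
rewrite LE; apply/conv_hull_cbary; apply: contrapT => /forallNP nz.
have [u [v [r [hle]]]] := separation nz; rewrite ltNge => /negP; apply.
apply: sep => w wL; have /tnthP[k ->] : w \in in_tuple L by [].
exact: hle.
Qed.

Definition vertices (P : pred 'I_n) : set R[i] := [set lam k | k in [set` P]].

Lemma conv_hull_vertices P z :
  (forall u v r, (forall k, P k -> aff u v r (lam k) <= 0) -> aff u v r z <= 0) ->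
  conv_hull (vertices P) z.
Proof.
move=> sep; have -> : vertices P = [set` [seq lam k | k <- enum P]].
  apply/seteqP; split=> [_ [k /= Pk <-]|w /mapP[k]] /=.
    by apply: map_f; rewrite mem_enum.
  by rewrite mem_enum => Pk ->; exists k.
apply: conv_hull_seq => u v r hle; apply: sep => k Pk; apply: hle.
by apply: map_f; rewrite mem_enum.
Qed.

Lemma conv_hull_vertices_cbary P p z : cbary lam p z ->
  (forall k, ~~ P k -> p k = 0) -> conv_hull (vertices P) z.
Proof.
move=> [p0 pz] pP; apply: conv_hull_vertices => u v r hle.
rewrite -(bary_aff u v r pz) -oppr_ge0 -sumrN sumr_ge0 // => k _.
have [Pk|/pP ->] := boolP (P k); last by rewrite mul0r oppr0.
by rewrite -mulrN mulr_ge0 // oppr_ge0 hle.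
Qed.

Definition compressions mu : set R[i] :=
  [set nu | exists x y, compression_pair lam mu nu x y].

Lemma vertices_compressions P mu :
  (forall k, P k -> exists p, cbary lam p mu /\ p k = 0) ->
  conv_hull (vertices P) `<=` conv_hull (compressions mu).
Proof.
move=> Pmu; apply: conv_hull_sub => _ [k /Pmu[p [pmu pk]] <-].
by apply: sub_conv_hull; exact: compression_vertex pmu pk.
Qed.

Section RankTwo.
(** Stands for the rank-2 numerical range, through [rank2_vertex] and [rank2_disjoint]. *)
Variable R2 : R[i] -> Prop.
Hypothesis R2_vertex : forall z k, R2 z -> exists p, cbary lam p z /\ p k = 0.
Hypothesis R2_disjoint : forall z p q, cbary lam p z -> cbary lam q z ->
  (forall k, p k * q k = 0) -> R2 z.

Lemma conv_compressions_rank2 mu : R2 mu ->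
  conv_hull (compressions mu) = hull lam.
Proof.
move=> R2mu; apply/seteqP; split=> z.
  apply: conv_hull_min => [w1 w2 t [p p1] [q q2] t0 t1|w [x [y [_ yw _ _]]]].
    by exists (fun k => t * p k + (1 - t) * q k); exact: cbary_mix.
  by exists (fun k => nsq (y k)).
move=> [p pz]; apply: (@vertices_compressions xpredT).
  by move=> k _; exact: R2_vertex.
by apply: conv_hull_vertices_cbary pz _.
Qed.

(** Otherwise the weights off [i], renormalised by [1 - p i], form a second representation, disjoint
    from the trivial one. *)
Lemma rank2_avoid i p : ~ R2 (lam i) -> cbary lam p (lam i) -> p i = 1.
Proof.
move=> nR2 [p0 [p1 pz]]; apply: contrapT => pi.
have pi1 : p i < 1.
  rewrite lt_neqAle; apply/andP; split; first by apply/eqP.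
  by rewrite -p1 (bigD1 i) //= lerDl sumr_ge0.
have d0 : 0 < 1 - p i by rewrite subr_gt0.
have d0' : (1 - p i)%:C != 0 by apply/eqP => -[] /eqP; rewrite gt_eqF.
apply: nR2; apply: (@R2_disjoint _ (fun k => (k == i)%:R)
  (fun k => if k == i then 0 else p k / (1 - p i))).
- exact: bary_vertex.
- split=> [k|]; first by case: ifP => // _; rewrite divr_ge0 // ltW.
  split.
    rewrite (bigD1 i) //= eqxx add0r (eq_bigr (fun k => p k / (1 - p i))).
      rewrite -mulr_suml; move: p1; rewrite (bigD1 i) //= => E.
      rewrite (_ : \sum_(k < n | k != i) p k = 1 - p i) ?divff ?gt_eqF //.
      by rewrite -E addrAC subrr add0r.
    by move=> k /negbTE ->.
  apply: (mulfI d0'); rewrite mulr_sumr (bigD1 i) //= eqxx mul0r mulr0 add0r.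
  transitivity (\sum_(k < n | k != i) (p k)%:C * lam k).
    apply: eq_bigr => k /negbTE ->; rewrite fmorph_div /=; field.
    by rewrite -rmorphB.
  move: pz; rewrite (bigD1 i) //= => E.
  by apply/esym/eqP; rewrite rmorphB rmorph1 mulrBl mul1r subr_eq addrC E.
- by move=> k; case: eqP; rewrite ?mulr0 ?mul0r.
Qed.

(** By [rank2_avoid], [x] is supported at [i] alone, and orthogonality makes [y] vanish there. *)
Lemma conv_compressions_eigenvalue i : ~ R2 (lam i) ->
  conv_hull (compressions (lam i)) = conv_hull (vertices (predC1 i)).
Proof.
move=> nR2; apply/seteqP; split; last first.
  apply: vertices_compressions => k /= ki.
  by exists (fun j => (j == i)%:R); rewrite (negbTE ki); split=> //; exact: bary_vertex.
apply: conv_hull_sub => nu [x [y [xi ynu o1 _]]].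
have pi := rank2_avoid nR2 xi; have [x0 [x1 _]] := xi.
have xk k : k != i -> x k = 0.
  move=> ki; apply/eqP; rewrite -nsq_eq0.
  move: x1; rewrite (bigD1 i) //= pi => /eqP; rewrite addrC -subr_eq0 addrK.
  rewrite psumr_eq0 => [|l _]; last exact: nsq_ge0.
  by move=> /allP/(_ k (mem_index_enum _))/implyP; apply.
have yi : y i = 0.
  move: o1; rewrite (sum_at (i := i)) => [/eqP|k /xk ->]; last by rewrite mulr0.
  rewrite mulf_eq0 conjC_eq0 => /orP[/eqP //|xi0].
  by move: pi; rewrite (eqP xi0) nsq0 => /eqP; rewrite eq_sym oner_eq0.
apply: (conv_hull_vertices_cbary ynu) => k; rewrite /= negbK => /eqP ->.
by rewrite yi nsq0.
Qed.

Section Edge.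
Variables (mu : R[i]) (u v r : R) (d : R[i]).
Let f := aff u v r.
Hypotheses (uv : (u != 0) || (v != 0)) (fmu : f mu = 0).
Hypothesis fle : forall k, f (lam k) <= 0.
Hypotheses (d0 : d != 0) (fd : u * Re d + v * Im d = 0).

(** Signed position along the edge in units of [d], with origin [mu]. On the supporting line the
    quotient is already real. *)
Definition edge_coord z : R := Re ((z - mu) / d).
Let t k := edge_coord (lam k).
Let E k := f (lam k) = 0.

Lemma edge_coordE z : f z = 0 -> (z - mu) / d = (edge_coord z)%:C.
Proof.
move=> fz; apply: complex_ext => //=; set q := (z - mu) / d.
have wE : z - mu = q * d by rewrite /q divfK.
have E1 : u * Re (z - mu) + v * Im (z - mu) = 0.
  by move: fz fmu; rewrite /f /aff !ReImE; lra.
have : Im q * (v * Re d - u * Im d) = 0.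
  transitivity ((u * Re (q * d) + v * Im (q * d)) - Re q * (u * Re d + v * Im d)).
    by rewrite !ReImE; ring.
  by rewrite fd -wE E1; ring.
move=> /eqP; rewrite mulf_eq0 => /orP[/eqP //|/eqP E2].
have : (u ^+ 2 + v ^+ 2) * nsq d = 0.
  transitivity ((u * Re d + v * Im d) ^+ 2 + (v * Re d - u * Im d) ^+ 2).
    by rewrite /nsq; ring.
  by rewrite fd E2; ring.
move=> /eqP; rewrite mulf_eq0 nsq_eq0 (negbTE d0) orbF.
rewrite paddr_eq0 ?sqr_ge0 // !sqrf_eq0 => /andP[/eqP u0 /eqP v0].
by move: uv; rewrite u0 v0 eqxx.
Qed.

Lemma edge_coordK z : f z = 0 -> z = mu + (edge_coord z)%:C * d.
Proof. by move=> /edge_coordE <-; rewrite divfK // addrC subrK. Qed.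

Lemma edge_coord_sum p z : bary lam p z -> \sum_k p k * t k = edge_coord z.
Proof.
move=> [p1 pz]; rewrite /edge_coord.
have -> : (z - mu) / d = \sum_k (p k)%:C * ((lam k - mu) / d).
  under eq_bigr do rewrite mulrA mulrBr.
  by rewrite -mulr_suml sumrB pz -mulr_suml -rmorph_sum p1 /= rmorph1 mul1r.
by rewrite Re_sum; apply: eq_bigr => k _; rewrite cReZ.
Qed.

Lemma edge_coord_mu : edge_coord mu = 0.
Proof. by rewrite /edge_coord subrr mul0r. Qed.

Lemma edge_support p z k : cbary lam p z -> f z = 0 -> f (lam k) != 0 -> p k = 0.
Proof.
move=> [p0 pz] fz fk.
have := bary_aff u v r pz; rewrite -/f fz => /eqP; rewrite -oppr_eq0 -sumrN.
rewrite psumr_eq0 => [/allP/(_ k (mem_index_enum _))|l _]; last first.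
  by rewrite -mulrN mulr_ge0 // oppr_ge0.
by rewrite /= oppr_eq0 mulf_eq0 -/f (negbTE fk) orbF => /eqP.
Qed.

(** The left inequality is weak so that [z] may coincide with [lam k]; the strict right one keeps
    the length [t m - t k] positive. *)
Lemma edge_segment z k m : f z = 0 -> E k -> E m ->
  t k <= edge_coord z -> edge_coord z < t m ->
  exists p, cbary lam p z /\ forall l, l != k -> l != m -> p l = 0.
Proof.
move=> fz Ek Em tk tm; have D : 0 < t m - t k by lra.
have km : k != m by apply: contraTneq D => ->; rewrite subrr ltxx.
pose a := (t m - edge_coord z) / (t m - t k).
pose b := (edge_coord z - t k) / (t m - t k).
have ab : a + b = 1 by rewrite /a /b; field; rewrite gt_eqF.
have abt : a * t k + b * t m = edge_coord z by rewrite /a /b; field; rewrite gt_eqF.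
pose p l := if l == k then a else if l == m then b else 0.
have pk : p k = a by rewrite /p eqxx.
have pm : p m = b by rewrite /p eqxx eq_sym (negbTE km).
have pl l : l != k -> l != m -> p l = 0 by rewrite /p => /negbTE -> /negbTE ->.
exists p; split=> //; split.
  by move=> l; rewrite /p; do 2?[case: ifP => _] => //; apply: divr_ge0; lra.
split.
  by rewrite (sum_but2 _ km) pk pm ab big1 ?addr0 // => l /andP[]; apply: pl.
rewrite (sum_but2 _ km) pk pm big1 ?addr0; last first.
  by move=> l /andP[lk lm]; rewrite pl // mul0r.
rewrite (edge_coordK fz) (edge_coordK Ek) (edge_coordK Em) -/(t k) -/(t m) -abt.
transitivity ((a + b)%:C * mu + (a * t k + b * t m)%:C * d).
  by rewrite !rmorphD !rmorphM /=; ring.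
by rewrite ab mul1r.
Qed.

Lemma edge_above z p : f z = 0 -> cbary lam p z ->
  exists m, [/\ p m != 0, E m & edge_coord z <= t m].
Proof.
move=> fz pz; apply: contrapT => /forallNP none.
have [p0 bz] := pz; have [p1 _] := bz.
have : 0 <= \sum_k p k * (t k - edge_coord z).
  under eq_bigr do rewrite mulrBr.
  by rewrite sumrB (edge_coord_sum bz) -mulr_suml p1 mul1r subrr.
have lt_t k : p k != 0 -> t k < edge_coord z.
  move=> pk; rewrite ltNge; apply/negP => tk; apply: (none k); split=> //.
  apply: contrapT => /eqP fk; move/eqP: pk; apply.
  exact: edge_support pz fz fk.
apply/negP; rewrite -ltNge.
have [k pk] : exists k, p k != 0.
  apply: contrapT => /forallNP na; have /eqP := p1.
  rewrite big1 ?(eq_sym 0) ?oner_eq0 // => k _; apply: contrapT => /eqP.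
  exact: na.
rewrite (bigD1 k) //= -[ltRHS](addr0 0) ltr_leD //.
  by rewrite pmulr_rlt0 ?subr_lt0 ?lt_t // lt_def pk p0.
rewrite -oppr_ge0 -sumrN sumr_ge0 // => l _; rewrite -mulrN.
have [->|pl] := eqVneq (p l) 0; first by rewrite mul0r.
by rewrite mulr_ge0 // oppr_ge0 subr_le0 ltW // lt_t.
Qed.

Lemma edge_up z p j : f z = 0 -> cbary lam p z -> p j = 0 ->
  exists m, [/\ m != j, E m & edge_coord z <= t m].
Proof.
move=> fz pz pj; have [m [pm Em tm]] := edge_above fz pz.
by exists m; split=> //; apply: contra pm => /eqP ->; rewrite pj.
Qed.

End Edge.

Lemma edge_coordN mu d z : edge_coord mu (- d) z = - edge_coord mu d z.
Proof. by rewrite /edge_coord invrN mulrN cReN. Qed.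

Lemma edge_down mu u v r d z p j : (forall k, aff u v r (lam k) <= 0) ->
  aff u v r z = 0 -> cbary lam p z -> p j = 0 ->
  exists m, [/\ m != j, aff u v r (lam m) = 0 &
    edge_coord mu d (lam m) <= edge_coord mu d z].
Proof.
move=> fle fz pz pj.
have [m [mj fm tm]] := edge_up mu (- d) fle fz pz pj.
by exists m; split=> //; move: tm; rewrite /= !edge_coordN lerN2.
Qed.

Section EdgeCases.
Variables (mu : R[i]) (u v r : R) (i j : 'I_n).
Let f := aff u v r.
Let d := lam j - lam i.
Let t k := edge_coord mu d (lam k).
Hypotheses (uv : (u != 0) || (v != 0)) (fmu : f mu = 0).
Hypothesis fle : forall k, f (lam k) <= 0.
Hypotheses (fi : f (lam i) = 0) (fj : f (lam j) = 0).
Hypotheses (ti : t i < 0) (tj : 0 < t j).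
Hypothesis nR2 : ~ R2 mu.

Let d0 : d != 0.
Proof.
apply/negP => /eqP dE; move: ti tj; rewrite /t /edge_coord dE invr0 !mulr0 ltxx.
by [].
Qed.

Let fd : u * Re d + v * Im d = 0.
Proof. by move: fi fj; rewrite /f /aff /d !ReImE; lra. Qed.

Let tmu : edge_coord mu d mu = 0. Proof. exact: edge_coord_mu. Qed.

Let ij : i != j.
Proof. by apply: contraTneq ti => ->; rewrite -leNgt ltW. Qed.

Let segment := edge_segment uv fmu d0 fd.

(** Otherwise [mu] is represented both on [i], [j] and on [k], [m], with disjoint supports. *)
Lemma edge_straddle k m : k != i -> k != j -> m != i -> m != j ->
  f (lam k) = 0 -> f (lam m) = 0 -> t k <= 0 -> ~ (0 < t m).
Proof.
move=> ki kj mi mj fk fm tk tm; apply: nR2.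
have [p [pmu pz]] : exists p, cbary lam p mu /\ forall l, l != i -> l != j -> p l = 0.
  by apply: segment; rewrite // tmu // ltW.
have [q [qmu qz]] : exists p, cbary lam p mu /\ forall l, l != k -> l != m -> p l = 0.
  by apply: segment; rewrite // tmu.
apply: (R2_disjoint pmu qmu) => l.
have [->|li] := eqVneq l i; first by rewrite qz ?mulr0 // eq_sym.
have [->|lj] := eqVneq l j; first by rewrite qz ?mulr0 // eq_sym.
by rewrite pz // mul0r.
Qed.

(** Representing each end without its own index requires points of the edge at or beyond it, and
    these straddle [mu]. *)
Lemma edge_rank2_ends : R2 (lam i) -> R2 (lam j) -> False.
Proof.
move=> /(R2_vertex i)[p [pi pi0]] /(R2_vertex j)[q [qj qj0]].
have [k [ki fk tk]] := edge_down mu d fle fi pi pi0.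
have [m [mj fm tm]] := edge_up mu d fle fj qj qj0.
have tk0 : t k < 0 by apply: le_lt_trans tk ti.
have tm0 : 0 < t m by apply: lt_le_trans tj tm.
apply: (@edge_straddle k m) => //; last exact: ltW.
  by apply: contraTneq tk0 => ->; rewrite -leNgt ltW.
by apply: contraTneq tm0 => ->; rewrite -leNgt ltW.
Qed.

(** Otherwise [lam i] is represented on [k] and [j], disjointly from its trivial representation. *)
Lemma edge_rank2_extreme k : ~ R2 (lam i) -> f (lam k) = 0 -> k != i -> t i < t k.
Proof.
move=> nR2i fk ki; rewrite ltNge; apply/negP => tk; apply: nR2i.
have [p [pz p0]] : exists p, cbary lam p (lam i) /\ forall l, l != k -> l != j -> p l = 0.
  by apply: segment => //; apply: lt_trans tj.
apply: (R2_disjoint (bary_vertex lam i) pz) => l.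
have [->|_] := eqVneq l i; last by rewrite mul0r.
by rewrite p0 ?mulr0 // eq_sym.
Qed.

Lemma edge_rank2_extreme' k : ~ R2 (lam j) -> f (lam k) = 0 -> k != j -> t k < t j.
Proof.
move=> nR2j fk kj; rewrite ltNge; apply/negP => tk; apply: nR2j.
(* A repeated eigenvalue is treated apart, [edge_segment] being strict on the right. *)
have [tkj|tkj] := eqVneq (t k) (t j).
  have kE : lam k = lam j.
    rewrite (edge_coordK uv fmu d0 fd fk) (edge_coordK uv fmu d0 fd fj).
    by rewrite -/(t k) -/(t j) tkj.
  apply: (R2_disjoint (bary_vertex lam j) _ (q := fun l => (l == k)%:R)).
    by rewrite -kE; exact: bary_vertex.
  move=> l; have [->|_] := eqVneq l j; last by rewrite mul0r.
  by rewrite eq_sym (negbTE kj) mulr0.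
have [p [pz p0]] : exists p, cbary lam p (lam j) /\ forall l, l != i -> l != k -> p l = 0.
  apply: segment => //; first by apply/ltW; apply: lt_trans tj.
  by rewrite lt_neqAle eq_sym tkj.
apply: (R2_disjoint (bary_vertex lam j) pz) => l.
have [->|_] := eqVneq l j; last by rewrite mul0r.
by rewrite p0 ?mulr0 // eq_sym.
Qed.

(** Here [x] is supported on [i] and [j], with both entries nonzero; as [lam i != lam j], the two
    orthogonality relations force [y i = y j = 0]. *)
Lemma conv_compressions_edge2 :
  (forall k, f (lam k) = 0 -> k = i \/ k = j) ->
  conv_hull (compressions mu) =
  conv_hull (vertices [pred k | (k != i) && (k != j)]).
Proof.
move=> Eij; apply/seteqP; split; last first.
  apply: vertices_compressions => k /andP[ki kj].
  have [p [pmu pz]] : exists p, cbary lam p mu /\ forall l, l != i -> l != j -> p l = 0.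
    by apply: segment; rewrite // tmu // ltW.
  by exists p; split=> //; exact: pz.
apply: conv_hull_sub => nu [x [y [xmu ynu o1 o2]]].
have xk k : k != i -> k != j -> x k = 0.
  move=> ki kj; apply/eqP; rewrite -nsq_eq0; apply/eqP.
  apply: (edge_support fle xmu fmu); apply/eqP => /Eij[kE|kE].
    by rewrite kE eqxx in ki.
  by rewrite kE eqxx in kj.
have [x0 bx] := xmu; have [x1 _] := bx.
have xs : nsq (x i) + nsq (x j) = 1.
  rewrite -x1 (sum_but2 _ ij) [X in _ = _ + X]big1 ?addr0 // => k /andP[ki kj].
  by rewrite xk // nsq0.
have xt : nsq (x i) * t i + nsq (x j) * t j = 0.
  have := edge_coord_sum mu d bx; rewrite tmu (sum_but2 _ ij) -/(t i) -/(t j).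
  rewrite [X in _ + X]big1 ?addr0 // => k /andP[ki kj].
  by rewrite xk // nsq0 mul0r.
have xi : x i != 0.
  rewrite -nsq_eq0; apply/eqP => xi; move: xs xt; rewrite xi mul0r !add0r => ->.
  by rewrite mul1r => E; move: tj; rewrite E ltxx.
have xj : x j != 0.
  rewrite -nsq_eq0; apply/eqP => xj; move: xs xt; rewrite xj mul0r !addr0 => ->.
  by rewrite mul1r => E; move: ti; rewrite E ltxx.
pose w k := Num.conj (y k) * x k.
have w1 : w i + w j = 0.
  rewrite -[RHS]o1 (sum_but2 _ ij) big1 ?addr0 // => k /andP[ki kj].
  by rewrite xk // mulr0.
have w2 : w i * lam i + w j * lam j = 0.
  rewrite -[RHS]o2 (sum_but2 _ ij) big1 ?addr0 // => k /andP[ki kj].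
  by rewrite xk // mulr0 mul0r.
have wj : w j = 0.
  have : w j * d = 0.
    transitivity ((w i * lam i + w j * lam j) - (w i + w j) * lam i).
      by rewrite /d; ring.
    by rewrite w1 w2; ring.
  by move/eqP; rewrite mulf_eq0 (negbTE d0) orbF => /eqP.
have wi : w i = 0 by move: w1; rewrite wj addr0.
have yi : y i = 0.
  by move: wi => /eqP; rewrite mulf_eq0 conjC_eq0 (negbTE xi) orbF => /eqP.
have yj : y j = 0.
  by move: wj => /eqP; rewrite mulf_eq0 conjC_eq0 (negbTE xj) orbF => /eqP.
apply: (conv_hull_vertices_cbary ynu) => k; rewrite /= negb_and !negbK.
by case/orP => /eqP ->; rewrite ?yi ?yj nsq0.
Qed.

(* Let [t l] be the least coordinate on the edge after [t i].  Subtracting a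
   multiple [z x] of [x] from [y] decreases the sum over the edge of the
   [(t k - t l) * |y k|^2] by [|z|^2 * t l >= 0], and a suitable [z] cancels the
   only negative term, that of index [i]. *)
Lemma conv_compressions_edge1 : R2 (lam j) ->
  conv_hull (compressions mu) = conv_hull (vertices (predC1 i)).
Proof.
move=> R2j; have [q [qj qj0]] := R2_vertex j R2j.
have [m [mj fm tm]] := edge_up mu d fle fj qj qj0.
have tm0 : 0 < t m by apply: lt_le_trans tj tm.
have mi : m != i by apply: contraTneq tm0 => ->; rewrite -leNgt ltW.
(* Another point of the edge at or before [mu] would straddle it together with [m], the point at or
   beyond [lam j]. *)
have tpos k : k != i -> f (lam k) = 0 -> 0 < t k.
  move=> ki fk; rewrite ltNge; apply/negP => tk.
  apply: (@edge_straddle k m) => //.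
  by apply: contraTneq tj => <-; rewrite -leNgt.
apply/seteqP; split; last first.
  apply: vertices_compressions => k /= ki; have [->|kj] := eqVneq k j.
    have [p [pmu pz]] : exists p, cbary lam p mu /\ forall l, l != i -> l != m -> p l = 0.
      by apply: segment; rewrite // tmu // ltW.
    by exists p; split=> //; apply: pz; rewrite eq_sym.
  have [p [pmu pz]] : exists p, cbary lam p mu /\ forall l, l != i -> l != j -> p l = 0.
    by apply: segment; rewrite // tmu // ltW.
  by exists p; split=> //; exact: pz.
apply: conv_hull_sub => nu [x [y [xmu ynu o1 o2]]].
apply: conv_hull_vertices => hu hv hr; set h := aff hu hv hr => hk.
have [y0 by_] := ynu; have [x0 bx] := xmu; have [x1 _] := bx.
have hnu : h nu = \sum_k nsq (y k) * h (lam k) by rewrite (bary_aff hu hv hr by_).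
have [hi|hi] := leP (h (lam i)) 0.
  rewrite hnu -oppr_ge0 -sumrN sumr_ge0 // => k _; rewrite -mulrN mulr_ge0 //.
  by rewrite oppr_ge0; have [->|/hk] := eqVneq k i.
have xk k : f (lam k) != 0 -> x k = 0.
  move=> fk; apply/eqP; rewrite -nsq_eq0; apply/eqP.
  exact: (edge_support fle xmu fmu).
have xi : x i != 0.
  apply/eqP => xi.
  have sx := edge_coord_sum mu d bx; rewrite tmu in sx.
  have xz k : nsq (x k) = 0.
    have [->|ki] := eqVneq k i; first by rewrite xi nsq0.
    have [/eqP fk|fk] := boolP (f (lam k) == 0); last first.
      by rewrite xk // nsq0.
    have /eqP := sx; rewrite psumr_eq0 => [|l _].
      move=> /allP/(_ k (mem_index_enum _)); rewrite /= mulf_eq0.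
      by rewrite [X in _ || X]gt_eqF ?orbF ?tpos // => /eqP.
    have [->|li] := eqVneq l i.
      by rewrite xi nsq0 mul0r.
    have [/eqP fl|fl] := boolP (f (lam l) == 0).
      by rewrite mulr_ge0 // ltW // tpos.
    by rewrite xk // nsq0 mul0r.
  by move: x1; rewrite big1 // => /eqP; rewrite eq_sym oner_eq0.
pose Q k := (k != i) && (f (lam k) == 0).
have Qj : Q j by rewrite /Q eq_sym ij; apply/eqP.
case: (arg_minP t Qj) => l /andP[li /eqP fl] tl.
have tl0 : 0 < t l by apply: tpos.
pose c k := if f (lam k) == 0 then t k - t l else 0.
have c_ge0 k : k != i -> 0 <= c k.
  move=> ki; rewrite /c; case: ifP => // fk.
  by rewrite subr_ge0 tl // /Q ki.
(* On the edge, [c k] is the value at [lam k] of [(z - mu) / d - t l]; off the edge [x k] vanishes.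
   The sum is thus a combination of the two orthogonality relations. *)
have cx : \sum_k (c k)%:C * (Num.conj (y k) * x k) = 0.
  transitivity (\sum_k ((lam k - mu) / d - (t l)%:C) * (Num.conj (y k) * x k)).
    apply: eq_bigr => k _; rewrite /c; case: ifP => [/eqP fk|/negbT fk].
      by rewrite rmorphB /= (edge_coordE uv fmu d0 fd fk).
    by rewrite xk // !mulr0.
  transitivity ((\sum_k Num.conj (y k) * x k * lam k) / d -
     (mu / d + (t l)%:C) * (\sum_k Num.conj (y k) * x k)).
    rewrite mulr_suml mulr_sumr -sumrB; apply: eq_bigr => k _; ring.
  by rewrite o1 o2; ring.
have cp : \sum_k c k * nsq (x k) = - t l.
  transitivity (\sum_k (nsq (x k) * t k - t l * nsq (x k))).
    apply: eq_bigr => k _; rewrite /c; case: ifP => [_|/negbT fk]; first by ring.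
    by rewrite xk // nsq0; ring.
  rewrite sumrB -mulr_sumr x1 mulr1.
  by have -> := edge_coord_sum mu d bx; rewrite tmu sub0r.
have cy : 0 <= \sum_k c k * nsq (y k).
  have := sum_nsqB c x y (y i / x i).
  rewrite cx cp mulr0 /= mulr0 subr0 mulrN => E.
  have S0 : 0 <= \sum_k c k * nsq (y k - y i / x i * x k).
    apply: sumr_ge0 => k _; have [->|ki] := eqVneq k i.
      by rewrite divfK // subrr nsq0 mulr0.
    by rewrite mulr_ge0 ?nsq_ge0 ?c_ge0.
  have := mulr_ge0 (nsq_ge0 (y i / x i)) (ltW tl0); move: S0; rewrite E; lra.
pose eta := hu * Re d + hv * Im d.
have hs (a : R) (w : R[i]) : h (mu + a%:C * w) = h mu + a * (hu * Re w + hv * Im w).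
  by rewrite /h /aff !ReImE /=; ring.
have hE k : f (lam k) = 0 -> h (lam k) = h (lam l) + (t k - t l) * eta.
  move=> fk; rewrite (edge_coordK uv fmu d0 fd fk) (edge_coordK uv fmu d0 fd fl).
  by rewrite !hs -/(t k) -/(t l) -/eta; ring.
(* [eta] is the slope of [h] along the edge, on which [h] falls from a positive value at [lam i] to
   a nonpositive one at [lam l]. *)
have eta0 : eta < 0.
  have hl : h (lam l) <= 0 by apply: hk.
  rewrite ltNge; apply/negP => e0.
  have := hE i fi; move: hi; rewrite ltNge => /negP + E; apply; rewrite E.
  have : (t i - t l) * eta <= 0.
    by rewrite mulr_le0_ge0 // subr_le0 ltW // (lt_trans ti).
  lra.
rewrite hnu.
apply: (@le_trans _ _ (\sum_k eta * (c k * nsq (y k)))); last first.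
  by rewrite -mulr_sumr nmulr_rle0.
apply: ler_sum => k _; rewrite /c; case: ifP => [/eqP fk|/negbT fk].
  rewrite hE // mulrDr [X in X + _ <= _]mulrC.
  have := mulr_ge0 (nsq_ge0 (y k)) (_ : 0 <= - h (lam l)).
  rewrite oppr_ge0 => /(_ (hk l li)); lra.
rewrite mul0r mulr0 -oppr_ge0 -mulrN mulr_ge0 ?nsq_ge0 // oppr_ge0 hk //.
by apply: contraNneq fk => ->; apply/eqP.
Qed.

End EdgeCases.
End RankTwo.
End Vertices.

Lemma ordS_ind (n : nat) (P : 'I_n -> Prop) (i : 'I_n) :
  P i -> (forall k, P k -> P (ordS k)) -> forall k, P k.
Proof.
move=> Pi PS k.
have Pit m : P (iter m (@ordS n) i) by elim: m => //= m IHm; exact: PS.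
have vit m : val (iter m (@ordS n) i) = ((i + m) %% n)%N.
  elim: m => [|m IHm]; first by rewrite addn0 modn_small.
  by rewrite iterS /= IHm -addn1 modnDml addn1 addnS.
(* [n - i] steps wrap round to index 0, and [k] more reach [k]. *)
have -> : k = iter (n - i + k) (@ordS n) i.
  apply: val_inj; rewrite vit addnA subnKC; last exact: ltnW.
  by rewrite modnDl modn_small.
exact: Pit.
Qed.

(** * Angular order around the centre of mass and order along an edge *)

Section Counterclockwise.
Variables (R : realType) (n : nat) (lam : 'I_n -> R[i]) (c : R[i]).
Variable theta : 'I_n -> R.
Hypothesis theta_arg : forall j,
  lam j - c = `|lam j - c| * (cos (theta j) +i* sin (theta j)).
Hypothesis theta_le : forall j k : 'I_n, (j <= k)%N -> theta j <= theta k.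
Hypothesis theta_lt : forall j k, theta k < theta j + 2 * pi.
Hypothesis center : \sum_k lam k = n%:R * c.
Hypothesis spread : forall u v r, (u != 0) || (v != 0) ->
  exists k, aff u v r (lam k) != 0.
Hypothesis supported : forall i, exists u v r,
  [/\ (u != 0) || (v != 0), aff u v r (lam i) = 0
    & forall k, aff u v r (lam k) <= 0].

Let rad k : R := Num.sqrt (nsq (lam k - c)).

Lemma cross_sin k l :
  cross c (lam k) (lam l) = rad k * rad l * sin (theta l - theta k).
Proof.
have E j : Re (lam j - c) = rad j * cos (theta j) /\
           Im (lam j - c) = rad j * sin (theta j).
  rewrite [lam j - c in LHS]theta_arg normc_def.
  by rewrite [X in _ /\ Im X = _]theta_arg normc_def cReZ cImZ.
have [k1 k2] := E k; have [l1 l2] := E l.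
by rewrite /cross k1 k2 l1 l2 sinB; ring.
Qed.

Lemma aff_center (u v r : R) : \sum_k aff u v r (lam k) = n%:R * aff u v r c.
Proof.
have nC : n%:R = (n%:R : R)%:C :> R[i] by rewrite rmorph_nat.
have E1 : \sum_k Re (lam k) = n%:R * Re c by rewrite -Re_sum center nC cReZ.
have E2 : \sum_k Im (lam k) = n%:R * Im c by rewrite -Im_sum center nC cImZ.
rewrite /aff !big_split -!mulr_sumr /= E1 E2 sumr_const card_ord -mulr_natl.
by ring.
Qed.

(** The value at the centre is the mean of nonpositive values, not all zero by [spread]. *)
Lemma aff_center_lt0 (u v r : R) : (u != 0) || (v != 0) ->
  (forall k, aff u v r (lam k) <= 0) -> aff u v r c < 0.
Proof.
move=> uv hle; have [k hk] := spread r uv.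
have n0 : 0 < n%:R :> R by rewrite ltr0n; exact: leq_ltn_trans (ltn_ord k).
rewrite -(pmulr_rlt0 _ n0) -aff_center (bigD1 k) //=.
rewrite -[ltRHS](addr0 0) ltr_leD //; first by rewrite lt_neqAle hk hle.
by rewrite -oppr_ge0 -sumrN sumr_ge0 // => l _; rewrite oppr_ge0.
Qed.

Lemma rad_gt0 k : 0 < rad k.
Proof.
rewrite sqrtr_gt0 nsq_gt0 subr_eq0; apply/eqP => kc.
have [u [v [r [uv hk hle]]]] := supported k.
by have := aff_center_lt0 uv hle; rewrite -kc hk ltxx.
Qed.

Lemma cross_gt0 k l : (0 < cross c (lam k) (lam l)) = (0 < sin (theta l - theta k)).
Proof. by rewrite cross_sin pmulr_rgt0 // mulr_gt0 ?rad_gt0. Qed.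

Lemma cross_ge0 k l : (0 <= cross c (lam k) (lam l)) = (0 <= sin (theta l - theta k)).
Proof. by rewrite cross_sin pmulr_rge0 // mulr_gt0 ?rad_gt0. Qed.

Lemma crossN (a b z : R[i]) : cross z a b = - cross z b a.
Proof. by rewrite /cross; ring. Qed.

Lemma sin_periodB (x : R) : sin (x - 2 * @pi R) = sin x.
Proof. by rewrite -[in RHS](subrK (2 * @pi R) x) mulr_natl sinD2pi. Qed.

(** Treats the wrap-around of indices once and for all: [be] is a lift of the angle of the
    successor, and all angles have lifts [th] between [be] and one full turn after [theta a]. *)
Lemma angular_gap a : exists (be : R) (th : 'I_n -> R),
  [/\ theta a <= be <= theta a + 2 * pi,
      forall l, be <= th l <= theta a + 2 * pi,
      forall l, sin (th l - theta a) = sin (theta l - theta a),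
      forall l, sin (th l - be) = sin (theta l - theta (ordS a))
    & sin (be - theta a) = sin (theta (ordS a) - theta a)].
Proof.
have p2 (x y : R) : sin (x + 2 * @pi R - y) = sin (x - y).
  by rewrite -(sin_periodB (x + _ - y)); congr sin; ring.
have p2' (x y : R) : sin (x - (y + 2 * @pi R)) = sin (x - y).
  by rewrite -(sin_periodB (x - y)); congr sin; ring.
have [an|an] := ltnP a.+1 n.
  have bE : val (ordS a) = a.+1 by rewrite /= modn_small.
  exists (theta (ordS a)), (fun l : 'I_n => if (l <= a)%N then theta l + 2 * pi else theta l).
  split=> [|l|l|l|//].
  - by rewrite theta_le ?bE //= ltW.
  - case: leqP => la; first by rewrite ltW //= lerD2r theta_le.
    by rewrite theta_le ?bE //= ltW.
  - by case: ifP; rewrite ?p2.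
  - by case: ifP; rewrite ?p2.
have aE : a.+1 = n by apply/eqP; rewrite eqn_leq an ltn_ord.
have bE : val (ordS a) = 0%N by rewrite /= aE modnn.
exists (theta (ordS a) + 2 * pi), (fun l : 'I_n => theta l + 2 * pi).
split=> [|l|l|l|]; rewrite ?p2 ?p2' //.
  by rewrite ltW //= lerD2r theta_le ?bE.
by rewrite !lerD2r !theta_le ?bE // -ltnS aE.
Qed.

(** If [l] is less than half a turn after [a], the successor of [a] comes between them. *)
Lemma successor_cross_pos a l : 0 < cross c (lam a) (lam l) ->
  0 <= cross c (lam (ordS a)) (lam l) /\ 0 <= cross c (lam a) (lam (ordS a)).
Proof.
have [be [th [/andP[ab b2] thb sa sb sab]]] := angular_gap a.
rewrite cross_gt0 -sa => sl; rewrite !cross_ge0 -sb -sab.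
have /andP[bl la] := thb l.
have lpi : th l - theta a < @pi R.
  rewrite ltNge; apply/negP => pil.
  have : 0 <= sin (th l - theta a - @pi R) by apply: sin_ge0_pi; lra.
  have -> : sin (th l - theta a - @pi R) = - sin (th l - theta a).
    by rewrite -[in RHS](subrK (@pi R) (th l - theta a)) sinDpi opprK.
  by rewrite oppr_ge0 leNgt sl.
by split; apply: sin_ge0_pi; lra.
Qed.

(** The gap after [a] exceeds half a turn, so all points are in the complementary sector, narrower
    than half a turn. *)
Lemma successor_cross_neg a l : cross c (lam a) (lam (ordS a)) < 0 ->
  0 <= cross c (lam (ordS a)) (lam l) /\ 0 <= cross c (lam l) (lam a).
Proof.
have [be [th [/andP[ab b2] thb sa sb sab]]] := angular_gap a.
move=> cr; have sl : sin (be - theta a) < 0.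
  by move: cr; rewrite ltNge cross_ge0 -sab -ltNge.
have /andP[bl la] := thb l.
have bpi : @pi R < be - theta a.
  rewrite ltNge; apply/negP => pib.
  by move: sl; rewrite ltNge sin_ge0_pi //; apply/andP; split; lra.
split; first by rewrite cross_ge0 -sb; apply: sin_ge0_pi; lra.
rewrite crossN oppr_ge0 leNgt cross_gt0 -sa -leNgt.
have : 0 <= sin (th l - theta a - @pi R) by apply: sin_ge0_pi; lra.
have -> : sin (th l - theta a - @pi R) = - sin (th l - theta a).
  by rewrite -[in RHS](subrK (@pi R) (th l - theta a)) sinDpi opprK.
by rewrite oppr_ge0.
Qed.

Section EdgeOrder.
Variables (u v r : R).
Let f := aff u v r.
Hypotheses (uv : (u != 0) || (v != 0)) (fle : forall k, f (lam k) <= 0).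

Let fc : f c < 0. Proof. exact: aff_center_lt0. Qed.

(** Cramer's rule for [z - c] in terms of [z1 - c] and [z2 - c], under a linear form. *)
Lemma cramer (z1 z2 z : R[i]) (u' v' r' : R) :
  cross c z1 z2 * (aff u' v' r' z - aff u' v' r' c) =
  cross c z z2 * (aff u' v' r' z1 - aff u' v' r' c) +
  cross c z1 z * (aff u' v' r' z2 - aff u' v' r' c).
Proof. by rewrite /cross /aff !ReImE; ring. Qed.

(* If the successor of [a] came before [a] on the edge, all the eigenvalues would
   be on the same side of the center of mass. *)
Lemma edge_successor_cross a : f (lam a) = 0 -> f (lam (ordS a)) = 0 ->
  lam a != lam (ordS a) -> 0 < cross c (lam a) (lam (ordS a)).
Proof.
move=> fa fb ab; rewrite lt_def; apply/andP; split.
  apply/eqP => cr0; case/eqP: ab; apply: (aff_inj uv).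
    by move: fa fb; rewrite /f /aff; lra.
  move: cr0; rewrite /cross !ReImE => cr0.
  have E1 : u * (Re (lam a) - Re c) + v * (Im (lam a) - Im c) = - f c.
    by move: fa; rewrite /f /aff; lra.
  have E2 : u * (Re (lam (ordS a)) - Re c) + v * (Im (lam (ordS a)) - Im c) = - f c.
    by move: fb; rewrite /f /aff; lra.
  set xa := Re (lam a) in E1 cr0 *; set ya := Im (lam a) in E1 cr0 *.
  set xb := Re (lam (ordS a)) in E2 cr0 *; set yb := Im (lam (ordS a)) in E2 cr0 *.
  have fc0 : - f c != 0 by rewrite oppr_eq0 lt_eqF.
  apply: (mulfI fc0); apply/eqP; rewrite -subr_eq0; apply/eqP.
  transitivity ((- v * (xa - Re c) + u * (ya - Im c)) *
      (u * (xb - Re c) + v * (yb - Im c))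
    - (- v * (xb - Re c) + u * (yb - Im c)) *
      (u * (xa - Re c) + v * (ya - Im c))).
    by rewrite E1 E2; ring.
  transitivity (- (u ^+ 2 + v ^+ 2) * ((xa - Re c) * (yb - Im c) - (ya - Im c) * (xb - Re c))).
    by ring.
  by rewrite cr0 mulr0.
rewrite leNgt; apply/negP => cr.
have fl l : f c <= f (lam l).
  have [c1 c2] := successor_cross_neg l cr.
  have := cramer (lam (ordS a)) (lam a) (lam l) u v r; rewrite -/f fa fb !sub0r.
  have D : 0 < cross c (lam (ordS a)) (lam a) by rewrite crossN oppr_gt0.
  move=> E; rewrite -subr_ge0 -(pmulr_rge0 _ D) E.
  by rewrite addr_ge0 // mulr_ge0 // oppr_ge0 ltW.
have := aff_center u v r; rewrite -/f.
have -> : \sum_k aff u v r (lam k) = \sum_k (f (lam k) - f c) + n%:R * f c.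
  by rewrite sumrB sumr_const card_ord mulr_natl; ring.
move=> /eqP; rewrite -subr_eq0 addrK psumr_eq0 => [|l _]; last by rewrite subr_ge0.
move=> /allP/(_ a (mem_index_enum _)); rewrite /= fa sub0r oppr_eq0.
by rewrite lt_eqF.
Qed.

(** Such a point would come after [a] and strictly before its successor in angle, against
    [successor_cross_pos]. *)
Lemma edge_successor_adjacent a k (s : R) :
  f (lam a) = 0 -> f (lam (ordS a)) = 0 -> lam a != lam (ordS a) ->
  0 < s -> s < 1 -> lam k <> lam a + s%:C * (lam (ordS a) - lam a).
Proof.
move=> fa fb ab s0 s1 kE.
have cr := edge_successor_cross fa fb ab.
have E1 : cross c (lam a) (lam k) = s * cross c (lam a) (lam (ordS a)).
  by rewrite kE /cross !ReImE /=; ring.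
have E2 : cross c (lam (ordS a)) (lam k) = - (1 - s) * cross c (lam a) (lam (ordS a)).
  by rewrite kE /cross !ReImE /=; ring.
have [] := @successor_cross_pos a k; first by rewrite E1 mulr_gt0.
by rewrite E2 mulNr oppr_ge0 leNgt mulr_gt0 // subr_gt0.
Qed.

(* Starting on the edge before [mu], a successor stays on the edge: being
   between two points of the edge as seen from [c], it would otherwise be
   interior.  So some successor must step over [mu]. *)
Lemma edge_exists mu p : f mu = 0 -> cbary lam p mu -> (forall k, mu != lam k) ->
  exists a (s : R), [/\ f (lam a) = 0, f (lam (ordS a)) = 0, 0 < s, s < 1 &
    mu = lam a + s%:C * (lam (ordS a) - lam a)].
Proof.
move=> fmu pmu mul; pose d : R[i] := (- v) +i* u.
have d0 : d != 0 by rewrite eq_complex /= oppr_eq0 negb_and orbC.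
have fd : u * Re d + v * Im d = 0 by rewrite /=; ring.
pose t z := edge_coord mu d z.
have tK z : f z = 0 -> z = mu + (t z)%:C * d by exact: edge_coordK.
have tnz k : f (lam k) = 0 -> t (lam k) != 0.
  move=> fk; apply: contra (mul k) => /eqP tk; apply/eqP.
  by rewrite (tK _ fk) tk mul0r addr0.
have crE z1 z2 : f z1 = 0 -> f z2 = 0 -> cross c z1 z2 = - f c * (t z2 - t z1).
  move=> f1 f2; have [t1 t1E] : exists a, a = t z1 by exists (t z1).
  have [t2 t2E] : exists a, a = t z2 by exists (t z2).
  rewrite -t1E -t2E (tK _ f1) (tK _ f2) -t1E -t2E /cross !ReImE /=.
  have -> : - f c = u * (Re mu - Re c) + v * (Im mu - Im c).
    by move: fmu; rewrite /f /aff; lra.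
  by ring.
have [m [_ fm tm]] := edge_above mu d fle fmu pmu.
have [k [_ fk tk]] := edge_above mu (- d) fle fmu pmu.
rewrite edge_coord_mu in tm; rewrite !edge_coordN edge_coord_mu oppr0 oppr_ge0 in tk.
have tm0 : 0 < t (lam m) by rewrite lt_def tnz.
have tk0 : t (lam k) < 0 by rewrite lt_neqAle tnz.
pose P a := f (lam a) = 0 /\ t (lam a) < 0.
have [[a [[fa ta] [fb tb]]]|nocross] := pselect (exists a, P a /\
    (f (lam (ordS a)) = 0 /\ 0 < t (lam (ordS a)))).
  have D : 0 < t (lam (ordS a)) - t (lam a) by lra.
  exists a, (- t (lam a) / (t (lam (ordS a)) - t (lam a))); split=> //.
  - by rewrite divr_gt0 // oppr_gt0.
  - by rewrite ltr_pdivrMr // mul1r; lra.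
  - set s := _ / _.
    have sE : t (lam a) + s * (t (lam (ordS a)) - t (lam a)) = 0.
      by rewrite /s divfK ?gt_eqF // subrr.
    rewrite {1}(tK _ fa) {1}(tK _ fb) {2}(tK _ fa).
    transitivity (mu + (t (lam a) + s * (t (lam (ordS a)) - t (lam a)))%:C * d).
      by rewrite sE mul0r addr0.
    by rewrite rmorphD rmorphM rmorphB /=; ring.
have : P m; last by move=> [_]; rewrite ltNge ltW.
apply: (ordS_ind (P := P) (i := k)) => // a [fa ta]; set b := ordS a.
have am : 0 < cross c (lam a) (lam m).
  by rewrite crE // mulr_gt0 ?oppr_gt0 // subr_gt0 (lt_trans ta).
have [bm ab] := successor_cross_pos am; rewrite -/b in bm ab.
have [u2 [v2 [r2 [uv2 f2b f2le]]]] := supported b.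
have f2c := aff_center_lt0 uv2 f2le.
(* The coordinates of [lam b - c] along [lam a - c] and [lam m - c] are nonnegative; the supporting
   line at [lam b] shows that they sum to at least 1. Applied to [f], this pushes [lam b] onto the
   edge. *)
have sum_ge : cross c (lam a) (lam m) <= cross c (lam b) (lam m) + cross c (lam a) (lam b).
  have := cramer (lam a) (lam m) (lam b) u2 v2 r2; rewrite f2b sub0r.
  have := f2le a; have := f2le m; set F := aff u2 v2 r2 => fm2 fa2 E.
  have F0 : 0 < - F c by rewrite oppr_gt0.
  have h1 : cross c (lam b) (lam m) * (F (lam a) - F c) <=
    cross c (lam b) (lam m) * - F c by rewrite ler_wpM2l // gerDr.
  have h2 : cross c (lam a) (lam b) * (F (lam m) - F c) <=
    cross c (lam a) (lam b) * - F c by rewrite ler_wpM2l // gerDr.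
  rewrite -(ler_pM2r F0) E; lra.
have fb : f (lam b) = 0.
  apply/eqP; rewrite eq_le fle /= -(lerD2r (- f c)) sub0r.
  have := cramer (lam a) (lam m) (lam b) u v r; rewrite fm -/f fa sub0r -mulrDl => E.
  by rewrite -(ler_pM2l am) E ler_pM2r // oppr_gt0.
split=> //; rewrite ltNge; apply/negP => tb; apply: nocross.
by exists a; split=> //; split=> //; rewrite lt_def tnz.
Qed.

End EdgeOrder.
End Counterclockwise.

Section MultisetDiff.
Variables (T : eqType).

Lemma count_multiset_diff (s K : seq T) z :
  count_mem z (multiset_diff s K) = (count_mem z s - count_mem z K)%N.
Proof.
elim: K => [|a K IHK] /=; first by rewrite subn0.
by rewrite count_mem_rem IHK -subnDA addnC.
Qed.

(** [rem] deletes the first equal value, perhaps at an index outside [I], so the two sides are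
    compared by multiplicities. *)
Lemma mem_multiset_diff n (lam : n.-tuple T) (I : seq 'I_n) z : uniq I ->
  z \in multiset_diff lam [seq tnth lam k | k <- I] <->
  exists2 k, k \notin I & z = tnth lam k.
Proof.
move=> uI; rewrite -has_pred1 has_count count_multiset_diff subn_gt0.
have -> : count_mem z lam = count (fun k => tnth lam k == z) (enum 'I_n).
  by rewrite -[in LHS](map_tnth_enum lam) count_map.
have pE : perm_eq (enum 'I_n) (I ++ [seq k <- enum 'I_n | k \notin I]).
  apply: uniq_perm; first exact: enum_uniq.
    rewrite cat_uniq uI filter_uniq ?enum_uniq // andbT; apply/hasPn => k.
    by rewrite mem_filter => /andP[].
  move=> k; rewrite mem_enum mem_cat (mem_filter (fun k => k \notin I)) mem_enum.
  by rewrite andbT; case: (k \in I).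
rewrite (seq.permP pE) count_cat count_map -[X in (X < _)%N]addn0 ltn_add2l.
rewrite -has_count; split.
  case/hasP => k; rewrite (mem_filter (fun k => k \notin I)) => /andP[kI _] /eqP zk.
  by exists k.
case=> k kI ->; apply/hasP; exists k => //.
by rewrite (mem_filter (fun k => k \notin I)) kI mem_enum.
Qed.

End MultisetDiff.

(** * Both inclusions in the interior case *)

Section Assembly.
Variables (R : realType) (n : nat) (lam : n.-tuple R[i]).
Let l k := tnth lam k.
Implicit Types (z mu : R[i]).

Lemma cbary3 i j k mu (t1 t2 t3 : R) : i != j -> j != k -> k != i ->
  0 <= t1 -> 0 <= t2 -> 0 <= t3 -> t1 + t2 + t3 = 1 ->
  mu = t1%:C * l i + t2%:C * l j + t3%:C * l k ->
  exists p, cbary l p mu /\ forall m, m != i -> m != j -> m != k -> p m = 0.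
Proof.
move=> ij jk ki t10 t20 t30 tE muE.
pose q m := if m == i then t1 else if m == j then t2 else if m == k then t3 else 0.
have q1 : q i = t1 by rewrite /q eqxx.
have q2 : q j = t2 by rewrite /q eqxx eq_sym (negbTE ij).
have q3 : q k = t3 by rewrite /q eqxx (negbTE ki) eq_sym (negbTE jk).
have q_else m : m != i -> m != j -> m != k -> q m = 0.
  by rewrite /q => /negbTE -> /negbTE -> /negbTE ->.
exists q; split=> //; split; first by move=> m; rewrite /q; do 3?[case: ifP => _].
split.
  by rewrite (sum_at3 ij jk ki) ?q1 ?q2 ?q3 // => m mi mj mk; rewrite q_else.
rewrite (sum_at3 ij jk ki) ?q1 ?q2 ?q3 -?muE // => m mi mj mk.
by rewrite q_else // mul0r.
Qed.

Lemma conv_hull3 a b c mu : conv_hull [set a; b; c] mu <->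
  exists t1 t2 t3 : R, [/\ 0 <= t1, 0 <= t2, 0 <= t3, t1 + t2 + t3 = 1 &
    mu = t1%:C * a + t2%:C * b + t3%:C * c].
Proof.
pose s := tnth [tuple a; b; c].
have -> : [set a; b; c] = range s.
  apply/seteqP; split=> [z|_ [k _ <-]] /=.
    by case=> [[->|->]|->]; [exists 0|exists 1|exists 2%:R].
  rewrite /s; case: k => -[|[|[|//]]] ? /=; rewrite (tnth_nth a) /=.
  - by left; left.
  - by left; right.
  - by right.
have S3 (V : zmodType) (F : 'I_3 -> V) : \sum_k F k = F 0 + F 1 + F 2%:R.
  rewrite !big_ord_recl big_ord0 addr0 addrA; congr (_ + F _ + F _); exact: val_inj.
split=> [/conv_hull_cbary[p [p0 [p1 <-]]]|[t1 [t2 [t3 [t10 t20 t30 tE ->]]]]].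
  exists (p 0), (p 1), (p 2%:R); split=> //; first by rewrite -p1 S3.
  by rewrite S3 /s !(tnth_nth a).
apply/conv_hull_cbary; exists (tnth [tuple t1; t2; t3]); split.
  by case=> -[|[|[|//]]] ?; rewrite (tnth_nth 0).
split; rewrite S3; first by rewrite !(tnth_nth 0).
by rewrite /s !(tnth_nth a) !(tnth_nth 0).
Qed.

Variable mu : R[i].
Definition interior_region : set R[i] :=
  [set z | exists a b c, [/\ a \in lam, b \in lam, c \in lam,
     ~ collinear [set a; b; c] & triangle_set lam mu a b c z]].

Hypothesis spread : forall u v r, (u != 0) || (v != 0) ->
  exists k, aff u v r (l k) != 0.
Hypothesis supported : forall i, exists u v r,
  [/\ (u != 0) || (v != 0), aff u v r (l i) = 0
    & forall k, aff u v r (l k) <= 0].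
Hypothesis mu_int : interior_like l mu.

Let mu_neq k : mu != l k. Proof. by apply: interior_like_neq. Qed.

Lemma cross_neq i j k : cross (l i) (l j) (l k) != 0 ->
  [/\ i != j, j != k & k != i].
Proof.
move=> cr; split; apply: contra cr => /eqP ->; apply/eqP; rewrite /cross; ring.
Qed.

Lemma conv_compressions_interior :
  conv_hull (compressions l mu) = conv_hull interior_region.
Proof.
apply/seteqP; split; apply: conv_hull_sub => nu.
  move=> [x [y xy]].
  (* Separation works for finite lists: [L] collects the eigenvalues and conjugates, over all index
     triples, that do belong to the region. *)
  pose L0 := lam ++ [seq isogonal_conjugate (l ijk.1.1) (l ijk.1.2) (l ijk.2) mu
    | ijk <- enum {: 'I_n * 'I_n * 'I_n}].
  pose L := [seq z <- L0 | `[< interior_region z >]].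
  have LP z : z \in L0 -> interior_region z -> z \in L.
    by move=> zL0 zI; rewrite mem_filter zL0 andbT; apply/asboolP.
  suff : conv_hull [set` L] nu.
    apply: conv_hull_sub => z /=; rewrite mem_filter => /andP[/asboolP zI _].
    exact: sub_conv_hull.
  apply: conv_hull_seq => u v r hL.
  have tri i j k (t1 t2 t3 : R) : 0 <= t1 -> 0 <= t2 -> 0 <= t3 -> t1 + t2 + t3 = 1 ->
      mu = t1%:C * l i + t2%:C * l j + t3%:C * l k ->
      conv_hull [set l i; l j; l k] mu.
    by move=> t10 t20 t30 tE muE; apply/conv_hull3; exists t1, t2, t3.
  apply: (compression_le0 spread supported mu_int _ _ xy).
    move=> i j k t1 t2 t3 cr t10 t20 t30 tE muE; apply: hL; apply: LP.
      rewrite mem_cat; apply/orP; right; apply/mapP.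
      exists (i, j, k); first by rewrite mem_enum.
      by rewrite /= -(isogonal_conjugateE cr t10 t20 t30 tE muE).
    exists (l i), (l j), (l k); split; try exact: mem_tnth.
      by move=> /collinear_cross /eqP; apply/negP.
    split; first exact: tri muE.
    by left; rewrite -(isogonal_conjugateE cr t10 t20 t30 tE muE).
  move=> i j k m t1 t2 t3 cr t10 t20 t30 tE muE im jm km; apply: hL; apply: LP.
    by rewrite mem_cat mem_tnth.
  have [ij jk ki] := cross_neq cr.
  exists (l i), (l j), (l k); split; try exact: mem_tnth.
    by move=> /collinear_cross /eqP; apply/negP.
  split; first exact: tri muE.
  right; have uI : uniq [:: i; j; k] by rewrite /= !inE negb_or ij jk eq_sym ki.
  apply/(mem_multiset_diff _ _ uI); exists m => //.
  by rewrite !inE !negb_or; apply/and3P; split; rewrite eq_sym.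
move=> [a [b [c [/tnthP[i ->] /tnthP[j ->] /tnthP[k ->] ncol [mu3 nuE]]]]].
have cr : cross (l i) (l j) (l k) != 0.
  by apply/eqP => /collinear_cross.
have [ij jk ki] := cross_neq cr.
have [t1 [t2 [t3 [t10 t20 t30 tE muE]]]] := (conv_hull3 _ _ _ _).1 mu3.
apply: sub_conv_hull; case: nuE => [->|].
  have -> := isogonal_conjugateE cr t10 t20 t30 tE muE (mu_neq i) (mu_neq j) (mu_neq k).
  apply: (compression_isogonal (i := i) (j := j) (k := k)) => //.
  exact: (isogonal_mass_gt0 cr t10 t20 t30 tE muE (mu_neq i) (mu_neq j) (mu_neq k)).
have uI : uniq [:: i; j; k].
  by rewrite /= !inE negb_or ij jk eq_sym ki.
move=> /(mem_multiset_diff lam nu uI)[m]; rewrite !inE !negb_or => /and3P[mi mj mk] ->.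
have [p [pmu pz]] := cbary3 ij jk ki t10 t20 t30 tE muE.
exact: (compression_vertex pmu (pz m mi mj mk)).
Qed.

End Assembly.

Section Segments.
Variables (R : realType) (n : nat) (lam : n.-tuple R[i]).

Lemma multiset_diff_vertices (I : seq 'I_n) : uniq I ->
  [set` multiset_diff lam [seq tnth lam k | k <- I]] =
  vertices (tnth lam) [pred k | k \notin I].
Proof.
move=> uI; apply/seteqP; split=> [z /= /(mem_multiset_diff lam z uI)[k kI ->]|].
  by exists k.
by move=> _ [k /= kI <-]; apply/(mem_multiset_diff lam _ uI); exists k.
Qed.

Lemma hull_segment (l : 'I_n -> R[i]) a b (s : R) : 0 <= s -> s <= 1 ->
  hull l (l a + s%:C * (l b - l a)).
Proof.
move=> s0 s1; exists (fun k => s * (k == b)%:R + (1 - s) * (k == a)%:R).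
have -> : l a + s%:C * (l b - l a) = s%:C * l b + (1 - s)%:C * l a.
  by rewrite rmorphB rmorph1; ring.
by apply: cbary_mix => //; exact: bary_vertex.
Qed.

Lemma eq_vertices (l : 'I_n -> R[i]) (P Q : pred 'I_n) :
  P =1 Q -> vertices l P = vertices l Q.
Proof. by move=> PQ; congr vertices; apply/funext. Qed.

Lemma open_segP (a b mu : R[i]) : open_seg a b mu <->
  exists s : R, [/\ 0 < s, s < 1 & mu = a + s%:C * (b - a)].
Proof.
split=> [[s /=]|[s [s0 s1 ->]]].
  by rewrite in_itv /= => /andP[s0 s1] <-; exists s.
by exists s => //=; rewrite in_itv /= s0.
Qed.

Lemma closed_seg_mem (a b : R[i]) (s : R) : 0 <= s -> s <= 1 ->
  closed_seg a b (a + s%:C * (b - a)).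
Proof. by move=> s0 s1; exists s => //=; rewrite in_itv /= s0. Qed.

Lemma edge_coord_ends (a b mu : R[i]) (s : R) : a != b ->
  mu = a + s%:C * (b - a) ->
  edge_coord mu (b - a) a = - s /\ edge_coord mu (b - a) b = 1 - s.
Proof.
move=> ab ->; have d0 : b - a != 0 by rewrite subr_eq0 eq_sym.
rewrite /edge_coord; split.
  have -> : (a - (a + s%:C * (b - a))) / (b - a) = (- s)%:C.
    by rewrite rmorphN /=; field.
  by [].
have -> : (b - (a + s%:C * (b - a))) / (b - a) = (1 - s)%:C.
  by rewrite rmorphB rmorph1 /=; field.
by [].
Qed.

Lemma aff_segment (u v r : R) (a b : R[i]) (s : R) :
  aff u v r (a + s%:C * (b - a)) = (1 - s) * aff u v r a + s * aff u v r b.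
Proof. by rewrite /aff !ReImE /=; ring. Qed.

Lemma aff_segment_ends (u v r : R) (a b : R[i]) (s : R) : 0 < s -> s < 1 ->
  aff u v r (a + s%:C * (b - a)) = 0 -> aff u v r a <= 0 -> aff u v r b <= 0 ->
  aff u v r a = 0 /\ aff u v r b = 0.
Proof.
rewrite aff_segment => s0 s1 E fa fb.
have s1' : 0 < 1 - s by rewrite subr_gt0.
have h1 : (1 - s) * aff u v r a <= 0 by rewrite pmulr_rle0.
have h2 : s * aff u v r b <= 0 by rewrite pmulr_rle0.
have /eqP : (1 - s) * aff u v r a = 0 by lra.
have /eqP : s * aff u v r b = 0 by lra.
by rewrite !mulf_eq0 (gt_eqF s0) (gt_eqF s1') /= => /eqP -> /eqP ->.
Qed.

End Segments.

Theorem theorem1p1 (R : realType) (n : nat) (A : 'M[R[i]]_n)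
    (lam : n.-tuple R[i]) (mu1 : R[i]) :
  A \is normalmx ->
  char_poly A = \prod_(z <- lam) ('X - z%:P) ->
  ~ collinear [set` lam] ->
  counterclockwise lam (\tr A / n%:R) ->
  (forall i, ~ interior (numerical_range A : set R[i]^o) (tnth lam i)) ->
  numerical_range A mu1 ->
  conv_hull (compression_range A mu1) = region A lam mu1.
move=> Anormal Achar ncol [theta [th_arg th_le th_lt]] nint Wmu.
pose l := tnth lam.
have [U [UU UU' AE]] := spectral_decomposition Anormal Achar.
have WE : numerical_range A = hull l.
  by apply/seteqP; split=> z /(numerical_range_coord UU UU' AE).
have BE : compression_range A mu1 = compressions l mu1.
  by apply/seteqP; split=> z /(compression_range_coord UU UU' AE).
have R2v z k : rank2_numerical_range A z -> exists p, cbary l p z /\ p k = 0.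
  exact: rank2_vertex UU UU' AE z k.
have R2d z p q : cbary l p z -> cbary l q z -> (forall k, p k * q k = 0) ->
    rank2_numerical_range A z.
  exact: rank2_disjoint UU UU' AE z p q.
have spread u v r : (u != 0) || (v != 0) -> exists k, aff u v r (l k) != 0.
  move=> uv; apply: contrapT => /forallNP none; apply: ncol.
  apply: (collinear_aff (c := r) uv) => z /= /tnthP[k ->].
  by apply: contrapT => /eqP; exact: none.
have supported i : exists u v r, [/\ (u != 0) || (v != 0), aff u v r (l i) = 0
    & forall k, aff u v r (l k) <= 0].
  apply: support; first by exists (fun k => (k == i)%:R); exact: bary_vertex.
  by rewrite -WE; exact: nint.
have one_nz : ((1 : R) != 0) || ((0 : R) != 0) by rewrite oner_eq0.
have n0 : n%:R != 0 :> R[i].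
  rewrite pnatr_eq0; apply/eqP => n0; have [k _] := spread 1 0 0 one_nz.
  by have := leq_ltn_trans (leq0n k) (ltn_ord k); rewrite n0.
have center : \sum_k l k = n%:R * (\tr A / n%:R).
  rewrite mulrC divfK // AE -mulmxA mxtrace_mulC -mulmxA UU mulmx1.
  rewrite /mxtrace; apply: eq_bigr => k _; by rewrite !mxE eqxx.
have ord_moves (a : 'I_n) : a != ordS a.
  apply/eqP => aE.
  have all_a (k : 'I_n) : k = a by apply: (@ordS_ind _ (fun k => k = a) a) => // _ ->.
  have [k] := spread 1 0 (- complex.Re (l a)) one_nz.
  by rewrite (all_a k) /aff mul1r mul0r addr0 subrr eqxx.
(* An eigenvalue outside the rank-2 range is simple: the representation by another copy would have
   weight 0 at [i]. *)
have distinct (i j : 'I_n) : i != j -> ~ rank2_numerical_range A (l i) -> l i != l j.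
  move=> ij nR2i; apply/eqP => lij.
  have := rank2_avoid R2d nR2i (p := fun k => (k == j)%:R).
  rewrite {1}lij => /(_ (bary_vertex l j)) /eqP.
  by rewrite (negbTE ij) eq_sym oner_eq0.
have [p pmu] : hull l mu1 by rewrite -WE.
have edge_support i j (s : R) : 0 < s -> s < 1 -> mu1 = l i + s%:C * (l j - l i) ->
    closed_seg (l i) (l j) `<=` boundary (numerical_range A) ->
    exists u v r, [/\ (u != 0) || (v != 0), aff u v r mu1 = 0,
      forall k, aff u v r (l k) <= 0, aff u v r (l i) = 0 & aff u v r (l j) = 0].
  move=> s0 s1 muE bd.
  have [_ nint1] : boundary (numerical_range A) mu1.
    by apply: bd; rewrite muE; apply: closed_seg_mem; exact: ltW.
  have [u [v [r [uv fmu fle]]]] : exists u v r, [/\ (u != 0) || (v != 0),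
      aff u v r mu1 = 0 & forall k, aff u v r (l k) <= 0].
    by apply: support; [exists p|rewrite -WE].
  have [fi fj] : aff u v r (l i) = 0 /\ aff u v r (l j) = 0.
    by apply: (aff_segment_ends s0 s1) => //; rewrite -muE.
  by exists u, v, r.
(* Either [xget] returns a set prescribed by some case, and every case gives the right hull, or no
   case applies, which is refuted at the end. *)
rewrite /region BE; case: xgetP => [S _ HS|none].
  case: HS => [R2mu|i muE nR2|i j [_ nR2mu] seg ijc bd nR2i R2j
      |i [_ nR2mu] seg bd nR2i nR2j|[_ nmu]].
  - by rewrite WE; exact: (conv_compressions_rank2 R2v R2mu).
  - rewrite muE (conv_compressions_eigenvalue R2d nR2).
    rewrite -[[:: tnth lam i]]/(map (tnth lam) [:: i]) multiset_diff_vertices //.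
    by congr conv_hull; apply: eq_vertices => k; rewrite /= !inE.
  - have /open_segP[s [s0 s1 muE]] := seg.
    have lij : l i != l j by apply/eqP => lE; apply: nR2i; rewrite -/(l i) lE.
    have [u [v [r [uv fmu fle fi fj]]]] := edge_support i j s s0 s1 muE bd.
    have [ti tj] := edge_coord_ends lij muE.
    rewrite (conv_compressions_edge1 R2v R2d uv fmu fle fi fj _ _ nR2mu R2j).
    + rewrite -[[:: tnth lam i]]/(map (tnth lam) [:: i]) multiset_diff_vertices //.
      by congr conv_hull; apply: eq_vertices => k; rewrite /= !inE.
    + by rewrite ti oppr_lt0.
    + by rewrite tj subr_gt0.
  - have /open_segP[s [s0 s1 muE]] := seg.
    have ij := ord_moves i; have lij := distinct i (ordS i) ij nR2i.
    have [u [v [r [uv fmu fle fi fj]]]] := edge_support i (ordS i) s s0 s1 muE bd.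
    have [ti tj] := edge_coord_ends lij muE.
    have ti0 : edge_coord mu1 (l (ordS i) - l i) (l i) < 0 by rewrite ti oppr_lt0.
    have tj0 : 0 < edge_coord mu1 (l (ordS i) - l i) (l (ordS i)).
      by rewrite tj subr_gt0.
    have d0 : l (ordS i) - l i != 0 by rewrite subr_eq0 eq_sym.
    have fd : u * complex.Re (l (ordS i) - l i) + v * complex.Im (l (ordS i) - l i) = 0.
      by move: fi fj; rewrite /aff !ReImE; lra.
    rewrite (conv_compressions_edge2 uv fmu fle fi fj ti0 tj0).
      rewrite -[[:: _; _]]/(map (tnth lam) [:: i; ordS i]) multiset_diff_vertices.
        by congr conv_hull; apply: eq_vertices => k; rewrite /= !inE negb_or.
      by rewrite /= inE ij.
    move=> k fk; have [->|ki] := eqVneq k i; first by left.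
    have [->|kj] := eqVneq k (ordS i); first by right.
    have tki := edge_rank2_extreme R2d uv fmu fi fj ti0 tj0 nR2i fk ki.
    have tkj := edge_rank2_extreme' R2d uv fmu fi fj ti0 tj0 nR2j fk kj.
    set d := l (ordS i) - l i in ti tj ti0 tj0 d0 fd tki tkj.
    (* [lam k] would be strictly between two consecutive points of the edge, at relative position
       [a]; the ends have coordinates [- s] and [1 - s], at distance 1. *)
    exfalso; pose a := edge_coord mu1 d (l k) - edge_coord mu1 d (l i).
    apply: (@edge_successor_adjacent _ _ l _ theta th_arg th_le th_lt center
      spread supported u v r uv fle i k a fi fj lij).
    + by rewrite subr_gt0.
    + by move: tkj; rewrite /a ti tj; lra.
    + rewrite {1}(edge_coordK uv fmu d0 fd fk) {1}(edge_coordK uv fmu d0 fd fi).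
      by rewrite /a rmorphB /= -/d; ring.
  - apply: conv_compressions_interior => // u v r uv fmu.
    apply: contrapT => /forallNP none.
    have intmu : interior (hull l : set R[i]^o) mu1.
      apply: contrapT => nint1; apply: nmu; right; split.
        exact: subset_closure.
      by rewrite WE.
    have fle k : aff u v r (l k) <= 0 by rewrite leNgt; apply/negP; exact: none.
    have [u0 v0] := interior_no_support intmu fmu fle.
    by move: uv; rewrite u0 v0 eqxx.
(* If no case applies, [mu1] is neither interior nor an eigenvalue, so it is strictly between
   consecutive eigenvalues of an edge; the position of these ends with respect to the rank-2 range
   decides the case. *)
exfalso.
have nR2 : ~ rank2_numerical_range A mu1.
  by move=> R2mu; exact: none (RegionRank2 _ R2mu).
have nint1 : ~ interior (numerical_range A : set R[i]^o) mu1.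
  move=> intmu; apply: (none _ (RegionInterior _ _)).
  by split=> //; case=> [//|[_]]; exact.
have mul k : mu1 != l k.
  apply/eqP => muE; apply: (none _ (RegionEigenvalue muE _)).
  by rewrite -[tnth lam k]muE.
have [u [v [r [uv fmu fle]]]] : exists u v r, [/\ (u != 0) || (v != 0),
    aff u v r mu1 = 0 & forall k, aff u v r (l k) <= 0].
  by apply: support; [exists p|rewrite -WE].
have [a [s [fa fb s0 s1 muE]]] := edge_exists th_arg th_le th_lt center
  spread supported uv fle fmu pmu mul.
set b := ordS a in fb muE.
have lab : l a != l b.
  apply: contra (mul a) => /eqP lE; apply/eqP.
  transitivity (l a + s%:C * (l b - l a)); first exact: muE.
  by rewrite -lE subrr mulr0 addr0.
have bd i j : aff u v r (l i) = 0 -> aff u v r (l j) = 0 ->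
    closed_seg (l i) (l j) `<=` boundary (numerical_range A).
  move=> fi fj z [t /= t01 <-]; move: t01; rewrite in_itv /= => /andP[t0 t1].
  rewrite WE; split; first by apply: subset_closure; exact: hull_segment.
  move=> intz; have fz : aff u v r (l i + t%:C * (l j - l i)) = 0.
    by rewrite aff_segment fi fj; ring.
  have [u0 v0] := interior_no_support intz fz fle.
  by move: uv; rewrite u0 v0 eqxx.
have Wmu' : (numerical_range A `\` rank2_numerical_range A) mu1 by split.
have seg : open_seg (l a) (l b) mu1 by apply/open_segP; exists s.
have seg' : open_seg (l b) (l a) mu1.
  apply/open_segP; exists (1 - s); split; first by rewrite subr_gt0.
    by rewrite ltrBlDr ltrDl.
  transitivity (l a + s%:C * (l b - l a)); first exact: muE.
  by rewrite rmorphB rmorph1; ring.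
(* Both ends cannot be in the rank-2 range. If only [l a] is, the edge is read backwards, from [b]
   to its predecessor [a]. *)
have [R2a|nR2a] := pselect (rank2_numerical_range A (l a)).
  have [R2b|nR2b] := pselect (rank2_numerical_range A (l b)).
    have [ti tj] := edge_coord_ends lab muE.
    apply: (edge_rank2_ends R2v R2d uv fmu fle fa fb _ _ nR2 R2a R2b).
      by rewrite ti oppr_lt0.
    by rewrite tj subr_gt0.
  apply: (none _ (RegionEdge1 Wmu' seg' _ (bd b a fb fa) nR2b R2a)).
  by right; rewrite ordSK.
have [R2b|nR2b] := pselect (rank2_numerical_range A (l b)).
  by apply: (none _ (RegionEdge1 Wmu' seg _ (bd a b fa fb) nR2a R2b)); left.
exact: (none _ (RegionEdge2 Wmu' seg (bd a b fa fb) nR2a nR2b)).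
Qed.
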